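(* Let $(M,g,I,J,K)$ be a hyperkähler manifold of real dimension $4n$, and for $(\alpha,\beta)\in\mathbb{CP}^1\times\mathbb{CP}^1$ let $\mathcal{J}_{\alpha,\beta}$ be the associated generalized complex structure on $M$. On the smooth manifold $\mathcal{X}=M\times\mathbb{CP}^1\times\mathbb{CP}^1$ define the generalized almost complex structure whose value at $(m,\alpha,\beta)$ is $$\mathcal{J}:=\mathcal{J}_{\alpha,\beta}|_m\times\mathcal{J}_{I_{\mathbb{CP}^1}}\times\mathcal{J}_{I_{\mathbb{CP}^1}},$$ acting block-diagonally on $E_{\mathcal{X}}=E_M\oplus E_{\mathbb{CP}^1}\oplus E_{\mathbb{CP}^1}$, where $I_{\mathbb{CP}^1}$ is the standard complex structure on $\mathbb{CP}^1$. Then $\mathcal{J}$ is integrable, and thus $\mathcal{X}$ is a generalized complex manifold.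
   Context: Generalized geometry. For a smooth manifold $N$ let $E_N=TN\oplus T^*N$ with inner product $\langle X+\xi,Y+\eta\rangle=\frac12(\xi(Y)+\eta(X))$ and bracket $[X+\xi,Y+\eta]=[X,Y]+\mathcal{L}_X\eta-\iota_Yd\xi$. A generalized almost complex structure is an endomorphism $\mathcal{J}$ of $E_N$, orthogonal for $\langle\,,\rangle$, with $\mathcal{J}^2=-1$. It is integrable (a generalized complex structure) if its $+i$-eigenbundle $L\subset E_N\otimes\mathbb{C}$ satisfies $[L,L]\subset L$. For an almost complex structure $I$, $\mathcal{J}_I=\begin{pmatrix}-I&0\\0&I^*\end{pmatrix}$, where $I^*\xi=\xi\circ I$. Hyperkähler notation. $g$ is a Riemannian metric that is Kähler with respect to complex structures $I,J,K$ with $IJ=K=-JI$, $JK=I=-KJ$, $KI=J=-IK$. For a $g$-compatible complex structure $A$, $\omega_A=g(A\cdot,\cdot)$ is its Kähler form, also regarded as a map $TM\to T^*M$, $X\mapsto\iota_X\omega_A$. For $\eta\in\mathbb{CP}^1=\mathbb{C}\cup\{\infty\}$, $$I_\eta=\tfrac{1-|\eta|^2}{1+|\eta|^2}I+\tfrac{2\mathrm{Re}\,\eta}{1+|\eta|^2}J+\tfrac{2\mathrm{Im}\,\eta}{1+|\eta|^2}K,\qquad I_\infty=-I,$$ with Kähler form $\omega_\eta$. Define $$\mathcal{J}_{\alpha,\beta}=\frac12\begin{pmatrix}-(I_\alpha+I_\beta)&-(\omega_\alpha^{-1}-\omega_\beta^{-1})\\ \omega_\alpha-\omega_\beta&I_\alpha^*+I_\beta^*\end{pmatrix};$$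 for each fixed $(\alpha,\beta)$ this is a generalized complex structure on $M$. *)

(* Defs.v *)
From HB Require Import structures.
From mathcomp Require Import all_boot all_order all_algebra.
From mathcomp Require Import all_classical all_reals all_analysis.
From mathcomp Require Import complex.

Set Implicit Arguments.
Unset Strict Implicit.
Unset Printing Implicit Defensive.

Import Order.TTheory GRing.Theory Num.Theory numFieldNormedType.Exports.
Local Open Scope classical_set_scope.
Local Open Scope ring_scope.

(* Points of R^d, tangent vectors and covectors are
   column vectors; the covector xi sends X to xi^T *m X.  An element X + xi of
   the generalized tangent space is col_mx X xi : 'cV_(d + d). *)

Section LocalCalculus.
Variable R : realType.
Implicit Types d p q : nat.

Definition pd d (a : 'I_d) (f : 'cV[R]_d -> R) (x : 'cV[R]_d) : R :=
  'D_(delta_mx a 0) f x.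

Fixpoint Ck d (k : nat) (U : set 'cV[R]_d) (f : 'cV[R]_d -> R) : Prop :=
  if k is k'.+1 then
    [/\ forall x, U x -> {for x, continuous f},
        forall a x, U x -> derivable f x (delta_mx a 0)
      & forall a, Ck k' U (pd a f)]
  else forall x, U x -> {for x, continuous f}.

Definition smooth_on d p q (U : set 'cV[R]_d) (F : 'cV[R]_d -> 'M[R]_(p, q)) :=
  forall k i j, Ck k U (fun x => F x i j).

Definition lie_bracket d (X Y : 'cV[R]_d -> 'cV[R]_d) (x : 'cV[R]_d) : 'cV[R]_d :=
  \col_k \sum_a (X x a 0 * pd a (fun y => Y y k 0) x
               - Y x a 0 * pd a (fun y => X y k 0) x).

Definition lie_derivative d (X eta : 'cV[R]_d -> 'cV[R]_d) (x : 'cV[R]_d) :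
    'cV[R]_d :=
  \col_k \sum_a (X x a 0 * pd a (fun y => eta y k 0) x
               + eta x a 0 * pd k (fun y => X y a 0) x).

(* A 2-form w is the matrix of its components w(e_a, e_b). *)
Definition ext_deriv1 d (xi : 'cV[R]_d -> 'cV[R]_d) (x : 'cV[R]_d) : 'M[R]_d :=
  \matrix_(a, b) (pd a (fun y => xi y b 0) x - pd b (fun y => xi y a 0) x).

Definition ext_deriv2 d (w : 'cV[R]_d -> 'M[R]_d) (x : 'cV[R]_d)
    (a b c : 'I_d) : R :=
  pd a (fun y => w y b c) x + pd b (fun y => w y c a) x
  + pd c (fun y => w y a b) x.

Definition interior d (Y : 'cV[R]_d) (w : 'M[R]_d) : 'cV[R]_d := w^T *m Y.

Definition courant d (u v : 'cV[R]_d -> 'cV[R]_(d + d)) (x : 'cV[R]_d) :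
    'cV[R]_(d + d) :=
  let X y := usubmx (u y) in let xi y := dsubmx (u y) in
  let Y y := usubmx (v y) in let eta y := dsubmx (v y) in
  col_mx (lie_bracket X Y x)
         (lie_derivative X eta x - interior (Y x) (ext_deriv1 xi x)).

Definition pairing d (u v : 'cV[R]_(d + d)) : R :=
  2^-1 * ((dsubmx u)^T *m usubmx v + (dsubmx v)^T *m usubmx u) 0 0.

Definition mxRe p q (A : 'M[R[i]]_(p, q)) : 'M[R]_(p, q) :=
  map_mx (@complex.Re R) A.
Definition mxIm p q (A : 'M[R[i]]_(p, q)) : 'M[R]_(p, q) :=
  map_mx (@complex.Im R) A.
Definition mxC p q (A B : 'M[R]_(p, q)) : 'M[R[i]]_(p, q) :=
  \matrix_(i, j) (A i j +i* B i j)%C.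

Definition smoothC_on d p q (U : set 'cV[R]_d)
    (F : 'cV[R]_d -> 'M[R[i]]_(p, q)) :=
  smooth_on U (fun x => mxRe (F x)) /\ smooth_on U (fun x => mxIm (F x)).

(* C-bilinear extension of the bracket to sections of E (x) C. *)
Definition courantC d (u v : 'cV[R]_d -> 'cV[R[i]]_(d + d)) (x : 'cV[R]_d) :
    'cV[R[i]]_(d + d) :=
  let u1 y := mxRe (u y) in let u2 y := mxIm (u y) in
  let v1 y := mxRe (v y) in let v2 y := mxIm (v y) in
  mxC (courant u1 v1 x - courant u2 v2 x) (courant u1 v2 x + courant u2 v1 x).

End LocalCalculus.

Section Manifolds.
Variable R : realType.

Record atlas (M : topologicalType) (d : nat) := Atlas {
  idx : Type;
  dom : idx -> set M;
  phi : idx -> M -> 'cV[R]_d;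
  psi : idx -> 'cV[R]_d -> M
}.

Definition codom_chart (M : topologicalType) d (A : atlas M d) (i : idx A) :
  set 'cV[R]_d := phi i @` dom i.

Record smooth_manifold (M : topologicalType) d (A : atlas M d) : Prop := {
  man_hausdorff : hausdorff_space M;
  man_second_countable : @second_countable M;
  man_cover : forall p : M, exists i : idx A, dom i p;
  man_open_dom : forall i : idx A, open (dom i);
  man_open_codom : forall i : idx A, open (codom_chart i);
  man_phiK : forall (i : idx A) p, dom i p -> psi i (phi i p) = p;
  man_phi_cont : forall (i : idx A) p, dom i p -> {for p, continuous (phi i)};
  man_psi_cont : forall (i : idx A) x,
    codom_chart i x -> {for x, continuous (psi i)};
  man_smooth : forall i j : idx A,
    smooth_on (phi i @` (dom i `&` dom j)) (fun x => phi j (psi i x))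
}.

(* A tensor field with square-matrix components is given by its components
   T i p in the chart i at the point p; T i p is only meaningful for p in
   dom i, and the components in two charts are related by the tensor
   transformation rules below. *)
Definition tensor (M : topologicalType) d (A : atlas M d) (k : nat) : Type :=
  idx A -> M -> 'M[R]_k.

Definition in_chart (M : topologicalType) d (A : atlas M d) k (T : tensor A k)
  (i : idx A) : 'cV[R]_d -> 'M[R]_k := fun x => T i (psi i x).

Definition smooth_tensor (M : topologicalType) d (A : atlas M d) k
  (T : tensor A k) : Prop :=
  forall i, smooth_on (codom_chart i) (in_chart T i).

Definition jac (M : topologicalType) d (A : atlas M d) (i j : idx A) (p : M) :
    'M[R]_d :=
  \matrix_(a, b) pd b (fun x => phi j (psi i x) a 0) (phi i p).

Definition bilinear_tensor (M : topologicalType) d (A : atlas M d)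
  (g : tensor A d) : Prop :=
  forall i j p, dom i p -> dom j p ->
    g i p = (jac i j p)^T *m g j p *m jac i j p.

Definition endo_tensor (M : topologicalType) d (A : atlas M d)
  (I : tensor A d) : Prop :=
  forall i j p, dom i p -> dom j p -> jac i j p *m I i p = I j p *m jac i j p.

(* Change of coordinates on T + T^*: vectors transform by the Jacobian,
   covectors by its inverse transpose. *)
Definition gen_jac (M : topologicalType) d (A : atlas M d) (i j : idx A)
    (p : M) : 'M[R]_(d + d) :=
  block_mx (jac i j p) 0 0 (invmx (jac i j p))^T.

Definition gen_endo_tensor (M : topologicalType) d (A : atlas M d)
  (J : tensor A (d + d)) : Prop :=
  forall i j p, dom i p -> dom j p ->
    gen_jac i j p *m J i p = J j p *m gen_jac i j p.

Record gen_almost_complex (M : topologicalType) d (A : atlas M d)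
    (J : tensor A (d + d)) : Prop := {
  gac_tensor : gen_endo_tensor J;
  gac_smooth : smooth_tensor J;
  gac_orth : forall i p, dom i p ->
    forall u v, pairing (J i p *m u) (J i p *m v) = pairing u v;
  gac_sq : forall i p, dom i p -> J i p *m J i p = - 1%:M
}.

Definition sectionL (M : topologicalType) d (A : atlas M d)
    (J : tensor A (d + d)) (i : idx A) (U : set 'cV[R]_d)
    (u : 'cV[R]_d -> 'cV[R[i]]_(d + d)) : Prop :=
  forall x, U x ->
    map_mx (real_complex R) (in_chart J i x) *m u x = 'i%C *: u x.

(* [L, L] is contained in L, for the sheaf of smooth local sections of L. *)
Definition integrable (M : topologicalType) d (A : atlas M d)
  (J : tensor A (d + d)) : Prop :=
  forall (i : idx A) (U : set 'cV[R]_d), open U -> U `<=` codom_chart i ->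
  forall u v : 'cV[R]_d -> 'cV[R[i]]_(d + d),
    smoothC_on U u -> smoothC_on U v ->
    sectionL J i U u -> sectionL J i U v -> sectionL J i U (courantC u v).

Record gen_complex_manifold (M : topologicalType) d (A : atlas M d)
    (J : tensor A (d + d)) : Prop := {
  gcm_manifold : smooth_manifold A;
  gcm_almost : gen_almost_complex J;
  gcm_integrable : integrable J
}.

End Manifolds.

Section Hyperkahler.
Variable R : realType.

Record riemannian (M : topologicalType) d (A : atlas R M d) (g : tensor A d) :
    Prop := {
  riem_tensor : bilinear_tensor g;
  riem_smooth : smooth_tensor g;
  riem_sym : forall i p, dom i p -> (g i p)^T = g i p;
  riem_pos : forall i p, dom i p ->
    forall v : 'cV[R]_d, v != 0 -> 0 < (v^T *m g i p *m v) 0 0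
}.

(* A complex structure is an almost complex structure I whose Nijenhuis tensor
   [IX, IY] - I[IX, Y] - I[X, IY] - [X, Y] vanishes. *)
Record complex_structure (M : topologicalType) d (A : atlas R M d)
    (I : tensor A d) : Prop := {
  cs_tensor : endo_tensor I;
  cs_smooth : smooth_tensor I;
  cs_sq : forall i p, dom i p -> I i p *m I i p = - 1%:M;
  cs_nijenhuis : forall (i : idx A) (U : set 'cV[R]_d),
    open U -> U `<=` codom_chart i ->
    forall X Y : 'cV[R]_d -> 'cV[R]_d, smooth_on U X -> smooth_on U Y ->
    forall x, U x ->
      let Ix := in_chart I i in
      let IX y := Ix y *m X y in let IY y := Ix y *m Y y in
      lie_bracket IX IY x - Ix x *m lie_bracket IX Y x
        - Ix x *m lie_bracket X IY x - lie_bracket X Y x = 0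
}.

(* omega_I(X, Y) = g(I X, Y), as the matrix of its components; the map
   X |-> interior X omega_I is then multiplication by (kahler_form g I)^T. *)
Definition kahler_form d (g I : 'M[R]_d) : 'M[R]_d := I^T *m g.

Definition kahler_map d (g I : 'M[R]_d) : 'M[R]_d := (kahler_form g I)^T.

Record kahler (M : topologicalType) d (A : atlas R M d) (g I : tensor A d) :
    Prop := {
  kahler_complex : complex_structure I;
  kahler_compat : forall i p, dom i p -> (I i p)^T *m g i p *m I i p = g i p;
  kahler_closed : forall (i : idx A) x, codom_chart i x -> forall a b c,
    ext_deriv2 (fun y => kahler_form (in_chart g i y) (in_chart I i y)) x a b c
    = 0
}.

Record hyperkahler (M : topologicalType) d (A : atlas R M d)
    (g I J K : tensor A d) : Prop := {
  hk_riemannian : riemannian g;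
  hk_I : kahler g I;
  hk_J : kahler g J;
  hk_K : kahler g K;
  hk_quaternion : forall i p, dom i p ->
    [/\ I i p *m J i p = K i p, J i p *m I i p = - K i p
      & J i p *m K i p = I i p] /\
    [/\ K i p *m J i p = - I i p, K i p *m I i p = J i p
      & I i p *m K i p = - J i p]
}.

(* CP^1 = C with a point (None) at infinity; R[i]^o carries the norm topology
   of the complex numbers. *)
Definition CP1 : topologicalType := one_point_compactification R[i]^o.

Definition cvec (z : R[i]) : 'cV[R]_2 :=
  \col_(a < 2) (if a == 0 then complex.Re z else complex.Im z).
Definition vecc (x : 'cV[R]_2) : R[i] := (x 0 0 +i* x 1 0)%C.

(* The two holomorphic charts: false is the coordinate eta on C, true is the
   coordinate 1 / eta on the complement of 0, extended by 0 at infinity (note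
   that 0^-1 = 0). *)
Definition CP1_atlas : atlas R CP1 2 := @Atlas R CP1 2 bool
  (fun b => [set eta : option R[i] |
               if b then eta <> Some 0 else eta <> None])
  (fun b (eta : option R[i]) =>
     if eta is Some z then cvec (if b then z^-1 else z) else 0)
  (fun b x => if b && (x == 0) then None
              else Some (if b then (vecc x)^-1 else vecc x)).

(* Multiplication by the imaginary unit in either holomorphic coordinate. *)
Definition I_CP1 : tensor CP1_atlas 2 :=
  fun _ _ => delta_mx 1 0 - delta_mx 0 1.

Definition I_at d (I J K : 'M[R]_d) (eta : CP1) : 'M[R]_d :=
  match (eta : option R[i]) with
  | None => - I
  | Some z =>
      let q := complex.Re z ^+ 2 + complex.Im z ^+ 2 in
      ((1 - q) / (1 + q)) *: I + (2 * complex.Re z / (1 + q)) *: J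
        + (2 * complex.Im z / (1 + q)) *: K
  end.

Definition J_of_complex d (I : 'M[R]_d) : 'M[R]_(d + d) :=
  block_mx (- I) 0 0 I^T.

Definition J_alpha_beta d (g I J K : 'M[R]_d) (alpha beta : CP1) :
    'M[R]_(d + d) :=
  let Ia := I_at I J K alpha in let Ib := I_at I J K beta in
  let wa := kahler_map g Ia in let wb := kahler_map g Ib in
  2^-1 *: block_mx (- (Ia + Ib)) (- (invmx wa - invmx wb))
                   (wa - wb) (Ia^T + Ib^T).

Definition prod_atlas (M N : topologicalType) d e (A : atlas R M d)
    (B : atlas R N e) : atlas R (M * N)%type (d + e) := 
  @Atlas R (M * N)%type (d + e) (idx A * idx B)%type
    (fun i => dom i.1 `*` dom i.2)
    (fun i p => col_mx (phi i.1 p.1) (phi i.2 p.2))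
    (fun i x => (psi i.1 (usubmx x), psi i.2 (dsubmx x))).

(* The endomorphism S x T of E_(M x N) = E_M + E_N; the blocks are reordered as
   (TM + TN) + (T^*M + T^*N). *)
Definition gen_prod d e (S : 'M[R]_(d + d)) (T : 'M[R]_(e + e)) :
    'M[R]_((d + e) + (d + e)) :=
  block_mx (block_mx (ulsubmx S) 0 0 (ulsubmx T))
           (block_mx (ursubmx S) 0 0 (ursubmx T))
           (block_mx (dlsubmx S) 0 0 (dlsubmx T))
           (block_mx (drsubmx S) 0 0 (drsubmx T)).

Definition X_atlas (M : topologicalType) d (A : atlas R M d) :
    atlas R (M * CP1 * CP1)%type (d + 2 + 2) :=
  prod_atlas (prod_atlas A CP1_atlas) CP1_atlas.

Definition J_X (M : topologicalType) d (A : atlas R M d)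
    (g I J K : tensor A d) : tensor (X_atlas A) (d + 2 + 2 + (d + 2 + 2)) :=
  fun (i : idx A * bool * bool) p =>
    let: (i0, i1, i2) := i in
    let: (m, alpha, beta) := p in
    gen_prod
      (gen_prod
        (J_alpha_beta (g i0 m) (I i0 m) (J i0 m) (K i0 m) alpha beta)
        (J_of_complex (I_CP1 i1 alpha)))
      (J_of_complex (I_CP1 i2 beta)).

End Hyperkahler.

(* Main.v *)
(* Let L be the +i-eigenbundle of J and pr the projection of E (x) C to the
   complexified tangent bundle.  The Courant bracket may be computed with any
   torsion-free connection nabla in place of the partial derivatives; since L is
   isotropic and equal to its orthogonal, it is involutive as soon as
   (nabla_(pr z) J) w = 0 for all w, z in L.  Take for nabla the Levi-Civita
   connection of g plus the flat connections of the charts of CP^1.  Along M,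
   nabla J = 0, because I, J, K are parallel.  Along the first factor CP^1, pr z is
   of type (0, 1), the derivative of J only involves that of I_alpha, and it only
   sees the component p of w in the bundle T^(0,1) of I_alpha.  This bundle
   is spanned by the vectors v + i alpha J v with v in T^(0,1) of I, so it depends
   holomorphically on alpha; applying d/d(conj alpha) to I_alpha p = - i p
   for such holomorphic p shows that d I_alpha / d(conj alpha) kills p.  The second
   factor is similar. *)

Require Import Defs.
From mathcomp Require Import all_boot all_order all_algebra.
From mathcomp Require Import all_classical all_reals all_analysis.
From mathcomp Require Import complex ring lra.

Set Implicit Arguments.
Unset Strict Implicit.
Unset Printing Implicit Defensive.

Import Order.TTheory GRing.Theory Num.Theory numFieldNormedType.Exports.
Local Open Scope classical_set_scope.
Local Open Scope ring_scope.

(** * Smooth functions on open subsets of R^d *)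

(** A Kähler structure is given here by an integrable I with closed omega_I, so the parallelism of
    I, J, K has to be derived; this is linear algebra on the 1-jets of g and I at one point. The
    condition (nabla_(pr z) J) w = 0 holds only after contraction with pr z: along a sphere a single
    coordinate derivative of J does not in general kill w, so the criterion keeps the sum over
    directions. J_(alpha, beta) contains inverse Kähler forms, but omega_alpha^-1 = - I_alpha g^-1
    makes it linear in the pair (I_alpha, I_beta). Hence its M-block is a combination of six fields
    that are parallel on M, with coefficients that depend on the spheres alone; these are
    stereographic coordinates, and one formula with a sign serves both charts of CP^1. Partial
    derivatives are available for real functions only: the eigen-equation of a section of L is split
    into real and imaginary parts, differentiated, and reassembled into complex 1-jets. From there
    on the bracket is algebra over an arbitrary field with a square root of -1. *)

Section Smooth.
Variable R : realType.
Implicit Types d p q r : nat.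

Lemma pd_eq_on d (U : set 'cV[R]_d) (f g : 'cV[R]_d -> R) a x :
  open U -> U x -> (forall y, U y -> f y = g y) -> pd a f x = pd a g x.
Proof.
move=> oU Ux fg; apply: near_eq_derive.
by near=> y; apply: fg; near: y; exact: open_nbhs_nbhs.
Unshelve. all: by end_near. Qed.

Lemma derivable_eq_on d (U : set 'cV[R]_d) (f g : 'cV[R]_d -> R) v x :
  open U -> U x -> (forall y, U y -> f y = g y) ->
  derivable f x v -> derivable g x v.
Proof.
move=> oU Ux fg; apply: near_eq_derivable.
by near=> y; apply: fg; near: y; exact: open_nbhs_nbhs.
Unshelve. all: by end_near. Qed.

Lemma continuous_eq_on (T S : topologicalType) (U : set T) (f g : T -> S) x :
  open U -> U x -> (forall y, U y -> f y = g y) ->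
  {for x, continuous f} -> {for x, continuous g}.
Proof.
move=> oU Ux fg cf; rewrite /prop_for /continuous_at -(fg _ Ux).
apply: cvg_trans cf; apply: near_eq_cvg.
by near=> y; apply: fg; near: y; exact: open_nbhs_nbhs.
Unshelve. all: by end_near. Qed.

Section PartialDerivatives.
Variables (d : nat) (a : 'I_d) (x : 'cV[R]_d).
Implicit Types f g : 'cV[R]_d -> R.
Let dv f := derivable f x (delta_mx a 0).

Lemma pd_cst c : pd a (fun=> c : R) x = 0.
Proof. exact: derive_cst. Qed.

Lemma pdD f g : dv f -> dv g ->
  pd a (fun y => f y + g y) x = pd a f x + pd a g x.
Proof. by move=> df dg; exact: deriveD. Qed.

Lemma pdB f g : dv f -> dv g ->
  pd a (fun y => f y - g y) x = pd a f x - pd a g x.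
Proof. by move=> df dg; exact: deriveB. Qed.

Lemma pdN f : dv f -> pd a (fun y => - f y) x = - pd a f x.
Proof. by move=> df; exact: deriveN. Qed.

Lemma pdM f g : dv f -> dv g ->
  pd a (fun y => f y * g y) x = pd a f x * g x + f x * pd a g x.
Proof.
move=> df dg; rewrite addrC [_ * g x]mulrC.
by etransitivity; first exact: deriveM.
Qed.

Lemma pdV f : f x != 0 -> dv f ->
  pd a (fun y => (f y)^-1) x = - (pd a f x / f x ^+ 2).
Proof.
move=> f0 df; etransitivity; first exact: deriveV.
by rewrite scaleNr /GRing.scale /= mulrC.
Qed.

Lemma pd_sum n (F : 'I_n -> 'cV[R]_d -> R) : (forall i, dv (F i)) ->
  pd a (fun y => \sum_i F i y) x = \sum_i pd a (F i) x.
Proof.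
move=> dF; rewrite /pd -(derive_sum dF); congr (derive _ _ _).
by apply/funext => y; rewrite fct_sumE.
Qed.

Lemma pd_coord b : is_derive x (delta_mx a 0) (fun y : 'cV[R]_d => y b 0) (a == b)%:R.
Proof.
suff cv : (fun h => h^-1 *: (((fun y : 'cV[R]_d => y b 0) \o shift x)
    (h *: delta_mx a 0) - x b 0)) @ 0^' --> ((a == b)%:R : R).
  by apply: DeriveDef; [exact: cvgP cv|exact: cvg_lim cv].
have cc : (fun=> (a == b)%:R : R) @ (0 : R)^' --> ((a == b)%:R : R) by exact: cvg_cst.
apply: cvg_trans cc.
apply: near_eq_cvg; near=> h; rewrite /= !mxE eqxx andbT eq_sym addrK.
by rewrite /GRing.scale /= mulKf //; near: h; exact: nbhs_dnbhs_neq.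
Unshelve. all: by end_near. Qed.
End PartialDerivatives.

Section Ck.
Variables (d : nat) (U : set 'cV[R]_d).
Hypothesis oU : open U.
Implicit Types f g : 'cV[R]_d -> R.

Lemma Ck_pred k f : Ck k.+1 U f -> Ck k U f.
Proof.
elim: k f => [|k IH] f; first by case.
by case=> cf df pf; split=> // a; apply: IH; exact: pf.
Qed.

Lemma eq_Ck k f g : (forall x, U x -> f x = g x) -> Ck k U f -> Ck k U g.
Proof.
elim: k f g => [|k IH] f g fg.
  by move=> cf x Ux; apply: continuous_eq_on fg _ => //; exact: cf.
case=> cf df pf; split.
- by move=> x Ux; apply: continuous_eq_on fg _ => //; exact: cf.
- by move=> a x Ux; apply: derivable_eq_on fg _ => //; exact: df.
- by move=> a; apply: IH (pf a) => x Ux; exact: pd_eq_on fg.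
Qed.

Lemma Ck_cst k c : Ck k U (fun=> c).
Proof.
elim: k c => [|k IH] c; first by move=> x _; exact: cst_continuous.
split=> [x _|a x _|a]; first exact: cst_continuous.
  exact: derivable_cst.
by apply: eq_Ck (IH 0) => x _; rewrite pd_cst.
Qed.

Lemma Ck_add k f g : Ck k U f -> Ck k U g -> Ck k U (fun x => f x + g x).
Proof.
elim: k f g => [|k IH] f g.
  by move=> cf cg x Ux; apply: continuousD; [exact: cf|exact: cg].
move=> [cf df pf] [cg dg pg]; split.
- by move=> x Ux; apply: continuousD; [exact: cf|exact: cg].
- by move=> a x Ux; apply: derivableD; [exact: df|exact: dg].
- move=> a; apply: eq_Ck (IH _ _ (pf a) (pg a)) => x Ux.
  by rewrite pdD; [|exact: df|exact: dg].
Qed.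

Lemma Ck_mul k f g : Ck k U f -> Ck k U g -> Ck k U (fun x => f x * g x).
Proof.
elim: k f g => [|k IH] f g.
  by move=> cf cg x Ux; apply: continuousM; [exact: cf|exact: cg].
(* The Leibniz rule pairs a derivative of one factor with the other factor itself, so both factors
   are also needed at order k. *)
move=> fk gk; have f' := Ck_pred fk; have g' := Ck_pred gk.
move: fk gk => [cf df pf] [cg dg pg]; split.
- by move=> x Ux; apply: continuousM; [exact: cf|exact: cg].
- by move=> a x Ux; apply: derivableM; [exact: df|exact: dg].
- move=> a; apply: eq_Ck (Ck_add (IH _ _ f' (pg a)) (IH _ _ g' (pf a))) => x Ux.
  by rewrite pdM 1?addrC 1?[_ * g x]mulrC; [|exact: df|exact: dg].
Qed.

Lemma Ck_opp k f : Ck k U f -> Ck k U (fun x => - f x).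
Proof.
move=> /(Ck_mul (Ck_cst k (-1))); apply: eq_Ck => x _.
by rewrite mulN1r.
Qed.

Lemma Ck_inv k f : (forall x, U x -> f x != 0) ->
  Ck k U f -> Ck k U (fun x => (f x)^-1).
Proof.
move=> f0; elim: k => [|k IH].
  by move=> cf x Ux; apply: continuousV; [exact: f0|exact: cf].
move=> fk; have f' := IH (Ck_pred fk); case: fk => cf df pf; split.
- by move=> x Ux; apply: continuousV; [exact: f0|exact: cf].
- by move=> a x Ux; apply: derivableV; [exact: f0|exact: df].
- move=> a; apply: eq_Ck (Ck_opp (Ck_mul (Ck_mul f' f') (pf a))) => x Ux.
  rewrite pdV; [|exact: f0|exact: df].
  by rewrite expr2 invfM mulrC.
Qed.

Lemma Ck_sum k (I : Type) (s : seq I) (P : pred I) (F : I -> 'cV[R]_d -> R) :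
  (forall i, P i -> Ck k U (F i)) -> Ck k U (fun x => \sum_(i <- s | P i) F i x).
Proof.
move=> HF; elim: s => [|i s IH].
  by apply: eq_Ck (Ck_cst k 0) => x _; rewrite big_nil.
case Pi : (P i).
  by apply: eq_Ck (Ck_add (HF _ Pi) IH) => x _; rewrite big_cons Pi.
by apply: eq_Ck IH => x _; rewrite big_cons Pi.
Qed.

Lemma Ck_prod k (I : Type) (s : seq I) (P : pred I) (F : I -> 'cV[R]_d -> R) :
  (forall i, P i -> Ck k U (F i)) -> Ck k U (fun x => \prod_(i <- s | P i) F i x).
Proof.
move=> HF; elim: s => [|i s IH].
  by apply: eq_Ck (Ck_cst k 1) => x _; rewrite big_nil.
case Pi : (P i).
  by apply: eq_Ck (Ck_mul (HF _ Pi) IH) => x _; rewrite big_cons Pi.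
by apply: eq_Ck IH => x _; rewrite big_cons Pi.
Qed.

Lemma Ck_coord k (b : 'I_d) : Ck k U (fun x => x b 0).
Proof.
have cc : continuous (fun x : 'cV[R]_d => x b 0) by exact: coord_continuous.
case: k => [|k]; first by move=> x _; exact: cc.
split=> [x _|a x _|a]; first exact: cc.
  by have [] := pd_coord a x b.
by apply: eq_Ck (Ck_cst k (a == b)%:R) => x _; have [_ <-] := pd_coord a x b.
Qed.

End Ck.

Lemma sub_Ck d k (U V : set 'cV[R]_d) f : V `<=` U -> Ck k U f -> Ck k V f.
Proof.
move=> VU; elim: k f => [|k IH] f /=; first by move=> cf x /VU; exact: cf.
by case=> cf df pf; split=> [x /VU|a x /VU|a]; [exact: cf|exact: df|exact: IH].
Qed.
End Smooth.

(** * Smooth matrix-valued maps, and their pullback along coordinate projections *)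

Section SmoothMatrix.
Variable R : realType.
Implicit Types d p q r : nat.

Lemma continuous_matrix (T : topologicalType) p q (f : T -> 'M[R]_(p, q)) x :
  (forall i j, {for x, continuous (fun y => f y i j)}) -> {for x, continuous f}.
Proof.
move=> cf A /= [P nP sPA]; rewrite /nbhs /=.
suff : nbhs x (fun y => forall i j, P i j (f y i j)) by apply: filterS => y /sPA.
by apply: filter_forall => i; apply: filter_forall => j; apply: cf; exact: nP.
Qed.

Section Operations.
Variables (d : nat) (U : set 'cV[R]_d).
Hypothesis oU : open U.

Lemma eq_smooth_on p q (F G : 'cV[R]_d -> 'M[R]_(p, q)) :
  (forall x, U x -> F x = G x) -> smooth_on U F -> smooth_on U G.
Proof.
by move=> FG sF k i j; apply: (eq_Ck oU _ (sF k i j)) => x Ux; rewrite FG.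
Qed.

Lemma smooth_cst p q (C : 'M[R]_(p, q)) : smooth_on U (fun=> C).
Proof. by move=> k i j; exact: Ck_cst. Qed.

Lemma smooth_id : smooth_on U id.
Proof. by move=> k i j; rewrite ord1; exact: Ck_coord. Qed.

Lemma smooth_opp p q (F : 'cV[R]_d -> 'M[R]_(p, q)) :
  smooth_on U F -> smooth_on U (fun x => - F x).
Proof.
by move=> sF k i j; apply: (eq_Ck oU _ (Ck_opp oU (sF k i j))) => x _; rewrite mxE.
Qed.

Lemma smooth_add p q (F G : 'cV[R]_d -> 'M[R]_(p, q)) :
  smooth_on U F -> smooth_on U G -> smooth_on U (fun x => F x + G x).
Proof.
move=> sF sG k i j.
by apply: (eq_Ck oU _ (Ck_add oU (sF k i j) (sG k i j))) => x _; rewrite mxE.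
Qed.

Lemma smooth_scale p q c (F : 'cV[R]_d -> 'M[R]_(p, q)) :
  (forall k, Ck k U c) -> smooth_on U F -> smooth_on U (fun x => c x *: F x).
Proof.
move=> sc sF k i j.
by apply: (eq_Ck oU _ (Ck_mul oU (sc k) (sF k i j))) => x _; rewrite mxE.
Qed.

Lemma smooth_mul p q r (F : 'cV[R]_d -> 'M[R]_(p, q))
    (G : 'cV[R]_d -> 'M[R]_(q, r)) :
  smooth_on U F -> smooth_on U G -> smooth_on U (fun x => F x *m G x).
Proof.
move=> sF sG k i j.
pose H l x := F x i l * G x l j.
have sH : Ck k U (fun x => \sum_l H l x).
  by apply: Ck_sum => // l _; exact: Ck_mul.
by apply: (eq_Ck oU _ sH) => x _; rewrite mxE.
Qed.

Lemma Ck_det p k (F : 'cV[R]_d -> 'M[R]_p) :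
  smooth_on U F -> Ck k U (fun x => \det (F x)).
Proof.
move=> sF; apply: Ck_sum => // s _; apply: Ck_mul => //; first exact: Ck_cst.
by apply: Ck_prod => // i _; exact: sF.
Qed.

(** Cramer's rule: on invertible matrices the inverse is the adjugate divided by the determinant,
    both polynomial in the entries. *)
Lemma smooth_invmx p (F : 'cV[R]_d -> 'M[R]_p) :
  (forall x, U x -> F x \in unitmx) ->
  smooth_on U F -> smooth_on U (fun x => invmx (F x)).
Proof.
move=> uF sF.
have sA : smooth_on U (fun x => \adj (F x)).
  move=> k i j; apply: (@eq_Ck _ _ _ oU k (fun x => cofactor (F x) j i)).
    by move=> x _; rewrite mxE.
  apply: Ck_mul => //; first exact: Ck_cst.
  apply: Ck_det => l a b.
  by apply: (eq_Ck oU _ (sF l (lift j a) (lift i b))) => x _; rewrite !mxE.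
apply: (@eq_smooth_on _ _ (fun x => (\det (F x))^-1 *: \adj (F x))).
  by move=> x /uF u; rewrite /invmx u.
apply: smooth_scale => // k; apply: Ck_inv => //; last exact: Ck_det.
by move=> x /uF; rewrite unitmxE unitfE.
Qed.

Lemma smooth_block p1 p2 q1 q2 (F : 'cV[R]_d -> 'M[R]_(p1, q1))
    (G : 'cV[R]_d -> 'M[R]_(p1, q2)) (H : 'cV[R]_d -> 'M[R]_(p2, q1))
    (K : 'cV[R]_d -> 'M[R]_(p2, q2)) :
  smooth_on U F -> smooth_on U G -> smooth_on U H -> smooth_on U K ->
  smooth_on U (fun x => block_mx (F x) (G x) (H x) (K x)).
Proof.
move=> sF sG sH sK k i j.
case: (split_ordP i) => a ->; case: (split_ordP j) => b ->;
  [have s := sF k a b|have s := sG k a b|have s := sH k a b|have s := sK k a b];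
  apply: (eq_Ck oU _ s) => x _;
  by rewrite ?block_mxEul ?block_mxEur ?block_mxEdl ?block_mxEdr.
Qed.
End Operations.

Lemma sub_smooth_on d p q (U V : set 'cV[R]_d) (F : 'cV[R]_d -> 'M[R]_(p, q)) :
  V `<=` U -> smooth_on U F -> smooth_on V F.
Proof. by move=> VU sF k i j; exact: sub_Ck (sF k i j). Qed.

Section Projection.
Variables (D d : nat) (P : 'cV[R]_D -> 'cV[R]_d).
Hypothesis linP : forall h v x, P (h *: v + x) = h *: P v + P x.
Hypothesis cP : continuous P.

(** For linear [P] the difference quotient of [f \o P] along v equals that of f along [P v] exactly,
    which replaces the chain rule. *)
Lemma growth_comp_proj f v x :
  (fun h : R => h^-1 *: (((f \o P : _ -> R) \o shift x) (h *: v) - (f \o P) x)) =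
  (fun h => h^-1 *: ((f \o shift (P x)) (h *: P v) - f (P x))).
Proof. by apply/funext => h; rewrite /= linP. Qed.

Lemma pd_comp_proj a f x : pd a (f \o P) x = 'D_(P (delta_mx a 0)) f (P x).
Proof. by rewrite /pd /derive growth_comp_proj. Qed.

Lemma derivable_comp_proj a (f : 'cV[R]_d -> R) x :
  derivable (f \o P) x (delta_mx a 0) = derivable f (P x) (P (delta_mx a 0)).
Proof. by rewrite /derivable growth_comp_proj. Qed.

Hypothesis basisP :
  forall a, P (delta_mx a 0) = 0 \/ exists b, P (delta_mx a 0) = delta_mx b 0.

(** As [P] sends a basis vector to a basis vector or to 0, a partial derivative of [f \o P] is again
    a partial derivative of f composed with [P], or 0; so the induction on k closes. *)
Lemma Ck_comp_proj k (U : set 'cV[R]_d) (V : set 'cV[R]_D) f : open V ->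
  (forall x, V x -> U (P x)) -> Ck k U f -> Ck k V (f \o P).
Proof.
move=> oV VU; elim: k f => [|k IH] f.
  by move=> cf x Vx; apply: continuous_comp; [exact: cP|apply: cf; exact: VU].
case=> cf df pf; split.
- by move=> x Vx; apply: continuous_comp; [exact: cP|apply: cf; exact: VU].
- move=> a x Vx; rewrite derivable_comp_proj.
  by have [->|[b ->]] := basisP a; [exact: derivable0|apply: df; exact: VU].
- move=> a; have [P0|[b Pb]] := basisP a.
    by apply: (eq_Ck oV _ (Ck_cst oV k 0)) => x _; rewrite pd_comp_proj P0 derive0.
  apply: (eq_Ck oV _ (IH _ (pf b))) => x _.
  by rewrite pd_comp_proj Pb.
Qed.
End Projection.

Lemma usubmxP d e h (v x : 'cV[R]_(d + e)) :
  usubmx (h *: v + x) = h *: usubmx v + usubmx x.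
Proof. by rewrite linearP. Qed.

Lemma dsubmxP d e h (v x : 'cV[R]_(d + e)) :
  dsubmx (h *: v + x) = h *: dsubmx v + dsubmx x.
Proof. by rewrite linearP. Qed.

Lemma continuous_usubmx d e : continuous (@usubmx R d e 1).
Proof.
move=> x; apply: continuous_matrix => i j.
rewrite (_ : (fun y => _) = (fun y : 'cV[R]_(d + e) => y (lshift e i) j)).
  exact: coord_continuous.
by apply/funext => y; rewrite mxE.
Qed.

Lemma continuous_dsubmx d e : continuous (@dsubmx R d e 1).
Proof.
move=> x; apply: continuous_matrix => i j.
rewrite (_ : (fun y => _) = (fun y : 'cV[R]_(d + e) => y (rshift d i) j)).
  exact: coord_continuous.
by apply/funext => y; rewrite mxE.
Qed.

Lemma continuous_col_mx (T : topologicalType) d e (f : T -> 'cV[R]_d)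
    (g : T -> 'cV[R]_e) x :
  {for x, continuous f} -> {for x, continuous g} ->
  {for x, continuous (fun y => col_mx (f y) (g y))}.
Proof.
move=> cf cg; apply: continuous_matrix => i j; rewrite ord1 {j}.
case: (split_ordP i) => a ->.
  rewrite (_ : (fun y => _) = (fun z : 'cV[R]_d => z a 0) \o f).
    by apply: continuous_comp => //; exact: coord_continuous.
  by apply/funext => y; rewrite /= col_mxEu.
rewrite (_ : (fun y => _) = (fun z : 'cV[R]_e => z a 0) \o g).
  by apply: continuous_comp => //; exact: coord_continuous.
by apply/funext => y; rewrite /= col_mxEd.
Qed.

Lemma usubmx_delta_l d e (a : 'I_d) :
  usubmx (delta_mx (lshift e a) 0 : 'cV[R]_(d + e)) = delta_mx a 0.
Proof. by apply/matrixP => i j; rewrite !mxE eq_lshift. Qed.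

Lemma usubmx_delta_r d e (a : 'I_e) :
  usubmx (delta_mx (rshift d a) 0 : 'cV[R]_(d + e)) = 0.
Proof. by apply/matrixP => i j; rewrite !mxE eq_lrshift. Qed.

Lemma dsubmx_delta_l d e (a : 'I_d) :
  dsubmx (delta_mx (lshift e a) 0 : 'cV[R]_(d + e)) = 0.
Proof. by apply/matrixP => i j; rewrite !mxE eq_rlshift. Qed.

Lemma dsubmx_delta_r d e (a : 'I_e) :
  dsubmx (delta_mx (rshift d a) 0 : 'cV[R]_(d + e)) = delta_mx a 0.
Proof. by apply/matrixP => i j; rewrite !mxE eq_rshift. Qed.

Lemma smooth_comp_usubmx d e p q (U : set 'cV[R]_d) (V : set 'cV[R]_(d + e))
    (F : 'cV[R]_d -> 'M[R]_(p, q)) :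
  open V -> (forall x, V x -> U (usubmx x)) -> smooth_on U F ->
  smooth_on V (fun x => F (usubmx x)).
Proof.
move=> oV VU sF k i j.
apply: (@Ck_comp_proj _ _ _ (@usubmxP d e) (@continuous_usubmx d e) _ k U V
  (fun x => F x i j)) => // a.
case: (split_ordP a) => b ->; last by left; exact: usubmx_delta_r.
by right; exists b; exact: usubmx_delta_l.
Qed.

Lemma smooth_comp_dsubmx d e p q (U : set 'cV[R]_e) (V : set 'cV[R]_(d + e))
    (F : 'cV[R]_e -> 'M[R]_(p, q)) :
  open V -> (forall x, V x -> U (dsubmx x)) -> smooth_on U F ->
  smooth_on V (fun x => F (dsubmx x)).
Proof.
move=> oV VU sF k i j.
apply: (@Ck_comp_proj _ _ _ (@dsubmxP d e) (@continuous_dsubmx d e) _ k U V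
  (fun x => F x i j)) => // a.
case: (split_ordP a) => b ->; first by left; exact: dsubmx_delta_l.
by right; exists b; exact: dsubmx_delta_r.
Qed.

End SmoothMatrix.

(** * The Riemann sphere *)

Section RiemannSphere.
Variable R : realType.
Local Notation C := (R[i]^o).

Lemma second_countable_cV d : @second_countable ('cV[R]_d : topologicalType).
Proof.
(* Open boxes with rational corners; the type of pairs of corners is countable. *)
pose box (lr : {ffun 'I_d -> rat} * {ffun 'I_d -> rat}) : set 'cV[R]_d :=
  [set x | forall i, ratr (lr.1 i) < x i 0 < ratr (lr.2 i)].
exists (range box); first exact: (sub_countable (card_image_le _ _)).
split=> [_ [lr _ <-]|x A [P nP PA]].
  rewrite openE => x xlr; exists (fun i _ => [set y | ratr (lr.1 i) < y < ratr (lr.2 i)]).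
    move=> i j; rewrite ord1.
    by apply: (near_in_itvoo (a := ratr (lr.1 i)) (b := ratr (lr.2 i)));
      rewrite in_itv /=; exact: xlr.
  by move=> y /= ylr i; exact: ylr.
have /choice [lr lrP] : forall i, exists lr : rat * rat,
    ratr lr.1 < x i 0 < ratr lr.2 /\
    [set y : R | ratr lr.1 < y < ratr lr.2] `<=` P i 0.
  move=> i; have /nbhs_ballP [e /= e0 eP] := nP i 0.
  have [l] := @rat_in_itvoo _ (x i 0 - e) (x i 0) ltac:(by rewrite gtrBl).
  have [r] := @rat_in_itvoo _ (x i 0) (x i 0 + e) ltac:(by rewrite ltrDl).
  rewrite !in_itv /= => /andP[xr re] /andP[el lx].
  exists (l, r); split; first by rewrite lx.
  move=> y /= /andP[ly yr]; apply: eP; rewrite /ball /= ltr_distlC.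
  by rewrite (lt_trans el ly) (lt_trans yr re).
exists (box ([ffun i => (lr i).1], [ffun i => (lr i).2])).
  split; first by exists ([ffun i => (lr i).1], [ffun i => (lr i).2]).
  by move=> i; rewrite !ffunE; exact: (lrP i).1.
move=> y yb; apply: PA => i j; rewrite ord1; apply: (lrP i).2 => /=.
by have := yb i; rewrite !ffunE.
Qed.

Lemma normC_le_ReIm (z : R[i]) : `|z| <= (`|complex.Re z| + `|complex.Im z|)%:C%C.
Proof.
have nr (k : R) : `|k%:C%C| = (`|k|)%:C%C :> R[i].
  by rewrite normc_def /= expr0n /= addr0 sqrtr_sqr.
have ni : `|'i%C| = 1 :> R[i].
  by rewrite normc_def /= expr0n /= add0r expr1n sqrtr1.
rewrite {1}[z]complexE (le_trans (ler_normD _ _)) // normrM ni mul1r !nr.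
by rewrite rmorphD.
Qed.

Lemma normc_ge_Im (z : R[i]) : `|complex.Im z|%:C%C <= `|z|.
Proof.
have := normc_ge_Re (z * 'i%C); rewrite ReiNIm normrN normrM.
by rewrite (_ : `|'i%C| = 1 :> R[i]) ?mulr1 // normc_def /= expr0n add0r expr1n sqrtr1.
Qed.

Lemma ReB (z w : R[i]) : complex.Re (z - w) = complex.Re z - complex.Re w.
Proof. by case: z w => [a b] [c d]. Qed.

Lemma ImB (z w : R[i]) : complex.Im (z - w) = complex.Im z - complex.Im w.
Proof. by case: z w => [a b] [c d]. Qed.

Lemma continuous_Re : continuous (@complex.Re R : C -> R).
Proof.
move=> z A /nbhs_ballP[e /= e0 eA]; apply/nbhs_ballP.
exists e%:C%C; first by rewrite /= ltcR.
move=> w; rewrite /ball /= => zw; apply: eA.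
rewrite /ball /= -ltcR; apply: le_lt_trans zw.
by rewrite -ReB normc_ge_Re.
Qed.

Lemma continuous_Im : continuous (@complex.Im R : C -> R).
Proof.
move=> z A /nbhs_ballP[e /= e0 eA]; apply/nbhs_ballP.
exists e%:C%C; first by rewrite /= ltcR.
move=> w; rewrite /ball /= => zw; apply: eA.
rewrite /ball /= -ltcR; apply: le_lt_trans zw.
by rewrite -ImB normc_ge_Im.
Qed.

Lemma continuous_cvec : continuous (@cvec R : C -> 'cV[R]_2).
Proof.
move=> z; apply: continuous_matrix => i j; rewrite ord1.
have [->|i0] := eqVneq i 0.
  rewrite (_ : (fun y => _) = @complex.Re R :> (C -> R)); first exact: continuous_Re.
  by apply/funext => w; rewrite mxE.
rewrite (_ : (fun y => _) = @complex.Im R :> (C -> R)); first exact: continuous_Im.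
by apply/funext => w; rewrite mxE (negPf i0).
Qed.

Lemma continuous_vecc : continuous (@vecc R : 'cV[R]_2 -> C).
Proof.
move=> x A /nbhs_ballP[e + eA] /=; rewrite /= ltcE /= => /andP[/eqP ei e1].
(* The radius of a ball in [R[i]] is a complex number, and positivity forces it to be real. *)
move: eA; have -> : e = (complex.Re e)%:C%C by case: e ei {e1} => a b /= ->.
move: (complex.Re e) e1 => {e ei} e e0 eA.
apply/nbhs_ballP; exists (e / 2); first by rewrite /= divr_gt0.
move=> y [_ xy]; apply: eA; rewrite /ball /=.
apply: le_lt_trans (normC_le_ReIm _) _; rewrite ltcR.
have := ltrD (xy 0 0) (xy 1 0); rewrite -splitr.
by rewrite ReB ImB.
Qed.

Lemma cvecK : cancel (@cvec R) (@vecc R).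
Proof. by move=> [a b]; rewrite /vecc !mxE. Qed.

Lemma veccK : cancel (@vecc R) (@cvec R).
Proof.
move=> x; apply/matrixP => i j; rewrite ord1 mxE.
by case: i => -[|[|//]] ilt; rewrite /=; congr (x _ 0); exact: val_inj.
Qed.

Lemma cvec0 : cvec 0 = 0 :> 'cV[R]_2.
Proof. by apply/matrixP => i j; rewrite !mxE; case: ifP. Qed.

Lemma vecc_eq0 (x : 'cV[R]_2) : (vecc x == 0) = (x == 0).
Proof.
by apply/eqP/eqP => [h|->]; [rewrite -[x]veccK h cvec0|rewrite /vecc !mxE].
Qed.

Lemma continuous_inv (z : R[i]) : z != 0 -> {for z, continuous (GRing.inv : C -> C)}.
Proof. by move=> z0; exact: inv_continuous. Qed.

(** Squares rather than discs: a square is the continuous image of a product of two segments, so its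
    compactness comes from the real line. Their complements are the neighbourhoods of infinity used
    below. *)
Definition square (r : R) : set C :=
  [set z | `|complex.Re z| <= r /\ `|complex.Im z| <= r].

Lemma square_compact r : compact (square r).
Proof.
have cI : compact (`[- r, r]%classic : set R) by exact: segment_compact.
pose f (p : R * R) : C := (p.1 +i* p.2)%C.
have cf : continuous f.
  pose h (p : R * R) : 'cV[R]_2 := \col_i (if i == 0 then p.1 else p.2).
  have -> : f = @vecc R \o h by apply/funext => p; rewrite /f /h /vecc /= !mxE.
  move=> p; apply: continuous_comp; last exact: continuous_vecc.
  apply: continuous_matrix => i j; rewrite /h.
  have [->|i0] := eqVneq i 0.
    by rewrite (_ : (fun y => _) = fst); [exact: cvg_fst|apply/funext => q; rewrite mxE].
  rewrite (_ : (fun y => _) = snd); first exact: cvg_snd.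
  by apply/funext => q; rewrite mxE (negPf i0).
have -> : square r = f @` (`[- r, r]%classic `*` `[- r, r]%classic).
  apply/seteqP; split=> [z [zr zi]|_ [[a b] [/= + +] <-]].
    exists (complex.Re z, complex.Im z); last by case: z {zr zi}.
    by split; rewrite /= in_itv /= -ler_norml.
  by rewrite !in_itv /= -!ler_norml.
apply: continuous_compact; first exact: continuous_subspaceT.
exact: compact_setX.
Qed.

Lemma compact_sub_square (K : set C) : compact K -> exists r, K `<=` square r.
Proof.
move=> cK.
have cR : compact (@complex.Re R @` K).
  by apply: continuous_compact => //; apply: continuous_subspaceT; exact: continuous_Re.
have cI : compact (@complex.Im R @` K).
  by apply: continuous_compact => //; apply: continuous_subspaceT; exact: continuous_Im.
have bR := compact_bounded cR; have bI := compact_bounded cI.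
near (+oo : set_system R) => r; exists r => z Kz; split.
- by move: (complex.Re z) (imageP (@complex.Re R) Kz); near: r; exact: bR.
- by move: (complex.Im z) (imageP (@complex.Im R) Kz); near: r; exact: bI.
Unshelve. all: by end_near. Qed.

Lemma complex_hausdorff : hausdorff_space C.
Proof. exact: norm_hausdorff. Qed.

Lemma CP1_hausdorff : hausdorff_space (CP1 R).
Proof.
apply: one_point_compactification_hausdorff; last exact: complex_hausdorff.
move=> z _.
(* The margin 1 makes the unit ball around z fit into the square, which is then a compact
   neighbourhood of z. *)
pose r := Num.max `|complex.Re z| `|complex.Im z| + 1.
exists (square r); last first.
  split; first exact: square_compact.
  by apply: compact_closed; [exact: complex_hausdorff|exact: square_compact].
rewrite withinET; apply/nbhs_ballP; exists 1 => //= w; rewrite /ball /= => zw.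
have bd (a b : R) (c : R) : `|a| <= c -> `|a - b| < 1 -> `|b| <= c + 1.
  move=> ac ab; rewrite -[b](subrKC a) (le_trans (ler_normD _ _)) // lerD //.
  by rewrite distrC ltW.
split; [apply: (@bd (complex.Re z))|apply: (@bd (complex.Im z))].
- by rewrite le_max lexx.
- by rewrite -ReB -ltcR (le_lt_trans (normc_ge_Re _)).
- by rewrite le_max lexx orbT.
- by rewrite -ImB -ltcR (le_lt_trans (normc_ge_Im _)).
Qed.

Let A := CP1_atlas R.

Lemma CP1_cover (p : CP1 R) : exists i : idx A, dom i p.
Proof. by case: p => [z|]; [exists false|exists true]. Qed.

Lemma CP1_open_dom (i : idx A) : open (dom i).
Proof.
case: i => /=.
  have -> : [set eta : CP1 R | eta <> Some 0] = ~` [set (Some 0 : CP1 R)] by [].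
  apply: closed_openC; apply: accessible_closed_set1.
  by apply: hausdorff_accessible; exact: CP1_hausdorff.
have -> : [set eta : CP1 R | eta <> None] = Some @` [set: C].
  apply/seteqP; split=> [[z|//] _|_ [z _ <-]] //; by exists z.
exact: one_point_compactification_open_some openT.
Qed.

Lemma CP1_phiK (i : idx A) p : dom i p -> psi i (phi i p) = p.
Proof.
case: i p => -[z|] //= h; rewrite ?eqxx // ?cvecK //.
have z0 : z != 0 by apply/eqP => z0; apply: h; rewrite z0.
by rewrite -vecc_eq0 cvecK invr_eq0 (negPf z0) invrK.
Qed.

(** Each chart misses one point of the sphere but is onto R^2, so [psi] needs no restriction on
    x. *)
Lemma CP1_psiK (i : idx A) x : dom i (psi i x) /\ phi i (psi i x) = x.
Proof.
case: i => /=; last by rewrite veccK.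
have [->|x0] := eqVneq x 0; first by [].
rewrite invrK veccK; split=> // /Some_inj/eqP.
by rewrite invr_eq0 vecc_eq0 (negPf x0).
Qed.

Lemma CP1_codom (i : idx A) : codom_chart i = [set: 'cV[R]_2].
Proof.
apply/seteqP; split=> // x _.
by exists (psi i x); [exact: (CP1_psiK i x).1|exact: (CP1_psiK i x).2].
Qed.

Lemma CP1_phi_cont (i : idx A) p : dom i p -> {for p, continuous (phi i)}.
Proof.
case: i p => -[z|] /= h //.
- have z0 : z != 0 by apply/eqP => z0; apply: h; rewrite z0.
  move=> V NV.
  have cz : {for (z : C), continuous (@cvec R \o GRing.inv : C -> 'cV[R]_2)}.
    by apply: (@continuous_comp C C); [exact: continuous_inv|exact: continuous_cvec].
  exact: (cz V NV).
- move=> V /nbhs_ballP[e /= e0 eV].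
  (* Outside this square |z| > 2 / e, hence |1 / z| < e. *)
  exists (square (2 / e)).
    split; first exact: square_compact.
    by apply: compact_closed; [exact: complex_hausdorff|exact: square_compact].
  move=> _ [[z nz <-]|->] /=; last by apply: eV; exact: ballxx.
  apply: eV; split=> // i j.
  suff : `|z^-1| < e%:C%C.
    move=> ze; rewrite /ball /= mxE sub0r normrN -ltcR mxE.
    case: ifP => _; first exact: le_lt_trans (normc_ge_Re _) ze.
    exact: le_lt_trans (normc_ge_Im _) ze.
  have e0C : 0 < (2 / e)%:C%C :> R[i] by rewrite ltcR divr_gt0.
  have : (2 / e)%:C%C < `|z|.
    have [s sE] : exists s : R, `|z| = s%:C%C by rewrite normc_def; eexists.
    rewrite sE ltcR ltNge -lecR -sE; apply/negP => ze; apply: nz.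
    split; rewrite -lecR.
      exact: le_trans (normc_ge_Re _) ze.
    exact: le_trans (normc_ge_Im _) ze.
  move=> ze; have z0 := lt_trans e0C ze.
  rewrite normfV invf_plt ?posrE // ?ltcR //.
  apply: lt_trans ze; rewrite -fmorphV ltcR.
  by rewrite ltr_pdivlMr // mulVf ?gt_eqF // ltr1n.
- move=> V NV.
  have cz : {for (z : C), continuous (@cvec R : C -> 'cV[R]_2)} by exact: continuous_cvec.
  exact: (cz V NV).
Qed.

Lemma CP1_psi_cont (i : idx A) x : {for x, continuous (psi i)}.
Proof.
case: i => /=; last first.
  move=> V NV.
  have cx : {for x, continuous (@vecc R : 'cV[R]_2 -> C)} by exact: continuous_vecc.
  exact: (cx _ NV).
have [->|x0] := eqVneq x 0; last first.
  have cx : {for x, continuous (fun y => Some ((vecc y)^-1) : CP1 R)}.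
    move=> V NV; have cx : {for x, continuous (GRing.inv \o @vecc R : 'cV[R]_2 -> C)}.
      apply: (@continuous_comp _ C C); first exact: continuous_vecc.
      by apply: continuous_inv; rewrite vecc_eq0.
    exact: (cx _ NV).
  have oU : open [set y : 'cV[R]_2 | y != 0].
    have -> : [set y : 'cV[R]_2 | y != 0] = ~` [set 0].
      by apply/seteqP; split=> y /= /eqP.
    apply: closed_openC; apply: accessible_closed_set1.
    by apply: hausdorff_accessible; exact: norm_hausdorff.
  by apply: (continuous_eq_on oU x0 _ cx) => y yn0; rewrite ifN.
move=> V; rewrite /= eqxx => -[K [cK _] KV].
have [r Kr] := compact_sub_square cK.
(* If both coordinates of y are below this radius then |y| < 1 / (2|r| + 1), so |1 / y| > 2|r| + 1,
   whereas the points of [square r] have norm at most 2|r|. *)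
have e0 : 0 < (2 * (2 * `|r| + 1))^-1 by rewrite invr_gt0 mulr_gt0 // ltr_wpDl // mulr_ge0.
apply/nbhs_ballP; exists (2 * (2 * `|r| + 1))^-1 => //= y [_ y0].
apply: KV => /=; case: eqVneq => [_|yn0]; [by right|left].
exists (vecc y)^-1 => // /Kr[zr zi].
have r1 : 0 < 2 * `|r| + 1 by rewrite ltr_wpDl // mulr_ge0.
have hr : `|(vecc y)^-1| <= (2 * `|r|)%:C%C.
  apply: le_trans (normC_le_ReIm _) _; rewrite lecR [2 * _]mulr_natl mulr2n.
  by apply: lerD; [apply: le_trans zr _|apply: le_trans zi _]; exact: ler_norm.
have hy : `|vecc y| < ((2 * `|r| + 1)^-1)%:C%C.
  apply: le_lt_trans (normC_le_ReIm _) _; rewrite ltcR.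
  rewrite [ltRHS](_ : _ = (2 * (2 * `|r| + 1))^-1 + (2 * (2 * `|r| + 1))^-1); last first.
    by field; rewrite gt_eqF.
  by apply: ltrD; [have := y0 0 0|have := y0 1 0]; rewrite /ball /= mxE sub0r normrN.
move: hr hy; rewrite normfV normc_def -fmorphV lecR ltcR.
set s := Num.sqrt _ => hr hy.
have s0 : 0 < s.
  rewrite sqrtr_gt0 lt_neqAle addr_ge0 ?sqr_ge0 // andbT eq_sym.
  rewrite paddr_eq0 ?sqr_ge0 // !sqrf_eq0; apply: contra_neqN yn0.
  by move=> ri0; apply/eqP; rewrite -vecc_eq0 eq_complex.
have := lt_le_trans _ hr; rewrite -ltf_pV2 ?posrE // ?invrK in hy.
by move=> /(_ _ hy); rewrite ltNge lerDl ler01.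
Qed.

(** A countable basis of R^2 is pulled back along the two charts: continuity of [phi] makes these
    sets open, continuity of [psi] makes them small enough. *)
Lemma CP1_second_countable : @second_countable (CP1 R).
Proof.
have [B cB [oB bB]] := second_countable_cV 2.
exists (\bigcup_(b in [set: bool]) [set phi (b : idx A) @^-1` V `&` dom (b : idx A) | V in B]).
  by apply: bigcup_countable => // b _; exact: (sub_countable (card_image_le _ _)).
have oP (b : idx A) (V : set 'cV[R]_2) : open V -> open (phi b @^-1` V `&` dom b).
  move=> oV; rewrite openE => p [pV pb]; apply: filterI.
    by apply: (CP1_phi_cont pb); exact: open_nbhs_nbhs.
  by apply: open_nbhs_nbhs; split=> //; exact: CP1_open_dom.
split=> [_ [b _ [V BV <-]]|p N Np]; first by apply: oP; exact: oB.
have [b pb] := CP1_cover p.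
have := @CP1_psi_cont b (phi b p); rewrite /prop_for /continuous_at CP1_phiK //.
move=> /(_ N Np) /bB [V [BV Vp] VN].
exists (phi b @^-1` V `&` dom b); first by split => //; exists b => //; exists V.
by move=> q [Vq qb]; have : N (psi b (phi b q)) := VN _ Vq; rewrite CP1_phiK.
Qed.

End RiemannSphere.

(** * The holomorphic atlas of the sphere and its Jacobians *)

Section RiemannSphereManifold.
Variable R : realType.
Let A := CP1_atlas R.

(** The coordinate change from eta to 1 / eta; as inversion is an involution it serves for both
    orders of the charts. *)
Definition cinv (x : 'cV[R]_2) : 'cV[R]_2 := cvec (vecc x)^-1.
Definition sqnorm (x : 'cV[R]_2) : R := x 0 0 * x 0 0 + x 1 0 * x 1 0.

Lemma sqnorm_neq0 x : x != 0 -> sqnorm x != 0.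
Proof.
apply: contra_neqN => /eqP; rewrite /sqnorm => q0; apply/eqP.
rewrite -vecc_eq0 eq_complex /=.
have : x 0 0 ^+ 2 + x 1 0 ^+ 2 == 0 by rewrite !expr2 q0.
by rewrite paddr_eq0 ?sqr_ge0 // !sqrf_eq0.
Qed.

Lemma cinv0E x : cinv x 0 0 = x 0 0 * (sqnorm x)^-1.
Proof. by rewrite /cinv mxE /= /sqnorm -!expr2. Qed.

Lemma cinv1E x : cinv x 1 0 = - (x 1 0 * (sqnorm x)^-1).
Proof. by rewrite /cinv mxE /= /sqnorm -!expr2. Qed.

Lemma open_neq0 d : open [set x : 'cV[R]_d | x != 0].
Proof.
have -> : [set x : 'cV[R]_d | x != 0] = ~` [set 0].
  by apply/seteqP; split=> x /= /eqP.
apply: closed_openC; apply: accessible_closed_set1.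
by apply: hausdorff_accessible; exact: norm_hausdorff.
Qed.

Lemma Ck_sqnorm k (U : set 'cV[R]_2) : open U -> Ck k U sqnorm.
Proof. by move=> oU; apply: Ck_add => //; apply: Ck_mul => //; exact: Ck_coord. Qed.

Lemma forall_I2 (P : 'I_2 -> Prop) : P 0 -> P 1 -> forall i, P i.
Proof.
move=> P0 P1 [[|[|//]] h].
  by rewrite (_ : Ordinal h = 0) //; exact: val_inj.
by rewrite (_ : Ordinal h = 1) //; exact: val_inj.
Qed.

Lemma smooth_cinv : smooth_on [set x | x != 0] cinv.
Proof.
have oU := @open_neq0 2; move=> k i j; rewrite ord1 {j}.
have sV : Ck k [set x | x != 0] (fun x => (sqnorm x)^-1).
  by apply: Ck_inv => //; [exact: sqnorm_neq0|exact: Ck_sqnorm].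
have sM a : Ck k [set x | x != 0] (fun x : 'cV[R]_2 => x a 0 * (sqnorm x)^-1).
  by apply: Ck_mul => //; exact: Ck_coord.
move: i; apply: forall_I2.
- by apply: (eq_Ck oU _ (sM 0)) => x _; rewrite cinv0E.
- by apply: (eq_Ck oU _ (Ck_opp oU (sM 1))) => x _; rewrite cinv1E.
Qed.

Lemma CP1_overlap (i j : idx A) (p : CP1 R) :
  i <> j -> dom i p -> dom j p -> phi i p != 0.
Proof.
have ne z : Some z <> Some 0 -> z != 0 :> R[i].
  by move=> h; apply/eqP => z0; apply: h; rewrite z0.
have nz z : z != 0 -> cvec z != 0 :> 'cV[R]_2.
  by rewrite -vecc_eq0 cvecK.
by case: i j p => -[] [z|] //= _ h1 h2; apply: nz; rewrite ?invr_eq0; exact: ne.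
Qed.

Lemma CP1_transition (i j : idx A) (x : 'cV[R]_2) :
  i <> j -> x != 0 -> phi j (psi i x) = cinv x.
Proof. by case: i j => -[] //= _ /negPf ->. Qed.

Lemma CP1_smooth (i j : idx A) :
  smooth_on (phi i @` (dom i `&` dom j)) (fun x => phi j (psi i x)).
Proof.
have [->|ij] := eqVneq (i : bool) j.
  apply: (@sub_smooth_on _ _ _ _ setT) => //.
  apply: (eq_smooth_on openT _ (smooth_id openT)) => x _.
  by rewrite (CP1_psiK j x).2.
move/eqP: ij => ij; apply: (@sub_smooth_on _ _ _ _ [set x | x != 0]).
  by move=> _ [p [pi pj] <-]; exact: CP1_overlap pi pj.
apply: (eq_smooth_on (@open_neq0 2) _ smooth_cinv) => x x0.
by rewrite CP1_transition.
Qed.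

Lemma CP1_manifold : smooth_manifold A.
Proof.
split.
- exact: CP1_hausdorff.
- exact: CP1_second_countable.
- exact: CP1_cover.
- exact: CP1_open_dom.
- by move=> i; rewrite CP1_codom; exact: openT.
- exact: CP1_phiK.
- exact: CP1_phi_cont.
- by move=> i x _; exact: CP1_psi_cont.
- exact: CP1_smooth.
Qed.

(** Multiplication by the imaginary unit, the value of [I_CP1] in both charts. *)
Definition rot90 : 'M[R]_2 := delta_mx 1 0 - delta_mx 0 1.

Lemma derivable_coord d (b : 'I_d) (x v : 'cV[R]_d) :
  derivable (fun y : 'cV[R]_d => y b 0) x v.
Proof. by apply: diff_derivable; exact: differentiable_coord. Qed.

Lemma pd_coordE d (a b : 'I_d) (x : 'cV[R]_d) :
  pd a (fun y : 'cV[R]_d => y b 0) x = (a == b)%:R.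
Proof. by have [_ <-] := pd_coord a x b. Qed.

Lemma derivable_sqnorm (x v : 'cV[R]_2) : derivable sqnorm x v.
Proof. by apply: derivableD; apply: derivableM; exact: derivable_coord. Qed.

Lemma pd_sqnorm (b : 'I_2) (x : 'cV[R]_2) : pd b sqnorm x = 2 * x b 0.
Proof.
rewrite pdD; try by apply: derivableM; exact: derivable_coord.
rewrite !pdM; try exact: derivable_coord.
by rewrite !pd_coordE; move: b; apply: forall_I2 => /=; rewrite ?eqxx /=; ring.
Qed.

(** Inversion is conjugation followed by division by the squared norm; [(-1) ^+ a] is the sign of
    the conjugation. *)
Lemma pd_cinv (x : 'cV[R]_2) (a b : 'I_2) : x != 0 ->
  pd b (fun y => cinv y a 0) x =
  (-1) ^+ a * ((a == b)%:R / sqnorm x - 2 * x a 0 * x b 0 / sqnorm x ^+ 2).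
Proof.
move=> x0; have q0 := sqnorm_neq0 x0.
have dq : derivable sqnorm x (delta_mx b 0) by exact: derivable_sqnorm.
have pq := pd_sqnorm b x.
have dV : derivable (fun y => (sqnorm y)^-1) x (delta_mx b 0) by exact: derivableV.
have pm c : pd b (fun y : 'cV[R]_2 => y c 0 * (sqnorm y)^-1) x =
    (b == c)%:R / sqnorm x - 2 * x c 0 * x b 0 / sqnorm x ^+ 2.
  by rewrite (pdM (@derivable_coord _ c x _) dV) (pdV q0 dq) pd_coordE pq; field.
move: a; apply: forall_I2.
  rewrite (_ : (fun y => _) = (fun y : 'cV[R]_2 => y 0 0 * (sqnorm y)^-1)).
    by rewrite pm mul1r eq_sym.
  by apply/funext => y; rewrite cinv0E.
rewrite (_ : (fun y => _) = (fun y : 'cV[R]_2 => - (y 1 0 * (sqnorm y)^-1))).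
  by rewrite (pdN (derivableM (@derivable_coord _ 1 x _) dV)) pm mulN1r eq_sym.
by apply/funext => y; rewrite cinv1E.
Qed.

(* The Cauchy-Riemann equations for the transition maps. *)
Lemma CP1_jac (i j : idx A) (p : CP1 R) : dom i p -> dom j p ->
  exists a b, jac i j p = a%:M + b *: rot90 /\ a ^+ 2 + b ^+ 2 != 0.
Proof.
move=> pi pj; have [ij|/eqP ij] := eqVneq (i : bool) j.
  exists 1, 0; split; last by rewrite expr1n expr0n addr0 oner_eq0.
  rewrite scale0r addr0 -ij; apply/matrixP => a b; rewrite !mxE.
  rewrite (_ : (fun x => _) = (fun x : 'cV[R]_2 => x a 0)) ?pd_coordE 1?eq_sym //.
  by apply/funext => x; rewrite (CP1_psiK i x).2.
have x0 := CP1_overlap ij pi pj; have q0 := sqnorm_neq0 x0.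
set x := phi i p in x0 q0.
(* s and t are the real and imaginary parts of -1 / eta^2, the derivative of 1 / eta. *)
pose s := (sqnorm x)^-1 - 2 * x 0 0 * x 0 0 / sqnorm x ^+ 2.
pose t := 2 * x 0 0 * x 1 0 / sqnorm x ^+ 2.
exists s, t; split.
  apply/matrixP => a b.
  rewrite !mxE -/x (pd_eq_on b (@open_neq0 2) x0 (g := fun y => cinv y a 0)).
    rewrite pd_cinv //; move: a b; do 2![apply: forall_I2]; rewrite /s /t /=.
  - by rewrite expr0; field.
  - by rewrite expr0; field.
  - by rewrite expr1; field.
  - by rewrite expr1 /sqnorm; field.
  by move=> y y0; rewrite CP1_transition.
have -> : s ^+ 2 + t ^+ 2 = (sqnorm x)^-2.
  by rewrite /s /t; move: q0; rewrite /sqnorm => q0; field.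
by rewrite invr_eq0 expf_neq0.
Qed.

Lemma rot90_sq : rot90 *m rot90 = - 1%:M.
Proof.
apply/matrixP => a b; rewrite !mxE !big_ord_recl big_ord0 !mxE.
by move: a b; do 2![apply: forall_I2]; rewrite /=; ring.
Qed.

Lemma CP1_jac_unit (i j : idx A) (p : CP1 R) :
  dom i p -> dom j p -> jac i j p \in unitmx.
Proof.
move=> pi pj; have [a [b [-> ab]]] := CP1_jac pi pj.
have /mulmx1_unit[] // :
  (a%:M + b *: rot90) *m ((a ^+ 2 + b ^+ 2)^-1 *: (a%:M - b *: rot90)) = 1%:M.
rewrite -scalemxAr mulmxDl !mulmxBr !mul_scalar_mx -!scalemxAl -!scalemxAr.
rewrite rot90_sq mul_mx_scalar [b *: (a *: _)]scalerA [b * a]mulrC -scalerA.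
by rewrite subrKA !scalerN opprK -scalemx1 !scalerA -!expr2 -scalerDl scalerA mulVf ?scale1r.
Qed.

Lemma CP1_jac_rot90 (i j : idx A) (p : CP1 R) :
  dom i p -> dom j p -> jac i j p *m rot90 = rot90 *m jac i j p.
Proof.
move=> pi pj; have [a [b [-> _]]] := CP1_jac pi pj.
by rewrite mulmxDl mulmxDr mul_scalar_mx mul_mx_scalar -scalemxAl -scalemxAr.
Qed.
End RiemannSphereManifold.

(** * Products of manifolds *)

Section ProductManifold.
Variable R : realType.

Lemma hausdorff_prod (T S : topologicalType) :
  hausdorff_space T -> hausdorff_space S -> hausdorff_space (T * S)%type.
Proof.
move=> hT hS [p1 p2] [q1 q2] cpq; congr pair.
  apply: hT => U V pU qV.
  have [] := cpq (fst @^-1` U) (fst @^-1` V).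
  - exact: (@cvg_fst _ _ (nbhs p1) (nbhs p2) _ U pU).
  - exact: (@cvg_fst _ _ (nbhs q1) (nbhs q2) _ V qV).
  by move=> [x y] [/= xU xV]; exists x.
apply: hS => U V pU qV.
have [] := cpq (snd @^-1` U) (snd @^-1` V).
- exact: (@cvg_snd _ _ (nbhs p1) (nbhs p2) _ U pU).
- exact: (@cvg_snd _ _ (nbhs q1) (nbhs q2) _ V qV).
by move=> [x y] [/= xU xV]; exists y.
Qed.

Lemma open_setX (T S : topologicalType) (U : set T) (V : set S) :
  open U -> open V -> open (U `*` V).
Proof.
move=> oU oV; rewrite openE => -[x y] [/= Ux Vy].
by exists (U, V); [split; exact: open_nbhs_nbhs|].
Qed.

Lemma second_countable_prod (T S : topologicalType) :
  @second_countable T -> @second_countable S -> @second_countable (T * S)%type.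
Proof.
move=> [B cB [oB bB]] [B' cB' [oB' bB']].
exists [set UV.1 `*` UV.2 | UV in B `*` B'].
  by apply: (sub_countable (card_image_le _ _)); exact: countableX.
split=> [_ [[U V] [/= BU BV] <-]|[x y] N [[U V] /= [xU yV] UVN]].
  by apply: open_setX; [exact: oB|exact: oB'].
have [U' [BU' U'x] U'U] := bB _ _ xU; have [V' [BV' V'y] V'V] := bB' _ _ yV.
exists (U' `*` V'); first by split=> //; exists (U', V').
by move=> [z w] [/= /U'U Uz /V'V Vw]; exact: UVN.
Qed.

Lemma smooth_col_mx d p q (U : set 'cV[R]_d) (F : 'cV[R]_d -> 'cV[R]_p)
    (G : 'cV[R]_d -> 'cV[R]_q) : open U ->
  smooth_on U F -> smooth_on U G -> smooth_on U (fun x => col_mx (F x) (G x)).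
Proof.
move=> oU sF sG k i j; rewrite ord1 {j}; case: (split_ordP i) => a ->.
  by apply: (eq_Ck oU _ (sF k a 0)) => x _; rewrite col_mxEu.
by apply: (eq_Ck oU _ (sG k a 0)) => x _; rewrite col_mxEd.
Qed.

Lemma open_continuous_in (T S : topologicalType) (U : set T) (V : set S) (f : T -> S) :
  open U -> open V -> (forall x, U x -> {for x, continuous f}) ->
  open (U `&` f @^-1` V).
Proof.
move=> oU oV cf; rewrite openE => x [Ux Vx]; apply: filterI.
  exact: open_nbhs_nbhs.
by apply: (cf x Ux); exact: open_nbhs_nbhs.
Qed.

(** Turns the image of an overlap into a preimage, from which it is seen to be open. *)
Lemma overlapE (M : topologicalType) d (A : atlas R M d) (i j : idx A) :
  smooth_manifold A ->
  phi i @` (dom i `&` dom j) = codom_chart i `&` psi i @^-1` (dom j).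
Proof.
move=> mA; apply/seteqP; split=> [_ [p [pi pj] <-]|x [[p pi <-] pj]].
  by split; [exists p|rewrite /= man_phiK].
by exists p => //; split=> //; move: pj; rewrite /= man_phiK.
Qed.

Lemma open_overlap (M : topologicalType) d (A : atlas R M d) (i j : idx A) :
  smooth_manifold A -> open (phi i @` (dom i `&` dom j)).
Proof.
move=> mA; rewrite overlapE //; apply: open_continuous_in.
- exact: man_open_codom.
- exact: man_open_dom.
- by move=> x; exact: man_psi_cont.
Qed.

Section Prod.
Variables (M N : topologicalType) (d e : nat).
Variables (A : atlas R M d) (B : atlas R N e).
Let P := prod_atlas A B.

Lemma codom_prod (i : idx P) : codom_chart i =
  [set x | codom_chart i.1 (usubmx x) /\ codom_chart i.2 (dsubmx x)].
Proof.
apply/seteqP; split=> [_ [p [p1 p2] <-]|x [[p1 d1 e1] [p2 d2 e2]]].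
  by rewrite /= col_mxKu col_mxKd; split; [exists p.1|exists p.2].
by exists (p1, p2) => //=; rewrite e1 e2 vsubmxK.
Qed.

Lemma open_prod_sub (U : set 'cV[R]_d) (V : set 'cV[R]_e) : open U -> open V ->
  open [set x : 'cV[R]_(d + e) | U (usubmx x) /\ V (dsubmx x)].
Proof.
move=> oU oV.
apply: (@openI _ (usubmx @^-1` U) (dsubmx @^-1` V)); apply: open_comp => // x _.
  exact: continuous_usubmx.
exact: continuous_dsubmx.
Qed.

Lemma prod_manifold : smooth_manifold A -> smooth_manifold B -> smooth_manifold P.
Proof.
move=> mA mB; split.
- exact: hausdorff_prod (man_hausdorff mA) (man_hausdorff mB).
- exact: second_countable_prod (man_second_countable mA) (man_second_countable mB).
- move=> [p q]; have [i ip] := man_cover mA p; have [j jq] := man_cover mB q.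
  by exists (i, j).
- by move=> i; apply: open_setX; [exact: man_open_dom mA _|exact: man_open_dom mB _].
- move=> i; rewrite codom_prod.
  by apply: open_prod_sub; [exact: man_open_codom mA _|exact: man_open_codom mB _].
- by move=> i [p q] [/= ip jq]; rewrite col_mxKu col_mxKd !man_phiK.
- move=> i [p q] [/= ip jq]; apply: continuous_col_mx.
    apply: (@continuous_comp _ _ _ fst (phi i.1)); first exact: cvg_fst.
    exact: man_phi_cont.
  apply: (@continuous_comp _ _ _ snd (phi i.2)); first exact: cvg_snd.
  exact: man_phi_cont.
- move=> i x; rewrite codom_prod => -[xi xj].
  have c1 : {for x, continuous (psi i.1 \o @usubmx R d e 1)}.
    by apply: continuous_comp; [exact: continuous_usubmx|exact: man_psi_cont xi].
  have c2 : {for x, continuous (psi i.2 \o @dsubmx R d e 1)}.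
    by apply: continuous_comp; [exact: continuous_dsubmx|exact: man_psi_cont xj].
  exact: (cvg_pair c1 c2).
- move=> i j.
  pose U := phi i.1 @` (dom i.1 `&` dom j.1).
  pose V := phi i.2 @` (dom i.2 `&` dom j.2).
  have oU : open U by exact: open_overlap.
  have oV : open V by exact: open_overlap.
  have oW := open_prod_sub oU oV.
  apply: (@sub_smooth_on _ _ _ _ [set x | U (usubmx x) /\ V (dsubmx x)]).
    move=> _ [p [[pi1 pi2] [pj1 pj2]] <-] /=; rewrite col_mxKu col_mxKd.
    by split; [exists p.1|exists p.2].
  apply: smooth_col_mx => //.
    apply: (smooth_comp_usubmx (U := U) (F := fun y => phi j.1 (psi i.1 y))) => //.
      by move=> x [].
    exact: man_smooth.
  apply: (smooth_comp_dsubmx (U := V) (F := fun y => phi j.2 (psi i.2 y))) => //.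
    by move=> x [].
  exact: man_smooth.
Qed.

Lemma jac_prod (i j : idx P) (p : M * N) :
  jac i j p = block_mx (jac i.1 j.1 p.1) 0 0 (jac i.2 j.2 p.2).
Proof.
apply/matrixP => a b; rewrite mxE.
case: (split_ordP a) => a' ->; case: (split_ordP b) => b' ->.
- rewrite block_mxEul mxE.
  rewrite (_ : (fun x => _) = (fun x => phi j.1 (psi i.1 x) a' 0) \o @usubmx R d e 1).
    by rewrite (pd_comp_proj (@usubmxP R d e)) usubmx_delta_l /= col_mxKu.
  by apply/funext => x; rewrite /= col_mxEu.
- rewrite block_mxEur mxE.
  rewrite (_ : (fun x => _) = (fun x => phi j.1 (psi i.1 x) a' 0) \o @usubmx R d e 1).
    by rewrite (pd_comp_proj (@usubmxP R d e)) usubmx_delta_r derive0.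
  by apply/funext => x; rewrite /= col_mxEu.
- rewrite block_mxEdl mxE.
  rewrite (_ : (fun x => _) = (fun x => phi j.2 (psi i.2 x) a' 0) \o @dsubmx R d e 1).
    by rewrite (pd_comp_proj (@dsubmxP R d e)) dsubmx_delta_l derive0.
  by apply/funext => x; rewrite /= col_mxEd.
- rewrite block_mxEdr mxE.
  rewrite (_ : (fun x => _) = (fun x => phi j.2 (psi i.2 x) a' 0) \o @dsubmx R d e 1).
    by rewrite (pd_comp_proj (@dsubmxP R d e)) dsubmx_delta_r /= col_mxKd.
  by apply/funext => x; rewrite /= col_mxEd.
Qed.
End Prod.
End ProductManifold.

(** * The Courant bracket and torsion-free connections *)

Section CourantAlgebra.
Variables (F : fieldType) (D : nat).
Implicit Types (u v w z : 'cV[F]_(D + D)) (du dv : 'I_D -> 'cV[F]_(D + D)).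

(** The Gram matrix of twice the pairing, over any field so that it applies to E and to its
    complexification. *)
Definition swap_mx : 'M[F]_(D + D) := block_mx 0 1%:M 1%:M 0.

Definition swap_form u v : F := (u^T *m swap_mx *m v) 0 0.

Lemma swap_formDl u u' v : swap_form (u + u') v = swap_form u v + swap_form u' v.
Proof. by rewrite /swap_form linearD /= !mulmxDl mxE. Qed.

Lemma swap_formDr u v v' : swap_form u (v + v') = swap_form u v + swap_form u v'.
Proof. by rewrite /swap_form mulmxDr mxE. Qed.

Lemma swap_formZl c u v : swap_form (c *: u) v = c * swap_form u v.
Proof. by rewrite /swap_form linearZ /= -!scalemxAl mxE. Qed.

Lemma swap_formZr c u v : swap_form u (c *: v) = c * swap_form u v.
Proof. by rewrite /swap_form -scalemxAr mxE. Qed.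

Lemma swap_form_suml (I : finType) (f : I -> 'cV[F]_(D + D)) v :
  swap_form (\sum_i f i) v = \sum_i swap_form (f i) v.
Proof.
apply: (big_morph (fun u => swap_form u v) (op2 := +%R)).
  by move=> x y; exact: swap_formDl.
by rewrite -(scale0r 0) swap_formZl mul0r.
Qed.

Lemma swap_formE u v : swap_form u v =
  \sum_a (usubmx u a 0 * dsubmx v a 0 + dsubmx u a 0 * usubmx v a 0).
Proof.
rewrite /swap_form -{1}[u]vsubmxK -{1}[v]vsubmxK /swap_mx tr_col_mx.
rewrite mul_row_block !mulmx0 !mulmx1 add0r addr0 mul_row_col mxE addrC.
rewrite [in LHS]mxE [X in _ + X]mxE -big_split /=; apply: eq_bigr => a _.
by rewrite !mxE.
Qed.

Lemma swap_form_covector u (theta : 'cV[F]_D) :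
  swap_form u (col_mx 0 theta) = \sum_a u (lshift D a) 0 * theta a 0.
Proof.
rewrite swap_formE; apply: eq_bigr => a _.
by rewrite col_mxKu col_mxKd !mxE mulr0 addr0.
Qed.

Lemma swap_form_nondegenerate v : (forall u, swap_form u v = 0) -> v = 0.
Proof.
move=> h; apply/colP => k; rewrite [RHS]mxE; case: (split_ordP k) => a ->.
  have := h (delta_mx (rshift D a) 0); rewrite swap_formE (bigD1 a) //= big1.
    by rewrite !mxE eq_lrshift !eqxx mul0r add0r mul1r addr0.
  by move=> b ba; rewrite !mxE eq_lrshift eq_rshift (negPf ba) !mul0r addr0.
have := h (delta_mx (lshift D a) 0); rewrite swap_formE (bigD1 a) //= big1.
  by rewrite !mxE eq_rlshift !eqxx mul0r mul1r !addr0.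
by move=> b ba; rewrite !mxE eq_rlshift eq_lshift (negPf ba) !mul0r addr0.
Qed.

(* The Courant bracket at a point, in terms of the 1-jets of u and v. *)
Definition jet_courant u v du dv : 'cV[F]_(D + D) :=
  \sum_a (u (lshift D a) 0 *: dv a - v (lshift D a) 0 *: du a)
  + col_mx 0 (\col_k swap_form (du k) v).

Lemma jet_courantDl u u' v du du' dv :
  jet_courant (u + u') v (fun a => du a + du' a) dv =
  jet_courant u v du dv + jet_courant u' v du' dv.
Proof.
rewrite /jet_courant addrACA -big_split /= add_col_mx addr0; congr (_ + col_mx 0 _).
  by apply: eq_bigr => a _; rewrite mxE scalerDl scalerDr opprD addrACA.
by apply/colP => k; rewrite !mxE swap_formDl.
Qed.

Lemma jet_courantDr u v v' du dv dv' :
  jet_courant u (v + v') du (fun a => dv a + dv' a) =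
  jet_courant u v du dv + jet_courant u v' du dv'.
Proof.
rewrite /jet_courant addrACA -big_split /= add_col_mx addr0; congr (_ + col_mx 0 _).
  by apply: eq_bigr => a _; rewrite mxE scalerDl scalerDr opprD addrACA.
by apply/colP => k; rewrite !mxE swap_formDr.
Qed.

Lemma jet_courantZl c u v du dv :
  jet_courant (c *: u) v (fun a => c *: du a) dv = c *: jet_courant u v du dv.
Proof.
rewrite /jet_courant scalerDr scaler_sumr scale_col_mx scaler0.
congr (_ + col_mx 0 _).
  apply: eq_bigr => a _; rewrite mxE scalerBr !scalerA.
  by rewrite [v _ _ * c]mulrC.
by apply/colP => k; rewrite !mxE swap_formZl.
Qed.

Lemma jet_courantZr c u v du dv :
  jet_courant u (c *: v) du (fun a => c *: dv a) = c *: jet_courant u v du dv.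
Proof.
rewrite /jet_courant scalerDr scaler_sumr scale_col_mx scaler0.
congr (_ + col_mx 0 _).
  apply: eq_bigr => a _; rewrite mxE scalerBr !scalerA.
  by rewrite [u _ _ * c]mulrC.
by apply/colP => k; rewrite !mxE swap_formZr.
Qed.

(** [Gam a k b] is the Christoffel symbol with upper index k and lower indices a, b; the second
    block is the dual connection on covectors. *)
Definition gen_connection (Gam : 'I_D -> 'M[F]_D) (a : 'I_D) : 'M[F]_(D + D) :=
  block_mx (Gam a) 0 0 (- (Gam a)^T).

(* The terms in Gam cancel because Gam is torsion free. *)
Lemma jet_courant_connection (Gam : 'I_D -> 'M[F]_D) u v du dv :
  (forall a b k, Gam a k b = Gam b k a) ->
  jet_courant u v (fun a => du a + gen_connection Gam a *m u)
                  (fun a => dv a + gen_connection Gam a *m v) =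
  jet_courant u v du dv.
Proof.
move=> sym; rewrite /jet_courant.
have -> : \sum_a (u (lshift D a) 0 *: (dv a + gen_connection Gam a *m v) -
                  v (lshift D a) 0 *: (du a + gen_connection Gam a *m u)) =
    \sum_a (u (lshift D a) 0 *: dv a - v (lshift D a) 0 *: du a) +
    \sum_a (u (lshift D a) 0 *: (gen_connection Gam a *m v) -
            v (lshift D a) 0 *: (gen_connection Gam a *m u)).
  by rewrite -big_split /=; apply: eq_bigr => a _; rewrite !scalerDr opprD addrACA.
have -> : \col_k swap_form (du k + gen_connection Gam k *m u) v =
    \col_k swap_form (du k) v + \col_k swap_form (gen_connection Gam k *m u) v.
  by apply/colP => k; rewrite !mxE swap_formDl.
rewrite -[in col_mx 0 _](addr0 0) -add_col_mx addrACA -[RHS]addr0; congr (_ + _).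
pose X := usubmx u; pose Y := usubmx v; pose xi := dsubmx u; pose eta := dsubmx v.
have Gu w a : gen_connection Gam a *m w =
    col_mx (Gam a *m usubmx w) (- ((Gam a)^T *m dsubmx w)).
  by rewrite -{1}[w]vsubmxK mul_block_col !mul0mx addr0 add0r mulNmx.
have sf := swap_formE.
have ushift w a : w (lshift D a) 0 = usubmx w a 0 by rewrite mxE.
apply/colP => k; rewrite mxE summxE; case: (split_ordP k) => c ->.
- rewrite col_mxEu [X in _ + X]mxE [RHS]mxE addr0.
  under eq_bigr => a _ do rewrite !Gu (ushift u) (ushift v) !scale_col_mx opp_col_mx
    add_col_mx col_mxEu !mxE.
  rewrite sumrB; apply/eqP; rewrite subr_eq0; apply/eqP.
  under eq_bigr => a _ do rewrite mulr_sumr.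
  under [RHS]eq_bigr => a _ do rewrite mulr_sumr.
  rewrite exchange_big /=; apply: eq_bigr => a _; apply: eq_bigr => b _.
  by rewrite sym !ushift; ring.
- rewrite col_mxEd [X in _ + X]mxE [RHS]mxE sf.
  (* The dual connection contributes S2 - S1 through the derivatives along X and Y, and the covector
     of pairings contributes S1 - S2 once the lower indices of Gam are exchanged. *)
  pose S1 := \sum_a \sum_b X a 0 * (Gam a b c * eta b 0).
  pose S2 := \sum_a \sum_b Y a 0 * (Gam a b c * xi b 0).
  have -> : \sum_a (u (lshift D a) 0 *: (gen_connection Gam a *m v) -
      v (lshift D a) 0 *: (gen_connection Gam a *m u)) (rshift D c) 0 = S2 - S1.
    rewrite -sumrB; apply: eq_bigr => a _.
    rewrite !Gu (ushift u) (ushift v) !scale_col_mx opp_col_mx add_col_mx col_mxEd.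
    rewrite -/X -/Y -/xi -/eta !scalerN opprK addrC.
    rewrite mxE [X in X + _]mxE [X in _ + X]mxE [X in - X]mxE.
    rewrite [X in _ * X]mxE [X in - (_ * X)]mxE !mulr_sumr.
    by congr (_ - _); apply: eq_bigr => b _; rewrite [(_^T) _ _]mxE.
  have -> : \sum_a (usubmx (gen_connection Gam c *m u) a 0 * dsubmx v a 0 +
      dsubmx (gen_connection Gam c *m u) a 0 * usubmx v a 0) = S1 - S2.
    rewrite /S1 /S2 exchange_big -sumrB /=; apply: eq_bigr => a _.
    rewrite !Gu col_mxKu col_mxKd -/X -/Y -/xi -/eta.
    rewrite mxE [X in _ + X * _]mxE [X in - X]mxE mulNr !mulr_suml.
    congr (_ - _); apply: eq_bigr => b _.
      by rewrite sym; ring.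
    by rewrite [(_^T) _ _]mxE sym; ring.
  by rewrite subrKA subrr.
Qed.

Variable iota : F.
Hypothesis iota2 : iota * iota = -1.
Hypothesis two0 : 2 != 0 :> F.

(** The right-hand side has the shape of [courantC], which brackets real and imaginary parts
    separately. *)
Lemma jet_courant_iota (u1 u2 v1 v2 : 'cV[F]_(D + D)) du1 du2 dv1 dv2 :
  jet_courant (u1 + iota *: u2) (v1 + iota *: v2)
    (fun a => du1 a + iota *: du2 a) (fun a => dv1 a + iota *: dv2 a) =
  (jet_courant u1 v1 du1 dv1 - jet_courant u2 v2 du2 dv2)
  + iota *: (jet_courant u1 v2 du1 dv2 + jet_courant u2 v1 du2 dv1).
Proof.
rewrite jet_courantDl !jet_courantDr !jet_courantZl !jet_courantZr scalerA iota2.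
set j11 := jet_courant u1 v1 _ _; set j12 := jet_courant u1 v2 _ _.
set j21 := jet_courant u2 v1 _ _; set j22 := jet_courant u2 v2 _ _.
by rewrite scaleN1r [X in _ + X]addrC addrACA (scalerDr iota j12 j21).
Qed.

Section Criterion.
Variables (J : 'M[F]_(D + D)) (dJ : 'I_D -> 'M[F]_(D + D)).
Variable Gam : 'I_D -> 'M[F]_D.
Hypothesis J2 : J *m J = - 1%:M.
Hypothesis JQ : J^T *m swap_mx = - (swap_mx *m J).
Hypothesis torsion_free : forall a b k, Gam a k b = Gam b k a.
Let G := gen_connection Gam.
Let DJ a := dJ a + G a *m J - J *m G a.

(** As J is skew for the form, iota <u, v> = <J u, v> = - <u, J v> = - iota <u, v>, and 2 iota is
    invertible. *)
Lemma eigen_isotropic u v : J *m u = iota *: u -> J *m v = iota *: v ->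
  swap_form u v = 0.
Proof.
move=> Ju Jv.
have h : iota * swap_form u v = - (iota * swap_form u v).
  rewrite -{1}swap_formZl -Ju -swap_formZr -Jv /swap_form trmx_mul.
  by rewrite -(mulmxA u^T J^T) JQ mulmxN mulNmx mxE -!mulmxA.
have i0 : iota != 0.
  by apply: contraTneq (oner_neq0 F) => i0; rewrite -oppr_eq0 -iota2 i0 mul0r eqxx.
move/eqP: h; rewrite -addr_eq0 -mulr2n -mulr_natl !mulf_eq0.
by rewrite (negPf two0) (negPf i0) => /eqP.
Qed.

(* The two sums in the bracket lie in L by hypothesis; the remaining covector
   k |-> <nabla_k u, v> is orthogonal to L, hence lies in L. *)
Lemma jet_courant_eigen u v du dv :
  (forall w z, J *m w = iota *: w -> J *m z = iota *: z ->
    \sum_a z (lshift D a) 0 *: (DJ a *m w) = 0) ->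
  J *m u = iota *: u -> J *m v = iota *: v ->
  (forall a, dJ a *m u + J *m du a = iota *: du a) ->
  (forall a, dJ a *m v + J *m dv a = iota *: dv a) ->
  J *m jet_courant u v du dv = iota *: jet_courant u v du dv.
Proof.
move=> par Ju Jv Jdu Jdv.
rewrite -(jet_courant_connection _ _ _ _ torsion_free) -/G.
(* Covariant differentiation of J w = iota w gives (J - iota) nabla w = - (nabla J) w, which
   vanishes once contracted with z in L. *)
have covL w dw z : J *m w = iota *: w ->
    (forall a, dJ a *m w + J *m dw a = iota *: dw a) ->
    J *m z = iota *: z ->
    J *m (\sum_a z (lshift D a) 0 *: (dw a + G a *m w)) =
    iota *: (\sum_a z (lshift D a) 0 *: (dw a + G a *m w)).
  move=> Jw Jdw Jz; apply/eqP; rewrite -subr_eq0 mulmx_sumr scaler_sumr -sumrB.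
  have pz := par w z Jw Jz; rewrite -oppr_eq0 -sumrN -[X in _ == X]pz.
  apply/eqP/eq_bigr => a _; rewrite -scalemxAr scalerA [iota * _]mulrC -scalerA.
  rewrite -scalerBr -scalerN; congr (_ *: _).
  rewrite opprB scalerDr -Jdw mulmxDr /DJ mulmxBl mulmxDl.
  rewrite -[G a *m J *m w]mulmxA Jw -scalemxAr mulmxA.
  by rewrite addrAC opprD !addrA addrK addrAC.
rewrite /jet_courant sumrB mulmxDr mulmxBr scalerDr scalerBr.
rewrite (covL v dv u) // (covL u du v) //; congr (_ + _).
set Theta := col_mx 0 _.
have ThetaL z : J *m z = iota *: z -> swap_form z Theta = 0.
  move=> Jz; rewrite swap_form_covector.
  under eq_bigr => k _ do rewrite mxE -swap_formZl.
  by rewrite -swap_form_suml eigen_isotropic // (covL u du z).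
apply/eqP; rewrite -subr_eq0; apply/eqP/swap_form_nondegenerate => w.
(* J^2 = -1 means (J - iota)(J + iota) = 0, so J + iota maps every w into L; testing [Theta] against
   these vectors yields its eigen-equation. *)
have JwL : J *m (J *m w + iota *: w) = iota *: (J *m w + iota *: w).
  rewrite mulmxDr mulmxA J2 -scalemxAr scalerDr scalerA iota2 mulNmx mul1mx.
  by rewrite scaleN1r addrC.
have := ThetaL _ JwL; rewrite swap_formDl swap_formZl.
have -> : swap_form (J *m w) Theta = - swap_form w (J *m Theta).
  by rewrite /swap_form trmx_mul -(mulmxA w^T J^T) JQ mulmxN mulNmx mxE -!mulmxA.
rewrite -scaleNr swap_formDr swap_formZr mulNr => /eqP.
by rewrite addrC subr_eq0 => /eqP ->; rewrite subrr.
Qed.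
End Criterion.
End CourantAlgebra.

(** * The Courant bracket of sections as an operation on 1-jets *)

Section CourantBracket.
Variables (R : realType) (D : nat).
Local Notation C := R[i].
Local Notation rc := (real_complex R).
Local Notation toC := (map_mx rc).
Implicit Types x : 'cV[R]_D.

Definition pd_mx p q (a : 'I_D) (F : 'cV[R]_D -> 'M[R]_(p, q)) x : 'M[R]_(p, q) :=
  \matrix_(i, j) pd a (fun y => F y i j) x.

Lemma pd_mxE p q a (F : 'cV[R]_D -> 'M[R]_(p, q)) x i j :
  pd_mx a F x i j = pd a (fun y => F y i j) x.
Proof. by rewrite mxE. Qed.

Definition pd_mxC p q (a : 'I_D) (F : 'cV[R]_D -> 'M[C]_(p, q)) x : 'M[C]_(p, q) :=
  mxC (pd_mx a (fun y => mxRe (F y)) x) (pd_mx a (fun y => mxIm (F y)) x).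

Lemma imag_sq : 'i%C * 'i%C = -1 :> C.
Proof. by rewrite -expr2 sqr_i. Qed.

Lemma mxCE p q (A B : 'M[R]_(p, q)) : mxC A B = toC A + 'i%C *: toC B.
Proof.
by apply/matrixP => i j; rewrite !mxE [LHS]complexE.
Qed.

Lemma mxC_ReIm p q (A : 'M[C]_(p, q)) : A = toC (mxRe A) + 'i%C *: toC (mxIm A).
Proof. by rewrite -mxCE; apply/matrixP => i j; rewrite !mxE; case: (A i j). Qed.

Lemma map_jet_courant (F G : fieldType) (f : {rmorphism F -> G})
    (u v : 'cV[F]_(D + D)) (du dv : 'I_D -> 'cV[F]_(D + D)) :
  map_mx f (jet_courant u v du dv) =
  jet_courant (map_mx f u) (map_mx f v) (fun a => map_mx f (du a)) (fun a => map_mx f (dv a)).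
Proof.
rewrite /jet_courant map_mxD map_col_mx map_mx0 map_mx_sum /=.
congr (_ + col_mx 0 _).
  by apply: eq_bigr => a _; rewrite map_mxB !map_mxZ !mxE.
apply/colP => k; rewrite !mxE /swap_form.
have -> : @swap_mx G D = map_mx f (@swap_mx F D).
  by rewrite /swap_mx map_block_mx !map_mx0 !map_mx1.
by rewrite map_trmx -!map_mxM [RHS]mxE.
Qed.

(** Beside the derivatives of eta along X and of xi along Y, the covector part contains eta_a d_k
    X^a from the Lie derivative and Y^a d_k xi_a from the contraction of d xi; together these are
    [swap_form] of d_k u and v. *)
Lemma courantE (u v : 'cV[R]_D -> 'cV[R]_(D + D)) x :
  courant u v x = jet_courant (u x) (v x) (fun a => pd_mx a u x) (fun a => pd_mx a v x).
Proof.
have up (w : 'cV[R]_D -> 'cV[R]_(D + D)) k :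
    (fun y => usubmx (w y) k 0) = (fun y => w y (lshift D k) 0).
  by apply/funext => y; rewrite mxE.
have dn (w : 'cV[R]_D -> 'cV[R]_(D + D)) k :
    (fun y => dsubmx (w y) k 0) = (fun y => w y (rshift D k) 0).
  by apply/funext => y; rewrite mxE.
apply/colP => k; rewrite [RHS]mxE summxE /courant.
case: (split_ordP k) => c ->.
  rewrite !col_mxEu [X in _ = _ + X]mxE addr0 mxE; apply: eq_bigr => a _.
  by rewrite !up !mxE.
rewrite !col_mxEd [X in _ = _ + X]mxE swap_formE.
rewrite [LHS]mxE [X in X + _]mxE [X in _ + X]mxE [X in - X]mxE -sumrB -big_split /=.
apply: eq_bigr => a _; by rewrite !mxE !up !dn; ring.
Qed.

Lemma courantCE (u v : 'cV[R]_D -> 'cV[C]_(D + D)) x :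
  courantC u v x =
  jet_courant (u x) (v x) (fun a => pd_mxC a u x) (fun a => pd_mxC a v x).
Proof.
rewrite [in RHS](mxC_ReIm (u x)) [in RHS](mxC_ReIm (v x)).
have mj (u' v' : 'cV[R]_D -> 'cV[R]_(D + D)) : toC (courant u' v' x) =
    jet_courant (toC (u' x)) (toC (v' x)) 
      (fun a => toC (pd_mx a u' x)) (fun a => toC (pd_mx a v' x)).
  exact: etrans (congr1 toC (courantE u' v' x)) (map_jet_courant _ _ _ _ _).
have mB (w w' : 'cV[R]_(D + D)) : toC (w - w') = toC w - toC w' by exact: map_mxB.
have mD (w w' : 'cV[R]_(D + D)) : toC (w + w') = toC w + toC w' by exact: map_mxD.
have dE w : (fun a => @pd_mxC (D + D) 1 a w x) = (fun a =>
   toC (pd_mx a (fun y => mxRe (w y)) x) + 'i%C *: toC (pd_mx a (fun y => mxIm (w y)) x)).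
  by apply/funext => a; rewrite /pd_mxC mxCE.
rewrite !dE (jet_courant_iota imag_sq); apply: etrans (mxCE _ _) _.
apply: (congr2 (fun w w' => w + 'i%C *: w')).
  by apply: etrans (mB _ _) _; apply: (congr2 (fun w w' => w - w')); exact: mj.
by apply: etrans (mD _ _) _; apply: (congr2 +%R); exact: mj.
Qed.

Section PdMatrix.
Variables (p q r : nat) (a : 'I_D) (x : 'cV[R]_D).

Definition derivable_entries p q (F : 'cV[R]_D -> 'M[R]_(p, q)) :=
  forall i j, derivable (fun y => F y i j) x (delta_mx a 0).

Lemma pd_mxM (F : 'cV[R]_D -> 'M[R]_(p, q)) (G : 'cV[R]_D -> 'M[R]_(q, r)) :
  derivable_entries F -> derivable_entries G ->
  pd_mx a (fun y => F y *m G y) x = pd_mx a F x *m G x + F x *m pd_mx a G x.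
Proof.
move=> dF dG; apply/matrixP => i j; rewrite !mxE.
rewrite (_ : (fun y => (F y *m G y) i j) = (fun y => \sum_l F y i l * G y l j)).
  rewrite pd_sum -?big_split /=; last first.
    by move=> l; apply: derivableM; [exact: dF|exact: dG].
  apply: eq_bigr => l _; rewrite pdM; [|exact: dF|exact: dG].
  by rewrite !mxE.
by apply/funext => y; rewrite mxE.
Qed.

Lemma pd_mxN (F : 'cV[R]_D -> 'M[R]_(p, q)) : derivable_entries F ->
  pd_mx a (fun y => - F y) x = - pd_mx a F x.
Proof.
move=> dF; apply/matrixP => i j; rewrite !mxE -pdN; last exact: dF.
by congr (pd a _ x); apply/funext => y; rewrite mxE.
Qed.

Lemma pd_mxD (F G : 'cV[R]_D -> 'M[R]_(p, q)) :
  derivable_entries F -> derivable_entries G ->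
  pd_mx a (fun y => F y + G y) x = pd_mx a F x + pd_mx a G x.
Proof.
move=> dF dG; apply/matrixP => i j; rewrite !mxE -pdD; [|exact: dF|exact: dG].
by congr (pd a _ x); apply/funext => y; rewrite mxE.
Qed.

Lemma pd_mx_tr (F : 'cV[R]_D -> 'M[R]_(p, q)) :
  pd_mx a (fun y => (F y)^T) x = (pd_mx a F x)^T.
Proof.
by apply/matrixP => i j; rewrite !mxE; congr (pd a _ x); apply/funext => y; rewrite mxE.
Qed.

Lemma pd_mx_cst (B : 'M[R]_(p, q)) : pd_mx a (fun=> B) x = 0.
Proof. by apply/matrixP => i j; rewrite !mxE pd_cst. Qed.

Lemma pd_mx_eq_on (U : set 'cV[R]_D) (F G : 'cV[R]_D -> 'M[R]_(p, q)) :
  open U -> U x -> (forall y, U y -> F y = G y) -> pd_mx a F x = pd_mx a G x.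
Proof.
move=> oU Ux FG; apply/matrixP => i j; rewrite !mxE.
by apply: (pd_eq_on a oU Ux) => y Uy; rewrite FG.
Qed.

Lemma smooth_derivable (U : set 'cV[R]_D) (F : 'cV[R]_D -> 'M[R]_(p, q)) :
  U x -> smooth_on U F -> derivable_entries F.
Proof. by move=> Ux sF i j; have [_ + _] := sF 1%N i j; apply. Qed.
End PdMatrix.

(** The connection enters only through its symbols at x, so [Gam] is a family of constant matrices;
    the eigen-equations are assumed on all of U because they get differentiated. *)
Lemma integrable_criterion (J : 'cV[R]_D -> 'M[R]_(D + D)) (U : set 'cV[R]_D)
    (Gam : 'I_D -> 'M[R]_D) x (u v : 'cV[R]_D -> 'cV[C]_(D + D)) :
  open U -> U x -> smooth_on U J ->
  J x *m J x = - 1%:M ->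
  (J x)^T *m swap_mx R D = - (swap_mx R D *m J x) ->
  (forall a b k, Gam a k b = Gam b k a) ->
  (forall w z : 'cV[C]_(D + D),
    toC (J x) *m w = 'i%C *: w -> toC (J x) *m z = 'i%C *: z ->
    \sum_a z (lshift D a) 0 *: (toC (pd_mx a J x + gen_connection Gam a *m J x
                                     - J x *m gen_connection Gam a) *m w) = 0) ->
  smoothC_on U u -> smoothC_on U v ->
  (forall y, U y -> toC (J y) *m u y = 'i%C *: u y) ->
  (forall y, U y -> toC (J y) *m v y = 'i%C *: v y) ->
  toC (J x) *m courantC u v x = 'i%C *: courantC u v x.
Proof.
move=> oU Ux sJ J2 JQ tf par su sv Ju Jv; rewrite courantCE.
have mapS : @swap_mx C D = toC (@swap_mx R D).
  by rewrite /swap_mx map_block_mx !map_mx0 !map_mx1.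
have mapG a : toC (gen_connection Gam a) = gen_connection (fun a => toC (Gam a)) a.
  by rewrite /gen_connection map_block_mx !map_mx0 map_mxN map_trmx.
have jetL w : smoothC_on U w -> (forall y, U y -> toC (J y) *m w y = 'i%C *: w y) ->
    forall a, toC (pd_mx a J x) *m w x + toC (J x) *m pd_mxC a w x = 'i%C *: pd_mxC a w x.
  move=> [sr si] Jw a.
  (* J is real, so the eigen-equation splits into two real equations, to which the real Leibniz rule
     applies. *)
  have Jri y : U y -> J y *m mxRe (w y) = - mxIm (w y) /\ J y *m mxIm (w y) = mxRe (w y).
    move=> Uy; have := Jw _ Uy; rewrite {1}(mxC_ReIm (w y)) mulmxDr -scalemxAr -!map_mxM.
    rewrite -mxCE => /matrixP e.
    split; apply/matrixP => i j; have := e i j; rewrite [LHS]mxE [RHS]mxE;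
      case wij : (w y i j) => [s t]; move/eqP; rewrite eq_complex /= => /andP[/eqP er /eqP ei].
      by rewrite er !mxE wij /=; ring.
    by rewrite ei !mxE wij /=; ring.
  have dJ : derivable_entries a x J by exact: smooth_derivable sJ.
  have dr : derivable_entries a x (fun y => mxRe (w y)) by exact: smooth_derivable sr.
  have di : derivable_entries a x (fun y => mxIm (w y)) by exact: smooth_derivable si.
  have e1 := pd_mxM dJ dr; have e2 := pd_mxM dJ di.
  rewrite (pd_mx_eq_on a oU Ux (fun y Uy => (Jri y Uy).1)) pd_mxN // in e1.
  rewrite (pd_mx_eq_on a oU Ux (fun y Uy => (Jri y Uy).2)) in e2.
  rewrite /pd_mxC !mxCE {1}(mxC_ReIm (w x)) !mulmxDr -!scalemxAr -!map_mxM.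
  rewrite addrACA -scalerDr -!map_mxD -e1 -e2 map_mxN scalerDr scalerA imag_sq.
  by rewrite scaleN1r addrC.
apply: (@jet_courant_eigen _ _ _ _ _ _ (fun a => toC (pd_mx a J x)) (fun a => toC (Gam a))).
- exact: imag_sq.
- by rewrite pnatr_eq0.
- by rewrite -map_mxM J2 map_mxN map_mx1.
- by rewrite map_trmx mapS -!map_mxM JQ map_mxN.
- by move=> a b k; rewrite !mxE tf.
- move=> w z Jw Jz; rewrite -[RHS](par w z Jw Jz); apply: eq_bigr => a _.
  by rewrite map_mxB map_mxD !map_mxM mapG.
- exact: Ju.
- exact: Jv.
- exact: jetL.
- exact: jetL.
Qed.

End CourantBracket.

(** * The complex structure of a Kahler manifold is parallel *)

(* Identities between linear combinations of matrix products, the products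
   being treated as atoms. *)
Ltac mx_ring :=
  do ?[move: (_ *m _) => ?];
  apply/matrixP => ? ?; rewrite !mxE; ring.

Section KahlerAlgebra.
Variables (R : realFieldType) (d : nat).
Implicit Types (m : 'I_d -> 'M[R]_d) (X Y Z : 'cV[R]_d).

(** When m lists partial derivatives, this is the derivative in the direction X. *)
Definition contract m X : 'M[R]_d := \sum_a X a 0 *: m a.

Lemma contractMr m X (B : 'M[R]_d) : contract (fun a => m a *m B) X = contract m X *m B.
Proof. by rewrite mulmx_suml; apply: eq_bigr => a _; rewrite scalemxAl. Qed.

Lemma contractMl m X (B : 'M[R]_d) : contract (fun a => B *m m a) X = B *m contract m X.
Proof. by rewrite mulmx_sumr; apply: eq_bigr => a _; rewrite scalemxAr. Qed.

Lemma contractD m m' X : contract (fun a => m a + m' a) X = contract m X + contract m' X.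
Proof. by rewrite -big_split; apply: eq_bigr => a _; rewrite scalerDr. Qed.

Lemma contractN m X : contract (fun a => - m a) X = - contract m X.
Proof. by rewrite -sumrN; apply: eq_bigr => a _; rewrite scalerN. Qed.

Lemma contract_tr m X : contract (fun a => (m a)^T) X = (contract m X)^T.
Proof. by rewrite /contract linear_sum; apply: eq_bigr => a _; rewrite linearZ. Qed.

Lemma contract_delta m a : contract m (delta_mx a 0) = m a.
Proof.
rewrite /contract (bigD1 a) //= !mxE !eqxx scale1r big1 ?addr0 // => b ba.
by rewrite mxE (negPf ba) scale0r.
Qed.

Lemma contract_sym m X Y : (forall a b k, m a k b = m b k a) ->
  contract m X *m Y = contract m Y *m X.
Proof.
move=> sym; have e V W : contract m V *m W = \col_k \sum_a \sum_b V a 0 * (m a k b * W b 0).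
  apply/colP => k; rewrite mulmx_suml summxE mxE; apply: eq_bigr => a _.
  by rewrite -scalemxAl mxE mxE mulr_sumr.
rewrite !e; apply/colP => k; rewrite !mxE exchange_big; apply: eq_bigr => a _.
by apply: eq_bigr => b _; rewrite sym; ring.
Qed.

Variables (g I : 'M[R]_d) (dI dg Gam : 'I_d -> 'M[R]_d).
(** [dI] and [dg] stand for the partial derivatives of I and g at one point, [dw] for those of
    omega_I, and [S] for nabla I. The hypotheses below are the defining equations at that point and
    their first-order consequences. *)
Let dw a : 'M[R]_d := (dI a)^T *m g + I^T *m dg a.
Let S a := dI a + Gam a *m I - I *m Gam a.
Let W := I^T *m g.

Hypothesis g_sym : g^T = g.
Hypothesis g_unit : g \in unitmx.
Hypothesis I2 : I *m I = - 1%:M.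
Hypothesis Ig : I^T *m g = - (g *m I).
Hypothesis torsion_free : forall a b k, Gam a k b = Gam b k a.
Hypothesis metric : forall a, dg a = (Gam a)^T *m g + g *m Gam a.
Hypothesis dI2 : forall a, dI a *m I + I *m dI a = 0.
Hypothesis dIg : forall a, (dI a)^T *m g + I^T *m dg a = - (dg a *m I + g *m dI a).
Hypothesis nijenhuis : forall X Y,
  contract dI (I *m X) *m Y - contract dI (I *m Y) *m X
  + I *m (contract dI Y *m X) - I *m (contract dI X *m Y) = 0.
Hypothesis closed : forall X Y Z,
  (Y^T *m contract dw X *m Z + Z^T *m contract dw Y *m X
   + X^T *m contract dw Z *m Y) 0 0 = 0.

(** The covariant derivative of I^2 = -1. *)
Let S_I a : S a *m I = - (I *m S a).
Proof.
rewrite /S mulmxBl mulmxDl mulmxBr mulmxDr !mulmxA.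
rewrite -[Gam a *m I *m I]mulmxA I2 mulNmx mul1mx mulmxN mulmx1.
have -> : dI a *m I = - (I *m dI a) by apply/eqP; rewrite -addr_eq0 dI2.
rewrite ?mulmxDr ?mulmxBr ?mulmxN ?mulmxA ?I2 ?mulNmx ?mul1mx.
mx_ring.
Qed.

(** The covariant derivative of I^T g = - g I, with g parallel. *)
Let S_g a : (S a)^T *m g = - (g *m S a).
Proof.
have h := dIg a; rewrite metric in h.
rewrite /S !linearB !linearD /= !trmx_mul !(mulmxBl, mulmxDl, mulmxBr, mulmxDr).
have -> : (dI a)^T *m g = - (((Gam a)^T *m g + g *m Gam a) *m I + g *m dI a)
    - I^T *m ((Gam a)^T *m g + g *m Gam a) by rewrite -h addrK.
rewrite !(mulmxDr, mulmxDl) -(mulmxA _ I^T g) Ig !mulmxA Ig !mulmxN !mulNmx !mulmxA.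
mx_ring.
Qed.

(* T X Y Z = g((nabla_X I) Y, Z), which the closedness of omega_I and the vanishing
   of the Nijenhuis tensor force to be 0. *)
Let T X Y Z : R := ((contract S X *m Y)^T *m g *m Z) 0 0.

Let T_anti X Y Z : T X Y Z = - T X Z Y.
Proof.
have h : (contract S X)^T *m g = - (g *m contract S X).
  rewrite -contract_tr -contractMr -contractMl -contractN.
  by congr contract; apply/funext => a; exact: S_g.
rewrite /T !trmx_mul -(mulmxA Y^T) h mulmxN mulNmx mxE; congr (- _).
transitivity ((Y^T *m (g *m contract S X) *m Z)^T 0 0); first by rewrite [RHS]mxE.
by rewrite !trmx_mul g_sym trmxK !mulmxA.
Qed.

Let T_I X Y Z : T X (I *m Y) Z = T X Y (I *m Z).
Proof.
have h : contract S X *m I = - (I *m contract S X).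
  by rewrite -contractMr -contractMl -contractN; congr contract; apply/funext => a; exact: S_I.
rewrite /T [contract S X *m _]mulmxA h mulNmx -(mulmxA I) linearN /= (trmx_mul I) !mulNmx.
by rewrite -(mulmxA _ I^T g) Ig mulmxN mulNmx opprK !mulmxA.
Qed.

Let contract_S X : contract S X = contract dI X + contract Gam X *m I - I *m contract Gam X.
Proof. by rewrite /S !contractD contractN contractMl contractMr. Qed.

(** For a torsion-free connection d omega_I is the cyclic sum of nabla omega_I: the terms in Gam
    cancel in pairs by symmetry. *)
Let T_cyc X Y Z : T X Y Z + T Y Z X + T Z X Y = 0.
Proof.
have dwE a : dw a = (S a)^T *m g + (Gam a)^T *m W + W *m Gam a.
  rewrite /dw metric /S /W !linearB !linearD /= !trmx_mul !(mulmxBl, mulmxDl, mulmxDr).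
  rewrite !mulmxA; mx_ring.
have WT : W^T = - W by rewrite /W trmx_mul trmxK g_sym Ig opprK.
have cE V : contract dw V = (contract S V)^T *m g + (contract Gam V)^T *m W
    + W *m contract Gam V.
  rewrite -!contract_tr -!contractMr -contractMl -!contractD.
  by congr contract; apply/funext => a; exact: dwE.
have wE V V' : (V^T *m W *m V') 0 0 = - (V'^T *m W *m V) 0 0.
  transitivity ((V^T *m W *m V')^T 0 0); first by rewrite [RHS]mxE.
  by rewrite trmx_mul (trmx_mul V^T) WT trmxK mulNmx mulmxN mxE mulmxA.
have key V1 V2 V3 : (V2^T *m contract dw V1 *m V3) 0 0 =
    T V1 V2 V3 + ((contract Gam V1 *m V2)^T *m W *m V3) 0 0
    - ((contract Gam V1 *m V3)^T *m W *m V2) 0 0.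
  rewrite -wE cE /T !trmx_mul !mulmxDr !mulmxDl !mulmxA mxE [X in X + _]mxE.
  by [].
have := closed X Y Z; rewrite mxE [X in X + _]mxE !key.
rewrite (contract_sym Y X) // (contract_sym Z X) // (contract_sym Z Y) //.
set t := T X Y Z; set t' := T Y Z X; set t'' := T Z X Y; lra.
Qed.

(** Torsion-freeness lets nabla I replace the partial derivatives of I in the Nijenhuis tensor,
    which is then paired with Z; I crosses g with a sign. *)
Let T_nijenhuis X Y Z :
  T (I *m X) Y Z - T (I *m Y) X Z - T Y X (I *m Z) + T X Y (I *m Z) = 0.
Proof.
have N : contract S (I *m X) *m Y - contract S (I *m Y) *m X
  + I *m (contract S Y *m X) - I *m (contract S X *m Y) = 0.
  rewrite -(nijenhuis X Y) !contract_S !mulmxBl !mulmxDl !mulmxBr !mulmxDr.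
  have gs := contract_sym _ _ torsion_free.
  rewrite -!mulmxA (gs (I *m X) (I *m Y)) (gs (I *m X) Y) (gs (I *m Y) X) (gs X Y).
  mx_ring.
have := congr1 (fun V => (V^T *m g *m Z) 0 0) N; rewrite !linearD !linearN /=.
rewrite !mulmxDl !mulNmx trmx0 !mul0mx mxE [X in X + _]mxE [X in X + _ + _]mxE.
have Tadj V : ((I *m V)^T *m g *m Z) 0 0 = - (V^T *m g *m (I *m Z)) 0 0.
  by rewrite trmx_mul -(mulmxA V^T I^T) Ig mulmxN mulNmx mxE !mulmxA.
have neg (A : 'M[R]_1) : (- A) 0 0 = - A 0 0 by rewrite mxE.
by rewrite [RHS]mxE !neg !Tadj => h; rewrite /T; lra.
Qed.

(** The sum of the cyclic identities at (I X, Y, Z) and (X, I Y, Z), minus the Nijenhuis identity at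
    (X, Y, Z), is 2 T(Z, I X, Y). *)
Let T0 X Y Z : T Z (I *m X) Y = 0.
Proof.
have := T_nijenhuis X Y Z.
have := T_cyc (I *m X) Y Z; have := T_cyc X (I *m Y) Z; have := T_cyc X Y (I *m Z).
rewrite (T_anti (I *m Y) X Z) (T_anti Y X (I *m Z)) -(T_I X Y Z) (T_I Z X Y).
by rewrite (T_I Y Z X); lra.
Qed.

Lemma kahler_parallel a : dI a + Gam a *m I - I *m Gam a = 0.
Proof.
(* Taking - I X in [T0] undoes the I in its second argument. *)
have TZ X Y : T (delta_mx a 0) X Y = 0.
  have := T0 (- (I *m X)) Y (delta_mx a 0).
  by rewrite mulmxN mulmxA I2 mulNmx opprK mul1mx.
rewrite -/(S a); suff h : (S a)^T *m g = 0.
  by apply: trmx_inj; rewrite -(mulmxK g_unit (S a)^T) h mul0mx trmx0.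
apply/matrixP => b c; have := TZ (delta_mx b 0) (delta_mx c 0).
rewrite /T contract_delta trmx_mul -(mulmxA _ (S a)^T g) trmx_delta.
by rewrite -rowE -colE !mxE.
Qed.

End KahlerAlgebra.

(** * The Levi-Civita connection in a chart, and Kähler structures as parallel fields *)

Section KahlerChart.
Variable R : realType.

Lemma posdef_unitmx d (g : 'M[R]_d) :
  (forall v : 'cV[R]_d, v != 0 -> 0 < (v^T *m g *m v) 0 0) -> g \in unitmx.
Proof.
move=> pos; rewrite -row_free_unit -kermx_eq0; apply/rowV0P => v /sub_kermxP vg.
apply/eqP/negPn/negP => v0; have := pos v^T.
by rewrite trmxK vg mul0mx mxE ltxx trmx_eq0 => /(_ v0).
Qed.

(* The Levi-Civita connection of g when dg a is the a-th partial derivative of g. *)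
Definition christoffel d (g : 'M[R]_d) (dg : 'I_d -> 'M[R]_d) (a : 'I_d) : 'M[R]_d :=
  2^-1 *: (invmx g *m \matrix_(l, b) (dg a b l + dg b a l - dg l a b)).

Lemma christoffel_sym d (g : 'M[R]_d) dg : (forall a, (dg a)^T = dg a) ->
  forall a b k, christoffel g dg a k b = christoffel g dg b k a.
Proof.
move=> sym a b k; rewrite !mxE; congr (_ * _); apply: eq_bigr => l _.
congr (_ * _); rewrite [LHS]mxE [RHS]mxE; congr (_ - _); first exact: addrC.
by rewrite -[in RHS]sym [RHS]mxE.
Qed.

Lemma christoffel_metric d (g : 'M[R]_d) dg :
  g \in unitmx -> g^T = g -> (forall a, (dg a)^T = dg a) ->
  forall a, dg a = (christoffel g dg a)^T *m g + g *m christoffel g dg a.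
Proof.
move=> u gT sym a.
have e : g *m christoffel g dg a =
    2^-1 *: \matrix_(l, b) (dg a b l + dg b a l - dg l a b).
  by rewrite /christoffel -scalemxAr mulKVmx.
have -> : (christoffel g dg a)^T *m g = (g *m christoffel g dg a)^T.
  by rewrite trmx_mul gT.
have s c i j : dg c i j = dg c j i by rewrite -[in LHS]sym [LHS]mxE.
rewrite e; apply/matrixP => l b; rewrite !mxE (s a l b).
by move: (dg a b l) (dg b a l) (dg l a b) => p q r; field.
Qed.

Lemma lie_bracketE d (X Y : 'cV[R]_d -> 'cV[R]_d) x :
  lie_bracket X Y x =
  \sum_a (X x a 0 *: pd_mx a Y x - Y x a 0 *: pd_mx a X x).
Proof.
by apply/colP => k; rewrite mxE summxE; apply: eq_bigr => a _; rewrite !mxE.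
Qed.

Lemma contract_form d (m : 'I_d -> 'M[R]_d) (X Y Z : 'cV[R]_d) :
  (Y^T *m contract m X *m Z) 0 0 =
  \sum_a \sum_b \sum_c X a 0 * Y b 0 * Z c 0 * m a b c.
Proof.
rewrite mulmx_sumr mulmx_suml summxE; apply: eq_bigr => a _.
rewrite -scalemxAr -scalemxAl mxE mxE mulr_sumr exchange_big /=.
apply: eq_bigr => c _; rewrite mxE mulr_suml mulr_sumr; apply: eq_bigr => b _.
by rewrite mxE; ring.
Qed.

Lemma sum_rot d (F : 'I_d -> 'I_d -> 'I_d -> R) :
  \sum_a \sum_b \sum_c F a b c = \sum_a \sum_b \sum_c F b c a.
Proof.
rewrite [RHS]exchange_big; apply: eq_bigr => a _.
by rewrite [RHS]exchange_big.
Qed.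

Lemma sum3D d (F G H : 'I_d -> 'I_d -> 'I_d -> R) :
  \sum_a \sum_b \sum_c F a b c + \sum_a \sum_b \sum_c G a b c
    + \sum_a \sum_b \sum_c H a b c =
  \sum_a \sum_b \sum_c (F a b c + G a b c + H a b c).
Proof.
rewrite -!big_split; apply: eq_bigr => a _; rewrite -!big_split.
by apply: eq_bigr => b _; rewrite -!big_split.
Qed.

(** After rotation of the summation indices the three terms share the coefficient X_a Y_b Z_c. *)
Lemma closed_contract d (m : 'I_d -> 'M[R]_d) :
  (forall a b c, m a b c + m b c a + m c a b = 0) ->
  forall X Y Z : 'cV[R]_d, (Y^T *m contract m X *m Z + Z^T *m contract m Y *m X
    + X^T *m contract m Z *m Y) 0 0 = 0.
Proof.
move=> cl X Y Z; rewrite mxE [X in X + _]mxE !contract_form.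
rewrite [X in _ + X + _]sum_rot [X in _ + X]sum_rot [X in _ + X]sum_rot.
rewrite sum3D big1 // => a _; rewrite big1 // => b _; rewrite big1 // => c _.
transitivity (X a 0 * Y b 0 * Z c 0 * (m a b c + m b c a + m c a b)).
  by ring.
by rewrite cl mulr0.
Qed.

Section Chart.
Variables (M : topologicalType) (d : nat) (A : atlas R M d).
Variables (g I : tensor A d) (i : idx A) (x : 'cV[R]_d).
Hypothesis mA : smooth_manifold A.
Hypothesis rg : riemannian g.
Hypothesis Ux : codom_chart i x.
Let U := codom_chart i.
Let gx := in_chart g i.
Let Ix := in_chart I i.

Lemma psi_dom y : codom_chart i y -> dom i (psi i y).
Proof. by move=> [p pi <-]; rewrite man_phiK. Qed.

Let oU : open U. Proof. exact: man_open_codom. Qed.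

Let g_sym y : U y -> (gx y)^T = gx y.
Proof. by move=> /psi_dom; exact: riem_sym. Qed.

Let dg_sym a : (pd_mx a gx x)^T = pd_mx a gx x.
Proof. by rewrite -pd_mx_tr; exact: pd_mx_eq_on oU Ux g_sym. Qed.

Lemma metric_unit y : U y -> gx y \in unitmx.
Proof. by move=> /psi_dom py; apply: posdef_unitmx; by apply: (riem_pos rg). Qed.

Let nabla := christoffel (gx x) (fun c => pd_mx c gx x).

Lemma levi_civita_torsion_free a b k : nabla a k b = nabla b k a.
Proof. exact: christoffel_sym. Qed.

Lemma levi_civita_metric a :
  pd_mx a gx x = (nabla a)^T *m gx x + gx x *m nabla a.
Proof. by apply: christoffel_metric; [exact: metric_unit|exact: g_sym|exact: dg_sym]. Qed.

Hypothesis kI : kahler g I.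

Let I_sq y : U y -> Ix y *m Ix y = - 1%:M.
Proof. by move=> /psi_dom; apply: cs_sq; exact: kahler_complex kI. Qed.

Lemma kahler_skew y : U y -> (Ix y)^T *m gx y = - (gx y *m Ix y).
Proof.
move=> Uy; have := kahler_compat kI (psi_dom Uy) => h.
have -> : gx y *m Ix y = (Ix y)^T *m gx y *m Ix y *m Ix y by rewrite h.
by rewrite -[_ *m Ix y *m Ix y]mulmxA I_sq // mulmxN mulmx1 opprK.
Qed.

Lemma kahler_covariant a :
  pd_mx a Ix x + nabla a *m Ix x - Ix x *m nabla a = 0.
Proof.
have dI b : derivable_entries b x Ix.
  apply: smooth_derivable Ux _; exact: cs_smooth (kahler_complex kI) i.
have dg b : derivable_entries b x gx.
  apply: smooth_derivable Ux _; exact: riem_smooth rg i.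
have dIT b : derivable_entries b x (fun y => (Ix y)^T).
  move=> k l; have -> : (fun y => (Ix y)^T k l) = (fun y => Ix y l k).
    by apply/funext => y; rewrite mxE.
  exact: dI.
apply: (@kahler_parallel _ _ (gx x) (Ix x) (fun b => pd_mx b Ix x) (fun b => pd_mx b gx x)).
- exact: g_sym.
- exact: metric_unit.
- exact: I_sq.
- exact: kahler_skew.
- exact: levi_civita_torsion_free.
- exact: levi_civita_metric.
- by move=> b; rewrite -pd_mxM // (pd_mx_eq_on b oU Ux I_sq) pd_mx_cst.
- move=> b; have dp : derivable_entries b x (fun y => gx y *m Ix y).
    move=> k l; have -> : (fun y => (gx y *m Ix y) k l) = (fun y => \sum_j gx y k j * Ix y j l).
      by apply/funext => y; rewrite mxE.
    have -> : (fun y => \sum_j gx y k j * Ix y j l) = \sum_j (fun y => gx y k j * Ix y j l).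
      by apply/funext => y; rewrite fct_sumE.
    by apply: derivable_sum => j; apply: derivableM; [exact: dg|exact: dI].
  have e1 := pd_mxM (dIT b) (dg b); rewrite pd_mx_tr in e1.
  rewrite -e1 -(pd_mxM (dg b) (dI b)) -(pd_mxN dp).
  exact: pd_mx_eq_on oU Ux kahler_skew.
(* The Nijenhuis condition is evaluated on constant fields, whose brackets leave only derivatives of
   I. *)
- move=> X Y.
  have dIX (V : 'cV[R]_d) b : pd_mx b (fun y => Ix y *m V) x = pd_mx b Ix x *m V.
    by rewrite pd_mxM ?pd_mx_cst ?mulmx0 ?addr0 // => k l; exact: derivable_cst.
  have sI (V W : 'cV[R]_d) : \sum_b V b 0 *: pd_mx b (fun y => Ix y *m W) x =
      contract (fun b => pd_mx b Ix x) V *m W.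
    by rewrite mulmx_suml; apply: eq_bigr => b _; rewrite dIX scalemxAl.
  have sC (V W : 'cV[R]_d) : \sum_b V b 0 *: pd_mx b (fun=> W) x = 0.
    by rewrite big1 // => b _; rewrite pd_mx_cst scaler0.
  have N := cs_nijenhuis (kahler_complex kI) oU (@subset_refl _ U)
    (smooth_cst oU X) (smooth_cst oU Y) Ux.
  have b1 : lie_bracket (fun y => Ix y *m X) (fun y => Ix y *m Y) x =
      contract (fun b => pd_mx b Ix x) (Ix x *m X) *m Y
      - contract (fun b => pd_mx b Ix x) (Ix x *m Y) *m X.
    by rewrite lie_bracketE sumrB (sI _ X) (sI _ Y).
  have b2 : lie_bracket (fun y => Ix y *m X) (fun=> Y) x =
      - (contract (fun b => pd_mx b Ix x) Y *m X).
    by rewrite lie_bracketE sumrB (sI _ X) (sC _ Y) sub0r.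
  have b3 : lie_bracket (fun=> X) (fun y => Ix y *m Y) x =
      contract (fun b => pd_mx b Ix x) X *m Y.
    by rewrite lie_bracketE sumrB (sI _ Y) (sC _ X) subr0.
  have b4 : lie_bracket (fun=> X) (fun=> Y) x = 0.
    by rewrite lie_bracketE sumrB (sC _ X) (sC _ Y) subr0.
  rewrite /= -/Ix b1 b2 b3 b4 subr0 mulmxN opprK in N.
  by rewrite -[RHS]N addrAC.
- apply: closed_contract => b c e.
  etransitivity; last exact: (kahler_closed kI Ux b c e).
  have dwE k l m : ((pd_mx k Ix x)^T *m gx x + (Ix x)^T *m pd_mx k gx x) l m =
      pd k (fun y => ((Ix y)^T *m gx y) l m) x.
    by rewrite -pd_mx_tr -(pd_mxM (dIT k) (dg k)); exact: pd_mxE.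
  by congr (_ + _ + _); exact: dwE.
Qed.

End Chart.
End KahlerChart.

(** * Bihermitian endomorphisms *)

Section Bihermitian.
Variables (F : fieldType) (d : nat).
Hypothesis two0 : 2 != 0 :> F.
Implicit Types (eps : F) (g A B : 'M[F]_d) (w : 'cV[F]_(d + d)).

(* The columns of graph_col eps g span the graph of - eps g; graph_row eps g
   vanishes on the graph of eps g. *)
Definition graph_col eps g : 'M[F]_(d + d, d) := col_mx 1%:M (- eps *: g).
Definition graph_row eps g : 'M[F]_(d, d + d) := row_mx 1%:M (- eps *: invmx g).

(* J_(alpha, beta) = bihermitian 1 g I_alpha + bihermitian (-1) g I_beta. *)
Definition bihermitian eps g A : 'M[F]_(d + d) :=
  - 2^-1 *: (graph_col eps g *m A *m graph_row eps g).

Lemma bihermitianE eps g A : eps ^+ 2 = 1 ->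
  bihermitian eps g A = 2^-1 *: block_mx (- A) (eps *: (A *m invmx g))
    (eps *: (g *m A)) (- (g *m A *m invmx g)).
Proof.
move=> e2; rewrite /bihermitian mul_col_mx mul_col_row scaleNr -scalerN opp_block_mx.
rewrite !mul1mx !mulmx1 -!scalemxAr -!scalemxAl !scalerA !scaleNr !opprK mulrNN -expr2 e2.
by rewrite scale1r.
Qed.

Lemma bihermitianZ eps g c A : bihermitian eps g (c *: A) = c *: bihermitian eps g A.
Proof. by rewrite /bihermitian -scalemxAr -scalemxAl !scalerA mulrC. Qed.

Lemma bihermitian_sum eps g (I : finType) (f : I -> 'M[F]_d) :
  bihermitian eps g (\sum_i f i) = \sum_i bihermitian eps g (f i).
Proof.
by rewrite /bihermitian mulmx_sumr mulmx_suml scaler_sumr.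
Qed.

(** For signs the value is 2 when they agree and 0 when they differ. Hence A |-> - bihermitian eps g
    A is multiplicative, and the two signs annihilate each other. *)
Lemma graph_mul eps eps' g : g \in unitmx ->
  graph_row eps g *m graph_col eps' g = (1 + eps * eps')%:M.
Proof.
move=> u; rewrite mul_row_col mulmx1 -scalemxAl -scalemxAr scalerA mulrNN mulVmx //.
by rewrite scalemx1 raddfD.
Qed.

Lemma bihermitian_mul_same eps g A B : g \in unitmx -> eps ^+ 2 = 1 ->
  bihermitian eps g A *m bihermitian eps g B = - bihermitian eps g (A *m B).
Proof.
move=> u e2; rewrite /bihermitian -scalemxAl -scalemxAr.
rewrite !mulmxA -(mulmxA _ (graph_row _ _) (graph_col _ _)) graph_mul // -expr2 e2.
rewrite mul_mx_scalar -!scalemxAl !scalerA -scaleNr; congr (_ *: _).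
by field.
Qed.

Lemma bihermitian_mul_opp g A B : g \in unitmx ->
  bihermitian 1 g A *m bihermitian (-1) g B = 0 /\
  bihermitian (-1) g A *m bihermitian 1 g B = 0.
Proof.
move=> u; rewrite /bihermitian; split; rewrite -scalemxAl -scalemxAr;
  rewrite !mulmxA -(mulmxA _ (graph_row _ _) (graph_col _ _)) graph_mul //.
  by rewrite mul1r subrr raddf0 mulmx0 !mul0mx !scaler0.
by rewrite mulr1 subrr raddf0 mulmx0 !mul0mx !scaler0.
Qed.

(** The graphs of - g and g are complementary: the two operators - bihermitian eps g 1 are the
    projections onto them and add up to the identity. *)
Lemma bihermitian_sq g A B : g \in unitmx ->
  A *m A = - 1%:M -> B *m B = - 1%:M ->
  (bihermitian 1 g A + bihermitian (-1) g B) *m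
  (bihermitian 1 g A + bihermitian (-1) g B) = - 1%:M.
Proof.
move=> u A2 B2; rewrite mulmxDl !mulmxDr !bihermitian_mul_same ?sqrrN ?expr1n //.
rewrite (bihermitian_mul_opp A B u).1 (bihermitian_mul_opp B A u).2 addr0 add0r A2 B2.
rewrite -opprD !bihermitianE ?sqrrN ?expr1n // -scalerDr add_block_mx.
rewrite !(mulmxN, mulNmx, opprK, mul1mx, mulmx1) mulmxV // !scaleN1r !scale1r !subrr.
rewrite -!mulr2n -!scaler_nat scale_block_mx !scaler0 !scalerA mulVf // scale1r.
by rewrite -scalar_mx_block.
Qed.

Lemma bihermitian_skew eps g A : g \in unitmx -> eps ^+ 2 = 1 -> g^T = g ->
  A^T *m g = - (g *m A) ->
  (bihermitian eps g A)^T *m swap_mx F d = - (swap_mx F d *m bihermitian eps g A).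
Proof.
move=> u e2 gT Ag; rewrite bihermitianE // linearZ /= -scalemxAl -scalemxAr -scalerN.
congr (_ *: _); rewrite /swap_mx tr_block_mx !mulmx_block opp_block_mx.
have AT : A^T = - (g *m A *m invmx g) by rewrite -mulNmx -Ag mulmxK.
rewrite !(mulmx0, mul0mx, mulmx1, mul1mx, addr0, add0r) !linearN !linearZ /=.
rewrite !trmx_mul trmx_inv gT AT opprK.
congr block_mx.
- by rewrite mulNmx mulmxKV.
- by rewrite mulNmx mulmxKV // mulmxN mulmxA mulVmx // mul1mx.
- by rewrite mulmxN !mulmxA mulVmx // mul1mx.
Qed.

(** A change of coordinates compatible with the metrics carries the graph of eps gi to that of eps
    gj; in blocks this is [jV] and [jg]. *)
Lemma bihermitian_transport eps gi gj Ai Aj j : eps ^+ 2 = 1 ->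
  gi \in unitmx -> gj \in unitmx -> j \in unitmx ->
  gi = j^T *m gj *m j -> j *m Ai = Aj *m j ->
  block_mx j 0 0 (invmx j)^T *m bihermitian eps gi Ai =
  bihermitian eps gj Aj *m block_mx j 0 0 (invmx j)^T.
Proof.
move=> e2 ui uj jU ggj jA; rewrite !bihermitianE // -scalemxAl -scalemxAr.
congr (_ *: _); rewrite !mulmx_block !(mulmx0, mul0mx, addr0, add0r).
have jV : j *m invmx gi = invmx gj *m (invmx j)^T.
  have jT : j^T \in unitmx by rewrite unitmx_tr.
  apply: (can_inj (mulmxK ui)); rewrite mulmxKV //.
  by rewrite ggj trmx_inv !mulmxA mulmxKV // mulVmx // mul1mx.
have jg : (invmx j)^T *m gi = gj *m j.
  by rewrite ggj trmx_inv !mulmxA mulVmx ?unitmx_tr // mul1mx.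
congr block_mx; rewrite ?mulmxN ?mulNmx -?scalemxAr -?scalemxAl.
- by rewrite jA.
- by rewrite mulmxA jA -!mulmxA jV.
- by rewrite mulmxA jg -!mulmxA jA.
- by rewrite !mulmxA jg -(mulmxA gj) jA -!mulmxA jV.
Qed.

Section Action.
Variables (iota : F) (g : 'M[F]_d).
Hypothesis g_unit : g \in unitmx.

(** [graph_row eps g] reads off the component of w in the graph of - eps g, on which the
    endomorphism acts as - A or - B; so the eigenvalue iota turns into - iota, the type (0,1). *)
Lemma bihermitian_eigen A B w :
  (bihermitian 1 g A + bihermitian (-1) g B) *m w = iota *: w ->
  A *m (graph_row 1 g *m w) = - iota *: (graph_row 1 g *m w) /\
  B *m (graph_row (-1) g *m w) = - iota *: (graph_row (-1) g *m w).
Proof.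
move=> e; rewrite !scaleNr !scalemxAr -e mulmxDl !mulmxDr /bihermitian.
split.
all: rewrite -!scalemxAl -!scalemxAr !mulmxA !graph_mul // !(mul1r, mulN1r, mulr1, opprK) subrr.
all: rewrite raddf0 !mul0mx scaler0 ?addr0 ?add0r mul_scalar_mx -!scalemxAl !scalerA.
all: by rewrite mulNr -[1 + 1]/(2 : F) mulVf // scaleN1r opprK.
Qed.

Lemma bihermitian_kernel eps A w :
  A *m (graph_row eps g *m w) = 0 -> bihermitian eps g A *m w = 0.
Proof. by move=> h; rewrite /bihermitian -scalemxAl -!mulmxA h mulmx0 scaler0. Qed.

(** As [bihermitian] is linear in its last argument and sees w only through [graph_row eps g *m w],
    the question descends from the generalized tangent bundle to a tangent vector. *)
Lemma bihermitian_family eps n m (t : 'I_n -> F) (r : 'I_n -> 'I_m -> F)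
    (T : 'I_m -> 'M[F]_d) w :
  \sum_a t a *: (\sum_k r a k *: (T k *m (graph_row eps g *m w))) = 0 ->
  \sum_a t a *: ((\sum_k r a k *: bihermitian eps g (T k)) *m w) = 0.
Proof.
move=> h.
have -> : \sum_a t a *: ((\sum_k r a k *: bihermitian eps g (T k)) *m w) =
    bihermitian eps g (\sum_a t a *: \sum_k r a k *: T k) *m w.
  rewrite bihermitian_sum mulmx_suml; apply: eq_bigr => a _.
  rewrite bihermitianZ bihermitian_sum -scalemxAl; congr (_ *: (_ *m _)).
  by apply: eq_bigr => k _; rewrite bihermitianZ.
apply: bihermitian_kernel; rewrite -[RHS]h mulmx_suml; apply: eq_bigr => a _.
rewrite -scalemxAl mulmx_suml; congr (_ *: _); apply: eq_bigr => k _.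
by rewrite -scalemxAl.
Qed.
End Action.
End Bihermitian.

(** * The twistor sphere *)

Section Twistor.

Definition pick3 T (a b c : T) (k : 'I_3) : T :=
  match val k with 0%N => a | 1%N => b | _ => c end.

Lemma sum_pick3 (V : zmodType) (f : 'I_3 -> V) :
  \sum_k f k = f 0 + f 1 + f (Ordinal (isT : (2 < 3)%N)).
Proof.
rewrite !big_ord_recl big_ord0 addr0 addrA; congr (_ + f _ + f _); exact: val_inj.
Qed.

Lemma sum_I2 (V : zmodType) (f : 'I_2 -> V) : \sum_k f k = f 0 + f 1.
Proof.
by rewrite !big_ord_recl big_ord0 addr0; congr (_ + f _); exact: val_inj.
Qed.

Section Quaternions.
Variables (F : fieldType) (d : nat) (I J K : 'M[F]_d).

Record quaternionic : Prop := Quaternionic {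
  quatII : I *m I = - 1%:M; quatJJ : J *m J = - 1%:M; quatKK : K *m K = - 1%:M;
  quatIJ : I *m J = K; quatJI : J *m I = - K;
  quatJK : J *m K = I; quatKJ : K *m J = - I;
  quatKI : K *m I = J; quatIK : I *m K = - J }.

Hypothesis Q : quaternionic.

Lemma quaternion_sq (c : 'I_3 -> F) : \sum_k c k ^+ 2 = 1 ->
  (\sum_k c k *: pick3 I J K k) *m (\sum_k c k *: pick3 I J K k) = - 1%:M.
Proof.
case: Q => II JJ KK IJ JI JK KJ KI IK.
rewrite !sum_pick3 /=; move: (c 0) (c 1) (c _) => x y z s.
rewrite !mulmxDl !mulmxDr -!scalemxAl -!scalemxAr II JJ KK IJ JI JK KJ KI IK.
rewrite -[in RHS](scale1r 1%:M) -s; apply/matrixP => a b; rewrite !mxE; ring.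
Qed.

(* T^(0,1) of I_eta = {v + iota eta J v | v in T^(0,1) of I} depends
   holomorphically on eta; here s = -1 in the chart at infinity. *)
Lemma twistor_holomorphic (iota s x y : F) (p : 'cV[F]_d) :
  iota * iota = -1 -> s * s = 1 ->
  let q := x * x + y * y in let z := x + iota * y in
  (s * (1 - q)) *: (I *m p) + (2 * x) *: (J *m p) + (s * (2 * y)) *: (K *m p)
    = - (iota * (1 + q)) *: p ->
  (1 + q) *: (2 *: (J *m p) + (iota * s * 2) *: (K *m p)) =
  (4 * z) *: (s *: (I *m p) + x *: (J *m p) + (s * y) *: (K *m p)).
Proof.
move=> i2 s2 q z hr; case: Q => II JJ KK IJ JI JK KJ KI IK.
have := congr1 (mulmx J) hr; have := congr1 (mulmx K) hr.
rewrite !mulmxDr -!scalemxAr !mulmxA JI JJ JK KI KJ KK !mulNmx mul1mx.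
move: hr; move: (I *m p) (J *m p) (K *m p) => a b c hr hK hJ.
apply/colP => k.
move: hr hJ hK => /colP/(_ k) + /colP/(_ k) + /colP/(_ k).
rewrite !mxE -/q -/z; move: (a k 0) (b k 0) (c k 0) (p k 0) => ak bk ck pk hr hJ hK.
have er : s * (1 - q) * ak + 2 * x * bk + s * (2 * y) * ck + iota * (1 + q) * pk = 0.
  by rewrite hr; ring.
have eJ : - (s * (1 - q) * ck) - 2 * x * pk + s * (2 * y) * ak + iota * (1 + q) * bk = 0.
  by rewrite -[RHS](subrr (- (iota * (1 + q)) * bk)) -[X in _ = X - _]hJ; ring.
have eK : s * (1 - q) * bk - 2 * x * ak - s * (2 * y) * pk + iota * (1 + q) * ck = 0.
  by rewrite -[RHS](subrr (- (iota * (1 + q)) * ck)) -[X in _ = X - _]hK; ring.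
(* The two sides differ by multiples of the eigen-equation and of its images under J and K, modulo
   iota^2 = -1 and s^2 = 1. *)
transitivity (4 * z * (s * ak + x * bk + s * y * ck)
    - iota * (1 + q) * (- (s * (1 - q) * ck) - 2 * x * pk + s * (2 * y) * ak
                        + iota * (1 + q) * bk)
    + s * (1 + q) * (s * (1 - q) * bk - 2 * x * ak - s * (2 * y) * pk + iota * (1 + q) * ck)
    - 2 * z * (s * (1 - q) * ak + 2 * x * bk + s * (2 * y) * ck + iota * (1 + q) * pk)).
  by rewrite /z /q; ring: i2 s2.
by rewrite er eJ eK !mulr0 !subr0 addr0.
Qed.

(** By the quotient rule the coefficients in the conclusion are d_x + iota d_y of those of the
    eigen-equation, where (d_x + iota d_y) q = 2 z: up to a factor 2, this is d I_eta / d(conj eta)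
    applied to p. *)
Lemma twistor_kernel (iota s x y : F) (p : 'cV[F]_d) :
  iota * iota = -1 -> s * s = 1 ->
  let q := x * x + y * y in let z := x + iota * y in 1 + q != 0 ->
  (s * (1 - q) / (1 + q)) *: (I *m p) + (2 * x / (1 + q)) *: (J *m p)
    + (s * (2 * y) / (1 + q)) *: (K *m p) = - iota *: p ->
  ((- (2 * s * z) * (1 + q) - 2 * z * (s * (1 - q))) / (1 + q) ^+ 2) *: (I *m p)
  + ((2 * (1 + q) - 2 * z * (2 * x)) / (1 + q) ^+ 2) *: (J *m p)
  + ((2 * iota * s * (1 + q) - 2 * z * (s * (2 * y))) / (1 + q) ^+ 2) *: (K *m p) = 0.
Proof.
move=> i2 s2 q z q0 hr.
have hr' : (s * (1 - q)) *: (I *m p) + (2 * x) *: (J *m p) + (s * (2 * y)) *: (K *m p)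
    = - (iota * (1 + q)) *: p.
  have := congr1 (fun v => (1 + q) *: v) hr; rewrite !scalerDr !scalerA.
  by rewrite ![(1 + q) * (_ / _)]mulrC !divfK // mulrN [(1 + q) * _]mulrC.
have /colP e := twistor_holomorphic i2 s2 hr'.
move: e; rewrite -/q -/z; clear hr hr'; clearbody q z.
move: (I *m p) (J *m p) (K *m p) => u v w e.
apply/colP => k; have := e k; rewrite !mxE; move: (u k 0) (v k 0) (w k 0) => a b c h.
transitivity (((1 + q) * (2 * b + iota * s * 2 * c) - 4 * z * (s * a + x * b + s * y * c))
   / (1 + q) ^+ 2); first by field.
by rewrite h subrr mul0r.
Qed.
End Quaternions.
End Twistor.

(** * Stereographic coordinates of the family I_eta *)

Section Sphere.
Variable R : realType.

Definition sgn (b : bool) : R := if b then -1 else 1.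

(** The coefficients of I_eta on I, J, K. Replacing eta by 1 / eta changes the sign of the first and
    of the third, whence [sgn]; at y = 0 in the chart at infinity they give - I. *)
Definition stereo (b : bool) (k : 'I_3) (y : 'cV[R]_2) : R :=
  pick3 (sgn b * (1 - sqnorm y)) (2 * y 0 0) (sgn b * (2 * y 1 0)) k * (1 + sqnorm y)^-1.

Lemma sqnorm1_neq0 (y : 'cV[R]_2) : 1 + sqnorm y != 0.
Proof. by rewrite gt_eqF // ltr_pwDl // addr_ge0 // -expr2 sqr_ge0. Qed.

Lemma stereo_sq b y : \sum_k stereo b k y ^+ 2 = 1.
Proof.
have h := sqnorm1_neq0 y; rewrite sum_pick3 /stereo /pick3 /=.
move: h; rewrite /sqnorm; move: (y 0 0) (y 1 0) => s t h.
by case: b; rewrite /sgn; field.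
Qed.

Lemma Ck_stereo n b k : Ck n setT (stereo b k).
Proof.
have oT := @openT 'cV[R]_2.
have cq := Ck_sqnorm n oT.
apply: Ck_mul => //; last first.
  by apply: Ck_inv => // [x _|]; [exact: sqnorm1_neq0|apply: Ck_add => //; exact: Ck_cst].
case: k => -[|[|[|//]]] h; rewrite /pick3 /=.
- by apply: Ck_mul => //; [exact: Ck_cst|apply: Ck_add => //; [exact: Ck_cst|exact: Ck_opp]].
- by apply: Ck_mul => //; [exact: Ck_cst|exact: Ck_coord].
- apply: Ck_mul => //; first exact: Ck_cst.
  by apply: Ck_mul => //; [exact: Ck_cst|exact: Ck_coord].
Qed.

Lemma I_at_stereo d (I J K : 'M[R]_d) (b : idx (CP1_atlas R)) y :
  I_at I J K (psi b y) = \sum_k stereo b k y *: pick3 I J K k.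
Proof.
have h := sqnorm1_neq0 y; rewrite sum_pick3 /stereo.
case: b; last first.
  by rewrite /I_at /pick3 /sgn /sqnorm /= !mul1r -!expr2.
have [->|y0] := eqVneq y 0.
  rewrite /= eqxx /I_at /pick3 /sgn /sqnorm !mxE /=.
  by rewrite !mulr0 !mul0r !addr0 !subr0 invr1 !mulr1 !scale0r !addr0 scaleN1r.
have -> : psi (true : idx (CP1_atlas R)) y = Some (vecc y)^-1 by rewrite /= (negPf y0).
have q0 := sqnorm_neq0 y0.
have eR : complex.Re (vecc y)^-1 = y 0 0 * (sqnorm y)^-1 by rewrite -cinv0E /cinv mxE.
have eI : complex.Im (vecc y)^-1 = - (y 1 0 * (sqnorm y)^-1) by rewrite -cinv1E /cinv mxE.
rewrite /I_at eR eI.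
have eq : (y 0 0 * (sqnorm y)^-1) ^+ 2 + (- (y 1 0 * (sqnorm y)^-1)) ^+ 2 = (sqnorm y)^-1.
  by move: q0; rewrite /sqnorm => q0; field.
rewrite eq; have q1 : sqnorm y + 1 != 0 by rewrite addrC.
clear eq eR eI; move: h q0 q1; rewrite /pick3 /sgn /=.
move: (sqnorm y) (y 0 0) (y 1 0) => q s t h q0 q1.
by congr (_ *: _ + _ *: _ + _ *: _); field; rewrite ?q0 ?h ?q1.
Qed.

Lemma pd_stereo (a : 'I_2) b k (x : 'cV[R]_2) : pd a (stereo b k) x =
  (pick3 (- (2 * sgn b * x a 0)) (2 * (a == 0)%:R) (2 * sgn b * (a == 1)%:R) k * (1 + sqnorm x)
   - 2 * x a 0 * pick3 (sgn b * (1 - sqnorm x)) (2 * x 0 0) (sgn b * (2 * x 1 0)) k)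
  / (1 + sqnorm x) ^+ 2.
Proof.
have h := sqnorm1_neq0 x.
have dc c : derivable (fun=> c : R) x (delta_mx a 0) by exact: derivable_cst.
have dx c : derivable (fun y : 'cV[R]_2 => y c 0) x (delta_mx a 0) by exact: derivable_coord.
have dq : derivable (@sqnorm R) x (delta_mx a 0) by exact: derivable_sqnorm.
have d1 : derivable (fun y => 1 + @sqnorm R y) x (delta_mx a 0).
  exact: (derivableD (dc 1) dq).
have dV : derivable (fun y => (1 + @sqnorm R y)^-1) x (delta_mx a 0).
  exact: (@derivableV _ _ (fun y => 1 + @sqnorm R y) x (delta_mx a 0) h d1).
have pV := pdV h d1; rewrite (pdD (dc 1) dq) (pd_cst a x 1) pd_sqnorm add0r in pV.
pose N0 (y : 'cV[R]_2) := sgn b * (1 - sqnorm y).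
pose N1 (y : 'cV[R]_2) := 2 * y 0 0.
pose N2 (y : 'cV[R]_2) := sgn b * (2 * y 1 0).
have d0 : derivable N0 x (delta_mx a 0) by exact: (derivableM (dc _) (derivableB (dc 1) dq)).
have d1' : derivable N1 x (delta_mx a 0) by exact: (derivableM (dc _) (dx 0)).
have d2' : derivable (fun y : 'cV[R]_2 => 2 * y 1 0) x (delta_mx a 0).
  exact: (derivableM (dc _) (dx 1)).
have d2 : derivable N2 x (delta_mx a 0) by exact: (derivableM (dc _) d2').
have p0 : pd a N0 x = - (2 * sgn b * x a 0).
  by rewrite (pdM (dc _) (derivableB (dc 1) dq)) (pdB (dc 1) dq) !pd_cst pd_sqnorm; ring.
have p1 : pd a N1 x = 2 * (a == 0)%:R.
  by rewrite (pdM (dc _) (dx 0)) pd_cst pd_coordE; ring.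
have p2 : pd a N2 x = 2 * sgn b * (a == 1)%:R.
  by rewrite (pdM (dc _) d2') (pdM (dc _) (dx 1)) !pd_cst pd_coordE; ring.
have key N dN : derivable N x (delta_mx a 0) -> pd a N x = dN ->
    pd a (fun y => N y * (1 + sqnorm y)^-1) x =
    (dN * (1 + sqnorm x) - 2 * x a 0 * N x) / (1 + sqnorm x) ^+ 2.
  move=> dvN <-; rewrite (pdM dvN dV) pV; move: (pd a N x) (sqnorm x) h => p q h.
  by field.
case: k => -[|[|[|//]]] hk; [exact: key p0|exact: key p1|exact: key p2].
Qed.

(** A direction t with t_1 = iota t_0 is t_0 (d_x + iota d_y), a multiple of d / d(conj y); f
    carries the real coefficients into the field that contains iota. *)
Lemma stereo_kernel (F : fieldType) (f : {rmorphism R -> F}) (iota : F) d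
    (I J K : 'M[F]_d) (p : 'cV[F]_d) (t : 'cV[F]_2) b y :
  iota * iota = -1 -> quaternionic I J K ->
  \sum_k f (stereo b k y) *: (pick3 I J K k *m p) = - iota *: p ->
  t 1 0 = iota * t 0 0 ->
  \sum_a t a 0 *: \sum_k f (pd a (stereo b k) y) *: (pick3 I J K k *m p) = 0.
Proof.
move=> i2 Q hp ht.
rewrite sum_I2 ht mulrC -scalerA -scalerDr scaler_sumr -big_split /=.
rewrite [X in t 0 0 *: X](_ : _ = 0) ?scaler0 //.
rewrite sum_pick3 /stereo in hp; rewrite sum_pick3 !scalerA -!scalerDl.
have fq : f (1 + sqnorm y) = 1 + (f (y 0 0) * f (y 0 0) + f (y 1 0) * f (y 1 0)).
  by rewrite !rmorphD !rmorphM rmorph1.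
have fq' : f (1 - sqnorm y) = 1 - (f (y 0 0) * f (y 0 0) + f (y 1 0) * f (y 1 0)).
  by rewrite rmorphB !rmorphD !rmorphM rmorph1.
have h : 1 + (f (y 0 0) * f (y 0 0) + f (y 1 0) * f (y 1 0)) != 0.
  by rewrite -fq fmorph_eq0 sqnorm1_neq0.
have s2 : f (sgn b) * f (sgn b) = 1.
  by rewrite -rmorphM /sgn; case: b {hp} => /=; rewrite ?mulrNN mulr1 rmorph1.
have tw := @twistor_kernel _ _ I J K Q iota (f (sgn b)) (f (y 0 0)) (f (y 1 0)) p i2 s2 h.
rewrite -[RHS]tw.
  rewrite !pd_stereo /pick3 /=.
  rewrite !(fmorph_div, rmorphXn, fq) !rmorphB !rmorphM !rmorphN !rmorphM !fq !fq' !rmorph_nat.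
  move: (f (sgn b)) (f (y 0 0)) (f (y 1 0)) h => s u v h.
  by congr (_ *: _ + _ *: _ + _ *: _); field.
rewrite -hp /pick3 !(fmorph_div, fq) !rmorphM !fq' !rmorph_nat.
by congr (_ *: _ + _ *: _ + _ *: _).
Qed.

End Sphere.

(** * Products of endomorphisms of the generalized tangent bundle *)

Section GeneralizedProduct.
Variable F : fieldType.
Variables d e : nat.
Implicit Types (S : 'M[F]_(d + d)) (T : 'M[F]_(e + e)) (w : 'cV[F]_((d + e) + (d + e))).

(* gen_prod over an arbitrary field, so that it can be complexified. *)
Definition gprod S T : 'M[F]_((d + e) + (d + e)) :=
  block_mx (block_mx (ulsubmx S) 0 0 (ulsubmx T))
           (block_mx (ursubmx S) 0 0 (ursubmx T))
           (block_mx (dlsubmx S) 0 0 (dlsubmx T))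
           (block_mx (drsubmx S) 0 0 (drsubmx T)).

(** With [gfst] and [gsnd], the isomorphism of E_M + E_N with E_(M x N) in the block order of
    [gprod]. *)
Definition gpair (u : 'cV[F]_(d + d)) (v : 'cV[F]_(e + e)) : 'cV[F]_((d + e) + (d + e)) :=
  col_mx (col_mx (usubmx u) (usubmx v)) (col_mx (dsubmx u) (dsubmx v)).
Definition gfst w : 'cV[F]_(d + d) := col_mx (usubmx (usubmx w)) (usubmx (dsubmx w)).
Definition gsnd w : 'cV[F]_(e + e) := col_mx (dsubmx (usubmx w)) (dsubmx (dsubmx w)).

Lemma gpairK w : gpair (gfst w) (gsnd w) = w.
Proof. by rewrite /gpair /gfst /gsnd !(col_mxKu, col_mxKd) !vsubmxK. Qed.

Lemma gfstK u v : gfst (gpair u v) = u.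
Proof. by rewrite /gpair /gfst !(col_mxKu, col_mxKd) vsubmxK. Qed.

Lemma gsndK u v : gsnd (gpair u v) = v.
Proof. by rewrite /gpair /gsnd !(col_mxKu, col_mxKd) vsubmxK. Qed.

Lemma gpairD u u' v v' : gpair (u + u') (v + v') = gpair u v + gpair u' v'.
Proof. by rewrite /gpair !linearD !add_col_mx. Qed.

Lemma gpairZ c u v : gpair (c *: u) (c *: v) = c *: gpair u v.
Proof. by rewrite /gpair !linearZ !scale_col_mx. Qed.

Lemma gpair0 : gpair 0 0 = 0.
Proof. by rewrite -(scale0r 0) -[X in gpair _ X](scale0r 0) gpairZ !scale0r. Qed.

Lemma gprodM S S' T T' : gprod S T *m gprod S' T' = gprod (S *m S') (T *m T').
Proof.
have bm p q (A A' : 'M[F]_p) (B B' : 'M[F]_q) :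
    block_mx A 0 0 B *m block_mx A' 0 0 B' = block_mx (A *m A') 0 0 (B *m B').
  by rewrite mulmx_block !(mulmx0, mul0mx, addr0, add0r).
rewrite /gprod mulmx_block !bm !add_block_mx !addr0.
rewrite -[S in RHS]submxK -[S' in RHS]submxK -[T in RHS]submxK -[T' in RHS]submxK !mulmx_block.
by rewrite !(block_mxKul, block_mxKur, block_mxKdl, block_mxKdr).
Qed.

Lemma gprod_mulv S T w : gprod S T *m w = gpair (S *m gfst w) (T *m gsnd w).
Proof.
have bm p q (A : 'M[F]_p) (B : 'M[F]_q) (u : 'cV_(p + q)) :
    block_mx A 0 0 B *m u = col_mx (A *m usubmx u) (B *m dsubmx u).
  by rewrite -{1}[u]vsubmxK mul_block_col !mul0mx addr0 add0r.
rewrite -{1}[w]vsubmxK /gprod mul_block_col !bm !add_col_mx.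
rewrite -[S in RHS]submxK -[T in RHS]submxK /gfst /gsnd !mul_block_col /gpair.
by rewrite !(col_mxKu, col_mxKd).
Qed.

Lemma gprod_block A B C D A' B' C' D' :
  gprod (block_mx A B C D) (block_mx A' B' C' D') =
  block_mx (block_mx A 0 0 A') (block_mx B 0 0 B') (block_mx C 0 0 C') (block_mx D 0 0 D').
Proof. by rewrite /gprod !(block_mxKul, block_mxKur, block_mxKdl, block_mxKdr). Qed.

Lemma gprodD S S' T T' : gprod (S + S') (T + T') = gprod S T + gprod S' T'.
Proof.
rewrite -[S]submxK -[S']submxK -[T]submxK -[T']submxK ![gprod (block_mx _ _ _ _) _]gprod_block.
by rewrite !add_block_mx gprod_block !addr0.
Qed.

Lemma gprodN S T : gprod (- S) (- T) = - gprod S T.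
Proof.
rewrite -[S]submxK -[T]submxK [in RHS]gprod_block.
by rewrite !opp_block_mx gprod_block !oppr0.
Qed.

Lemma gprod1 : gprod 1%:M 1%:M = 1%:M.
Proof.
rewrite (scalar_mx_block d d) (scalar_mx_block e e) gprod_block.
by rewrite !block_mx0 -!scalar_mx_block.
Qed.

Lemma gprod0 : gprod 0 0 = 0.
Proof. by rewrite -!block_mx0 gprod_block !block_mx0. Qed.

Lemma gprodDl S S' : gprod (S + S') 0 = gprod S 0 + gprod S' 0.
Proof. by rewrite -[X in gprod _ X](addr0 0) gprodD. Qed.

Lemma gprodBl S S' : gprod (S - S') 0 = gprod S 0 - gprod S' 0.
Proof. by rewrite gprodDl -[X in _ + gprod _ X]oppr0 gprodN. Qed.

Lemma gprod_tr S T : (gprod S T)^T = gprod S^T T^T.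
Proof.
by rewrite -[S]submxK -[T]submxK gprod_block !tr_block_mx gprod_block !trmx0.
Qed.

Lemma gprod_swap : gprod (swap_mx F d) (swap_mx F e) = swap_mx F (d + e).
Proof.
rewrite /swap_mx gprod_block.
by rewrite !block_mx0 -!scalar_mx_block.
Qed.

Lemma gprod_eigen c S T w : gprod S T *m w = c *: w ->
  S *m gfst w = c *: gfst w /\ T *m gsnd w = c *: gsnd w.
Proof.
rewrite gprod_mulv -{3}(gpairK w) -gpairZ => h.
by split; [have := congr1 gfst h; rewrite !gfstK|have := congr1 gsnd h; rewrite !gsndK].
Qed.
End GeneralizedProduct.

Lemma map_gprod (F G : fieldType) (f : {rmorphism F -> G}) d e
    (S : 'M[F]_(d + d)) (T : 'M[F]_(e + e)) :
  map_mx f (gprod S T) = gprod (map_mx f S) (map_mx f T).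
Proof.
by rewrite -[S]submxK -[T]submxK gprod_block !map_block_mx gprod_block !map_mx0.
Qed.

(** * Pairing, Jacobians and derivatives for product endomorphisms *)

Section Fields.
Variable R : realType.

Lemma pairingE d (u v : 'cV[R]_(d + d)) : pairing u v = 2^-1 * swap_form u v.
Proof.
rewrite /pairing swap_formE; congr (_ * _); rewrite !mxE -big_split; apply: eq_bigr => a _.
by rewrite !mxE addrC [X in _ + X]mulrC.
Qed.

Lemma orthogonalE d (J : 'M[R]_(d + d)) : J *m J = - 1%:M ->
  J^T *m swap_mx R d = - (swap_mx R d *m J) ->
  forall u v, pairing (J *m u) (J *m v) = pairing u v.
Proof.
move=> J2 JQ u v; rewrite !pairingE /swap_form trmx_mul -(mulmxA u^T) JQ.
by rewrite mulmxN mulNmx !mulmxA -(mulmxA _ J J) J2 mulmxN mulmx1 mulNmx opprK.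
Qed.

(** Both factors must be invertible: [invmx] returns a singular matrix unchanged, so it would not
    act blockwise. *)
Lemma gen_jac_prod (M N : topologicalType) d e (A : atlas R M d) (B : atlas R N e)
    (i j : idx (prod_atlas A B)) p :
  jac i.1 j.1 p.1 \in unitmx -> jac i.2 j.2 p.2 \in unitmx ->
  gen_jac i j p = gprod (gen_jac i.1 j.1 p.1) (gen_jac i.2 j.2 p.2).
Proof.
move=> u1 u2; rewrite /gen_jac jac_prod gprod_block block_mx0; congr block_mx.
have -> : invmx (block_mx (jac i.1 j.1 p.1) 0 0 (jac i.2 j.2 p.2)) =
    block_mx (invmx (jac i.1 j.1 p.1)) 0 0 (invmx (jac i.2 j.2 p.2)).
  have h : block_mx (jac i.1 j.1 p.1) 0 0 (jac i.2 j.2 p.2) *m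
      block_mx (invmx (jac i.1 j.1 p.1)) 0 0 (invmx (jac i.2 j.2 p.2)) = 1%:M.
    by rewrite mulmx_block !(mulmx0, mul0mx, addr0, add0r) !mulmxV // -scalar_mx_block.
  have [u _] := mulmx1_unit h.
  by rewrite -[LHS]mulmx1 -h mulKmx.
by rewrite tr_block_mx !trmx0.
Qed.

Lemma jac_prod_unit (M N : topologicalType) d e (A : atlas R M d) (B : atlas R N e)
    (i j : idx (prod_atlas A B)) p :
  jac i.1 j.1 p.1 \in unitmx -> jac i.2 j.2 p.2 \in unitmx -> jac i j p \in unitmx.
Proof. by move=> u1 u2; rewrite jac_prod unitmxE det_ublock unitrM -!unitmxE u1. Qed.

Lemma pd_mx_block D (a : 'I_D) x p1 p2 q1 q2
    (S1 : 'cV[R]_D -> 'M[R]_(p1, q1)) (S2 : 'cV[R]_D -> 'M[R]_(p1, q2))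
    (S3 : 'cV[R]_D -> 'M[R]_(p2, q1)) (S4 : 'cV[R]_D -> 'M[R]_(p2, q2)) :
  pd_mx a (fun y => block_mx (S1 y) (S2 y) (S3 y) (S4 y)) x =
  block_mx (pd_mx a S1 x) (pd_mx a S2 x) (pd_mx a S3 x) (pd_mx a S4 x).
Proof.
apply/matrixP => i j; rewrite pd_mxE.
case: (split_ordP i) => k ->; case: (split_ordP j) => l ->.
- by rewrite block_mxEul pd_mxE; congr (pd a _ x); apply/funext => y; rewrite block_mxEul.
- by rewrite block_mxEur pd_mxE; congr (pd a _ x); apply/funext => y; rewrite block_mxEur.
- by rewrite block_mxEdl pd_mxE; congr (pd a _ x); apply/funext => y; rewrite block_mxEdl.
- by rewrite block_mxEdr pd_mxE; congr (pd a _ x); apply/funext => y; rewrite block_mxEdr.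
Qed.

(** Covers the extraction of blocks, which only re-indexes entries. *)
Lemma pd_mx_select D (a : 'I_D) x p q p' q' (f : 'I_p' -> 'I_p) (h : 'I_q' -> 'I_q)
    (op : 'M[R]_(p, q) -> 'M[R]_(p', q')) (S : 'cV[R]_D -> 'M[R]_(p, q)) :
  (forall B i j, op B i j = B (f i) (h j)) ->
  pd_mx a (fun y => op (S y)) x = op (pd_mx a S x).
Proof.
move=> opE; apply/matrixP => i j; rewrite pd_mxE opE pd_mxE; congr (pd a _ x).
by apply/funext => y; rewrite opE.
Qed.

Lemma smooth_select D (U : set 'cV[R]_D) p q p' q' (f : 'I_p' -> 'I_p) (h : 'I_q' -> 'I_q)
    (op : 'M[R]_(p, q) -> 'M[R]_(p', q')) (S : 'cV[R]_D -> 'M[R]_(p, q)) : open U ->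
  (forall B i j, op B i j = B (f i) (h j)) ->
  smooth_on U S -> smooth_on U (fun y => op (S y)).
Proof.
by move=> oU opE sS k i j; apply: (eq_Ck oU _ (sS k (f i) (h j))) => y _; rewrite opE.
Qed.

Lemma pd_mx_gprod D (a : 'I_D) x d e (S : 'cV[R]_D -> 'M[R]_(d + d))
    (T : 'cV[R]_D -> 'M[R]_(e + e)) :
  pd_mx a (fun y => gprod (S y) (T y)) x = gprod (pd_mx a S x) (pd_mx a T x).
Proof.
rewrite /gprod !pd_mx_block !pd_mx_cst.
congr (block_mx (block_mx _ _ _ _) (block_mx _ _ _ _) (block_mx _ _ _ _) (block_mx _ _ _ _)).
all: by apply: pd_mx_select => B i j; rewrite !mxE.
Qed.

Lemma smooth_gprod D (U : set 'cV[R]_D) d e (S : 'cV[R]_D -> 'M[R]_(d + d))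
    (T : 'cV[R]_D -> 'M[R]_(e + e)) : open U ->
  smooth_on U S -> smooth_on U T -> smooth_on U (fun y => gprod (S y) (T y)).
Proof.
move=> oU sS sT.
do ![apply: smooth_block => //]; try exact: smooth_cst.
all: by apply: smooth_select => // B i j; rewrite !mxE.
Qed.
End Fields.

(** * Smoothness and parallelism of bihermitian fields *)

Section BihermitianFields.
Variable R : realType.

Lemma smooth_sum d (U : set 'cV[R]_d) p q n (F : 'I_n -> 'cV[R]_d -> 'M[R]_(p, q)) :
  open U -> (forall k, smooth_on U (F k)) -> smooth_on U (fun y => \sum_k F k y).
Proof.
move=> oU sF k i j.
have s : Ck k U (fun y => \sum_l F l y i j) by apply: Ck_sum => // l _; exact: sF.
by apply: (eq_Ck oU _ s) => y _; rewrite summxE.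
Qed.

Section Derivatives.
Variables (d : nat) (a : 'I_d) (x : 'cV[R]_d).

Lemma pd_mxZ p q (c : 'cV[R]_d -> R) (F : 'cV[R]_d -> 'M[R]_(p, q)) :
  derivable c x (delta_mx a 0) -> derivable_entries a x F ->
  pd_mx a (fun y => c y *: F y) x = pd a c x *: F x + c x *: pd_mx a F x.
Proof.
move=> dc dF; apply/matrixP => i j.
rewrite pd_mxE [RHS]mxE [X in X + _]mxE [X in _ + X]mxE pd_mxE -(pdM dc (dF i j)).
by congr (pd a _ x); apply/funext => y; rewrite mxE.
Qed.

Lemma pd_mx_sum p q n (F : 'I_n -> 'cV[R]_d -> 'M[R]_(p, q)) :
  (forall k, derivable_entries a x (F k)) ->
  pd_mx a (fun y => \sum_k F k y) x = \sum_k pd_mx a (F k) x.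
Proof.
move=> dF; apply/matrixP => i j; rewrite pd_mxE summxE.
rewrite (_ : (fun y => _) = (fun y => \sum_k F k y i j)); last first.
  by apply/funext => y; rewrite summxE.
rewrite (pd_sum (fun k => dF k i j)); apply: eq_bigr => k _; exact/esym/pd_mxE.
Qed.

Lemma pd_mx_lincomb p q n (c : 'I_n -> 'cV[R]_d -> R)
    (F : 'I_n -> 'cV[R]_d -> 'M[R]_(p, q)) (U : set 'cV[R]_d) :
  open U -> U x -> (forall k m, Ck m U (c k)) -> (forall k, smooth_on U (F k)) ->
  pd_mx a (fun y => \sum_k c k y *: F k y) x =
  \sum_k (pd a (c k) x *: F k x + c k x *: pd_mx a (F k) x).
Proof.
move=> oU Ux sc sF.
have dc k : derivable (c k) x (delta_mx a 0) by have [_ + _] := sc k 1%N; apply.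
have dF k : derivable_entries a x (F k) by exact: smooth_derivable Ux (sF k).
have dS k : derivable_entries a x (fun y => c k y *: F k y).
  by apply: smooth_derivable Ux _; apply: smooth_scale => //; exact: sc.
rewrite (pd_mx_sum dS); apply: eq_bigr => k _; exact: pd_mxZ (dc k) (dF k).
Qed.
End Derivatives.

Section Parallel.
Variables (d : nat) (U : set 'cV[R]_d) (g A : 'cV[R]_d -> 'M[R]_d).
Hypothesis oU : open U.
Hypothesis sg : smooth_on U g.
Hypothesis sA : smooth_on U A.
Hypothesis g_unit : forall y, U y -> g y \in unitmx.
Variable eps : R.
Hypothesis eps2 : eps ^+ 2 = 1.

Let V y := invmx (g y).
Let sV : smooth_on U V. Proof. exact: smooth_invmx. Qed.

Let bih_fun : (fun y => bihermitian eps (g y) (A y)) =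
  (fun y => 2^-1 *: block_mx (- A y) (eps *: (A y *m V y)) (eps *: (g y *m A y))
                             (- (g y *m A y *m V y))).
Proof. by apply/funext => y; rewrite bihermitianE. Qed.

Lemma smooth_bihermitian : smooth_on U (fun y => bihermitian eps (g y) (A y)).
Proof.
rewrite bih_fun; apply: smooth_scale => //; first by move=> k; exact: Ck_cst.
have sc := fun k => Ck_cst oU k eps.
apply: smooth_block => //.
- exact: smooth_opp.
- by apply: smooth_scale => //; exact: smooth_mul.
- by apply: smooth_scale => //; exact: smooth_mul.
- by apply: smooth_opp => //; apply: smooth_mul => //; exact: smooth_mul.
Qed.

Variables (x : 'cV[R]_d) (a : 'I_d) (Gam : 'M[R]_d).
Hypothesis Ux : U x.
Hypothesis g_par : pd_mx a g x = Gam^T *m g x + g x *m Gam.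
Hypothesis A_par : pd_mx a A x + Gam *m A x - A x *m Gam = 0.

Let D p q (F : 'cV[R]_d -> 'M[R]_(p, q)) (sF : smooth_on U F) : derivable_entries a x F :=
  smooth_derivable Ux sF.

Let V_par : pd_mx a V x = - (V x *m Gam^T + Gam *m V x).
Proof.
have u := g_unit Ux.
(* The derivative of the inverse metric is read off from that of g g^-1 = 1. *)
have h : pd_mx a (fun y => g y *m V y) x = 0.
  rewrite (pd_mx_eq_on (G := fun=> 1%:M) a oU Ux) ?pd_mx_cst // => y Uy.
  by rewrite mulmxV // g_unit.
rewrite (pd_mxM (D sg) (D sV)) g_par in h.
have -> : pd_mx a V x = V x *m (g x *m pd_mx a V x) by rewrite mulKmx.
have -> : g x *m pd_mx a V x = - ((Gam^T *m g x + g x *m Gam) *m V x).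
  by apply/eqP; rewrite -addr_eq0 addrC h.
rewrite mulmxN mulmxDl mulmxDr !mulmxA mulmxK //; congr (- (_ + _)).
by rewrite mulVmx // mul1mx.
Qed.

Let A_par' : pd_mx a A x = A x *m Gam - Gam *m A x.
Proof. by apply/eqP; rewrite -subr_eq0 opprB addrA A_par. Qed.

Lemma bihermitian_parallel :
  pd_mx a (fun y => bihermitian eps (g y) (A y)) x
  + block_mx Gam 0 0 (- Gam^T) *m bihermitian eps (g x) (A x)
  - bihermitian eps (g x) (A x) *m block_mx Gam 0 0 (- Gam^T) = 0.
Proof.
rewrite bih_fun bihermitianE // -/(V x).
have sgA : smooth_on U (fun y => g y *m A y) by exact: smooth_mul.
have sAV : smooth_on U (fun y => A y *m V y) by exact: smooth_mul.
have sgAV : smooth_on U (fun y => g y *m A y *m V y) by exact: smooth_mul.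
have dcst c : derivable (fun=> c : R) x (delta_mx a 0) by exact: derivable_cst.
have dZ p q c (F : 'cV[R]_d -> 'M[R]_(p, q)) : smooth_on U F ->
    pd_mx a (fun y => c *: F y) x = c *: pd_mx a F x.
  by move=> sF; rewrite (pd_mxZ (dcst c) (D sF)) (pd_cst a x c) scale0r add0r.
rewrite dZ; last first.
  have sc := fun k => Ck_cst oU k eps.
  apply: smooth_block => //.
  - exact: smooth_opp.
  - by apply: smooth_scale => //; exact: smooth_mul.
  - by apply: smooth_scale => //; exact: smooth_mul.
  - by apply: smooth_opp => //; apply: smooth_mul => //; exact: smooth_mul.
rewrite pd_mx_block (pd_mxN (D sA)) (dZ _ _ eps _ sAV) (dZ _ _ eps _ sgA) (pd_mxN (D sgAV)).
rewrite (pd_mxM (D sgA) (D sV)) (pd_mxM (D sg) (D sA)) (pd_mxM (D sA) (D sV)).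
rewrite g_par A_par' V_par -scalemxAr -scalemxAl -scalerDr -scalerBr.
have u := g_unit Ux.
rewrite !mulmx_block !(mulmx0, mul0mx, addr0, add0r) opp_block_mx !add_block_mx.
apply/eqP; rewrite scalemx_eq0; apply/orP; right; rewrite -block_mx0; apply/eqP.
congr block_mx; rewrite !(mulmxN, mulNmx, mulmxDl, mulmxDr, mulmxBl, mulmxBr) ?opprK
  -?scalemxAl -?scalemxAr ?mulmxA.
- by mx_ring.
- by mx_ring.
- by mx_ring.
- by mx_ring.
Qed.
End Parallel.
End BihermitianFields.

(** * Pointwise algebra of I_alpha and of J_(alpha, beta) *)

Section Pointwise.
Variables (R : realType) (d : nat).
Implicit Types (g I J K : 'M[R]_d) (alpha beta : CP1 R).

Lemma CP1_stereo alpha : exists (b : idx (CP1_atlas R)) y, alpha = psi b y.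
Proof.
have [b pb] := CP1_cover alpha; exists b, (phi b alpha).
by rewrite CP1_phiK.
Qed.

Lemma I_at_sq I J K alpha : quaternionic I J K ->
  I_at I J K alpha *m I_at I J K alpha = - 1%:M.
Proof.
move=> Q; have [b [y ->]] := CP1_stereo alpha.
by rewrite I_at_stereo; apply: quaternion_sq => //; exact: stereo_sq.
Qed.

(** Skewness for g and compatibility with a Jacobian are linear relations, so they pass from I, J, K
    to I_alpha. *)
Lemma I_at_linear (P : 'M[R]_d -> 'M[R]_d -> Prop) I J K I' J' K' alpha :
  (forall c B B' D D', P B B' -> P D D' -> P (c *: B + D) (c *: B' + D')) -> P 0 0 ->
  P I I' -> P J J' -> P K K' -> P (I_at I J K alpha) (I_at I' J' K' alpha).
Proof.
move=> lin P0 PI PJ PK; have [b [y ->]] := CP1_stereo alpha.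
rewrite !I_at_stereo !sum_pick3 -[X in P X]addr0 -[X in P _ X]addr0 -!addrA.
by apply: (lin) => //; apply: (lin) => //; apply: (lin).
Qed.

Lemma I_at_skew g I J K alpha : I^T *m g = - (g *m I) -> J^T *m g = - (g *m J) ->
  K^T *m g = - (g *m K) -> (I_at I J K alpha)^T *m g = - (g *m I_at I J K alpha).
Proof.
apply: (@I_at_linear (fun B D => B^T *m g = - (g *m D))); last by rewrite trmx0 mul0mx mulmx0 oppr0.
move=> c B B' D D' hB hD; rewrite linearD linearZ /= mulmxDl -scalemxAl hB hD.
by rewrite mulmxDr -scalemxAr opprD scalerN.
Qed.

Lemma I_at_conj (j : 'M[R]_d) I J K I' J' K' alpha :
  j *m I = I' *m j -> j *m J = J' *m j -> j *m K = K' *m j ->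
  j *m I_at I J K alpha = I_at I' J' K' alpha *m j.
Proof.
apply: (@I_at_linear (fun B D => j *m B = D *m j)); last by rewrite mul0mx mulmx0.
move=> c B B' D D' hB hD.
by rewrite mulmxDr mulmxDl -scalemxAr -scalemxAl hB hD.
Qed.

Lemma two_neq0 : 2 != 0 :> R. Proof. by rewrite pnatr_eq0. Qed.

(** For A = I_alpha, A^2 = -1 turns the inverse of omega_A = g A into - A g^-1, and skewness turns
    A^T into - g A g^-1; every block becomes linear in A, and likewise for I_beta. *)
Lemma J_alpha_betaE g I J K alpha beta : g \in unitmx -> g^T = g ->
  quaternionic I J K ->
  I^T *m g = - (g *m I) -> J^T *m g = - (g *m J) -> K^T *m g = - (g *m K) ->
  J_alpha_beta g I J K alpha beta =
  bihermitian 1 g (I_at I J K alpha) + bihermitian (-1) g (I_at I J K beta).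
Proof.
move=> u gT Q hI hJ hK; rewrite /J_alpha_beta.
have skew := fun e => I_at_skew e hI hJ hK.
have sq := fun e => I_at_sq e Q.
move: (I_at I J K alpha) (I_at I J K beta) (skew alpha) (skew beta) (sq alpha) (sq beta).
move=> A B hA hB A2 B2.
have kE (C : 'M[R]_d) : kahler_map g C = g *m C.
  by rewrite /kahler_map /kahler_form trmx_mul trmxK gT.
have iE (C : 'M[R]_d) : C *m C = - 1%:M -> invmx (g *m C) = - (C *m invmx g).
  move=> C2; have h : (g *m C) *m - (C *m invmx g) = 1%:M.
    by rewrite mulmxN mulmxA -(mulmxA g) C2 mulmxN mulmx1 mulNmx opprK mulmxV.
  by have [uC _] := mulmx1_unit h; rewrite -[LHS]mulmx1 -h mulKmx.
have tE (C : 'M[R]_d) : C^T *m g = - (g *m C) -> C^T = - (g *m C *m invmx g).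
  by move=> hC; rewrite -mulNmx -hC mulmxK.
rewrite !kE !iE // !bihermitianE ?sqrrN ?expr1n // -scalerDr add_block_mx.
rewrite !scale1r !scaleN1r; congr (_ *: block_mx _ _ _ _).
- exact: opprD.
- by rewrite opprK opprD opprK.
- by rewrite {1}(tE A hA) {1}(tE B hB).
Qed.

End Pointwise.

(** * Algebraic properties of J on X and its change of charts *)

Section XPointwise.
Variables (R : realType) (n : nat) (M : topologicalType).
Variables (A : atlas R M n) (g I J K : tensor A n).
Hypothesis mA : smooth_manifold A.
Hypothesis hk : hyperkahler g I J K.

Lemma hk_quaternionic i m : dom i m -> quaternionic (I i m) (J i m) (K i m).
Proof.
move=> im; have [[h1 h2 h3] [h4 h5 h6]] := hk_quaternion hk im.
split=> //.
- exact: (cs_sq (kahler_complex (hk_I hk))).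
- exact: (cs_sq (kahler_complex (hk_J hk))).
- exact: (cs_sq (kahler_complex (hk_K hk))).
Qed.

Lemma hk_unit i m : dom i m -> g i m \in unitmx.
Proof. by move=> im; apply: posdef_unitmx; apply: (riem_pos (hk_riemannian hk)). Qed.

Lemma hk_skew (T : tensor A n) i m : kahler g T -> dom i m ->
  (T i m)^T *m g i m = - (g i m *m T i m).
Proof.
move=> kT im; have h := kahler_compat kT im.
have -> : g i m *m T i m = (T i m)^T *m g i m *m T i m *m T i m by rewrite h.
by rewrite -[_ *m T i m *m T i m]mulmxA (cs_sq (kahler_complex kT) im) mulmxN mulmx1 opprK.
Qed.

Definition J_M (i : idx A) m alpha beta : 'M[R]_(n + n) :=
  bihermitian 1 (g i m) (I_at (I i m) (J i m) (K i m) alpha)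
  + bihermitian (-1) (g i m) (I_at (I i m) (J i m) (K i m) beta).
Definition J_S : 'M[R]_(2 + 2) := J_of_complex (rot90 R).

Lemma J_XE (i : idx (X_atlas A)) p : dom i p ->
  J_X g I J K i p = gprod (gprod (J_M i.1.1 p.1.1 p.1.2 p.2) J_S) J_S.
Proof.
move: i p => [[i0 i1] i2] [[m alpha] beta] [[/= im _] _].
rewrite /J_M -J_alpha_betaE //.
- exact: hk_unit.
- exact: riem_sym (hk_riemannian hk) _ _ im.
- exact: hk_quaternionic.
- exact: hk_skew (hk_I hk) im.
- exact: hk_skew (hk_J hk) im.
- exact: hk_skew (hk_K hk) im.
Qed.

Lemma J_M_sq i m alpha beta : dom i m ->
  J_M i m alpha beta *m J_M i m alpha beta = - 1%:M.
Proof.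
move=> im; apply: bihermitian_sq; first exact: two_neq0.
- exact: hk_unit.
- by apply: I_at_sq; exact: hk_quaternionic.
- by apply: I_at_sq; exact: hk_quaternionic.
Qed.

Lemma J_M_skew i m alpha beta : dom i m ->
  (J_M i m alpha beta)^T *m swap_mx R n = - (swap_mx R n *m J_M i m alpha beta).
Proof.
move=> im; have gT := riem_sym (hk_riemannian hk) im.
have sk e := I_at_skew e (hk_skew (hk_I hk) im) (hk_skew (hk_J hk) im) (hk_skew (hk_K hk) im).
rewrite /J_M linearD mulmxDl mulmxDr opprD.
by congr (_ + _); apply: bihermitian_skew => //; rewrite ?sqrrN ?expr1n //; exact: hk_unit.
Qed.

Lemma J_S_sq : J_S *m J_S = - 1%:M.
Proof.
rewrite /J_S /J_of_complex mulmx_block !(mulmx0, mul0mx, addr0, add0r) mulNmx mulmxN opprK.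
by rewrite -trmx_mul rot90_sq linearN /= trmx1 (scalar_mx_block 2 2) opp_block_mx !oppr0.
Qed.

Lemma J_S_skew : J_S^T *m swap_mx R 2 = - (swap_mx R 2 *m J_S).
Proof.
rewrite /J_S /J_of_complex /swap_mx tr_block_mx !mulmx_block opp_block_mx.
rewrite !(mulmx0, mul0mx, mulmx1, mul1mx, addr0, add0r, trmx0, oppr0) trmxK linearN /=.
by rewrite opprK.
Qed.

(** The Jacobian is a factor of the invertible matrix g, by the transformation law of the metric; no
    inverse transition map has to be differentiated. *)
Lemma jac_unit (i j : idx A) m : dom i m -> dom j m -> jac i j m \in unitmx.
Proof.
move=> im jm; have := hk_unit im; rewrite (riem_tensor (hk_riemannian hk) im jm).
by rewrite unitmx_mul => /andP[].
Qed.

Lemma gen_jac_J_S (i j : idx (CP1_atlas R)) p : dom i p -> dom j p ->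
  gen_jac i j p *m J_S = J_S *m gen_jac i j p.
Proof.
move=> ip jp; have u := CP1_jac_unit ip jp; have c := CP1_jac_rot90 ip jp.
rewrite /gen_jac /J_S /J_of_complex !mulmx_block !(mulmx0, mul0mx, addr0, add0r).
rewrite mulmxN mulNmx c -!trmx_mul; congr (block_mx _ _ _ _^T).
apply: (can_inj (mulKmx u)).
by rewrite !mulmxA c mulmxK // mulmxV // mul1mx.
Qed.

Lemma gen_jac_J_M (i j : idx A) m alpha beta : dom i m -> dom j m ->
  gen_jac i j m *m J_M i m alpha beta = J_M j m alpha beta *m gen_jac i j m.
Proof.
move=> im jm; have u := jac_unit im jm.
have cj e : jac i j m *m I_at (I i m) (J i m) (K i m) e =
    I_at (I j m) (J j m) (K j m) e *m jac i j m.
  apply: I_at_conj.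
  - exact: (cs_tensor (kahler_complex (hk_I hk)) im jm).
  - exact: (cs_tensor (kahler_complex (hk_J hk)) im jm).
  - exact: (cs_tensor (kahler_complex (hk_K hk)) im jm).
rewrite /J_M mulmxDl mulmxDr; congr (_ + _); apply: bihermitian_transport => //.
all: rewrite ?sqrrN ?expr1n //; try exact: hk_unit.
all: exact: (riem_tensor (hk_riemannian hk) im jm).
Qed.

Lemma X_manifold : smooth_manifold (X_atlas A).
Proof. exact: (prod_manifold (prod_manifold mA (CP1_manifold R)) (CP1_manifold R)). Qed.

Lemma J_X_sq i p : dom i p -> J_X g I J K i p *m J_X g I J K i p = - 1%:M.
Proof.
move=> ip; rewrite J_XE // !gprodM J_M_sq ?J_S_sq; last by case: ip => -[].
by rewrite !(gprodN, gprod1).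
Qed.

Lemma J_X_skew i p : dom i p -> (J_X g I J K i p)^T *m swap_mx R (n + 2 + 2) =
  - (swap_mx R (n + 2 + 2) *m J_X g I J K i p).
Proof.
move=> ip; rewrite J_XE // -!gprod_swap !gprod_tr !gprodM.
by rewrite J_M_skew ?J_S_skew ?gprodN //; case: ip => -[].
Qed.

Lemma J_X_tensor : gen_endo_tensor (J_X g I J K).
Proof.
move=> i j p ip jp; rewrite !J_XE //.
case: ip => -[im i1 i2]; case: jp => -[jm j1 j2].
rewrite !gen_jac_prod; last first.
all: try exact: CP1_jac_unit; try exact: jac_unit.
  by apply: jac_prod_unit; [exact: jac_unit|exact: CP1_jac_unit].
rewrite !gprodM.
exact: (congr2 (@gprod R _ _) (congr2 (@gprod R _ _)
  (gen_jac_J_M _ _ im jm) (gen_jac_J_S i1 j1)) (gen_jac_J_S i2 j2)).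
Qed.

End XPointwise.

(** [J_of_complex] acts on vectors by - I, so the tangent part of a +i-eigenvector is of type
    (0,1). *)
Lemma J_S_eigen (R : realType) (F : fieldType) (f : {rmorphism R -> F}) iota
    (v : 'cV[F]_(2 + 2)) : map_mx f (J_S R) *m v = iota *: v ->
  v (lshift 2 1) 0 = iota * v (lshift 2 0) 0.
Proof.
move=> /colP /(_ (lshift 2 0)); rewrite [RHS]mxE => <-.
rewrite /J_S /J_of_complex map_block_mx !map_mx0 -{2}[v]vsubmxK mul_block_col.
rewrite mul0mx addr0 col_mxEu mxE sum_I2 map_mxN.
have -> : (- map_mx f (rot90 R)) 0 0 = 0 by rewrite !mxE /= subrr rmorph0 oppr0.
have -> : (- map_mx f (rot90 R)) 0 1 = 1 by rewrite !mxE /= sub0r rmorphN1 opprK.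
by rewrite mul0r add0r mul1r mxE.
Qed.

Lemma map_quaternionic (F G : fieldType) (f : {rmorphism F -> G}) d (I J K : 'M[F]_d) :
  quaternionic I J K -> quaternionic (map_mx f I) (map_mx f J) (map_mx f K).
Proof.
case=> II JJ KK IJ JI JK KJ KI IK.
by split; rewrite -map_mxM ?II ?JJ ?KK ?IJ ?JI ?JK ?KJ ?KI ?IK ?map_mxN ?map_mx1.
Qed.

(** * Integrability *)

Section ProductConnection.

Definition ext_connection (F : fieldType) d e (Gam : 'I_d -> 'M[F]_d) (a : 'I_(d + e)) :
    'M[F]_(d + e) :=
  match fintype.split a with inl b => block_mx (Gam b) 0 0 0 | inr _ => 0 end.

Lemma split_lshift d e (a : 'I_d) : fintype.split (lshift e a) = inl a.
Proof. exact: unsplitK (inl a). Qed.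

Lemma split_rshift d e (a : 'I_e) : fintype.split (rshift d a) = inr a.
Proof. exact: unsplitK (inr a). Qed.

Lemma ext_connection_sym (F : fieldType) d e (Gam : 'I_d -> 'M[F]_d) :
  (forall a b k, Gam a k b = Gam b k a) ->
  forall a b k, @ext_connection F d e Gam a k b = @ext_connection F d e Gam b k a.
Proof.
move=> sym a b k; rewrite /ext_connection.
case: (split_ordP a) => a' ->; case: (split_ordP b) => b' ->.
- case: (split_ordP k) => k' ->.
    by rewrite !block_mxEul.
  by rewrite !block_mxEdl !mxE.
- case: (split_ordP k) => k' ->.
    by rewrite block_mxEur !mxE.
  by rewrite block_mxEdr !mxE.
- case: (split_ordP k) => k' ->.
    by rewrite block_mxEur !mxE.
  by rewrite block_mxEdr !mxE.
- by rewrite !mxE.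
Qed.

Lemma gen_connection_l (F : fieldType) d e (Gam : 'I_d -> 'M[F]_d) (a : 'I_d) :
  gen_connection (@ext_connection F d e Gam) (lshift e a) = gprod (gen_connection Gam a) 0.
Proof.
rewrite /gen_connection /ext_connection split_lshift -[X in gprod _ X]block_mx0.
by rewrite gprod_block tr_block_mx opp_block_mx !trmx0 !oppr0 !block_mx0.
Qed.

Lemma gen_connection_r (F : fieldType) d e (Gam : 'I_d -> 'M[F]_d) (a : 'I_e) :
  gen_connection (@ext_connection F d e Gam) (rshift d a) = 0.
Proof.
rewrite /gen_connection /ext_connection split_rshift.
by rewrite trmx0 oppr0 block_mx0.
Qed.

End ProductConnection.

Section Projections.
Variables (R : realType) (d e : nat).
Implicit Types x : 'cV[R]_(d + e).

Lemma pd_usubmx_l (f : 'cV[R]_d -> R) a x :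
  pd (lshift e a) (fun y => f (usubmx y)) x = pd a f (usubmx x).
Proof. by rewrite (pd_comp_proj (@usubmxP R d e) _ f) usubmx_delta_l. Qed.

Lemma pd_usubmx_r (f : 'cV[R]_d -> R) a x :
  pd (rshift d a) (fun y => f (usubmx y)) x = 0.
Proof. by rewrite (pd_comp_proj (@usubmxP R d e) _ f) usubmx_delta_r derive0. Qed.

Lemma pd_dsubmx_l (f : 'cV[R]_e -> R) a x :
  pd (lshift e a) (fun y => f (dsubmx y)) x = 0.
Proof. by rewrite (pd_comp_proj (@dsubmxP R d e) _ f) dsubmx_delta_l derive0. Qed.

Lemma pd_dsubmx_r (f : 'cV[R]_e -> R) a x :
  pd (rshift d a) (fun y => f (dsubmx y)) x = pd a f (dsubmx x).
Proof. by rewrite (pd_comp_proj (@dsubmxP R d e) _ f) dsubmx_delta_r. Qed.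

Lemma pd_mx_usubmx_l p q (F : 'cV[R]_d -> 'M[R]_(p, q)) a x :
  pd_mx (lshift e a) (fun y => F (usubmx y)) x = pd_mx a F (usubmx x).
Proof. by apply/matrixP => i j; rewrite !pd_mxE (pd_usubmx_l (fun y => F y i j)). Qed.

Lemma pd_mx_usubmx_r p q (F : 'cV[R]_d -> 'M[R]_(p, q)) a x :
  pd_mx (rshift d a) (fun y => F (usubmx y)) x = 0.
Proof. by apply/matrixP => i j; rewrite pd_mxE (pd_usubmx_r (fun y => F y i j)) mxE. Qed.

Lemma Ck_usubmx k (U : set 'cV[R]_d) (V : set 'cV[R]_(d + e)) f : open V ->
  (forall x, V x -> U (usubmx x)) -> Ck k U f -> Ck k V (fun y => f (usubmx y)).
Proof.
apply: (Ck_comp_proj (@usubmxP R d e) (@continuous_usubmx R d e)) => a.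
case: (split_ordP a) => b ->; last by left; exact: usubmx_delta_r.
by right; exists b; exact: usubmx_delta_l.
Qed.

Lemma Ck_dsubmx k (U : set 'cV[R]_e) (V : set 'cV[R]_(d + e)) f : open V ->
  (forall x, V x -> U (dsubmx x)) -> Ck k U f -> Ck k V (fun y => f (dsubmx y)).
Proof.
apply: (Ck_comp_proj (@dsubmxP R d e) (@continuous_dsubmx R d e)) => a.
case: (split_ordP a) => b ->; first by left; exact: dsubmx_delta_l.
by right; exists b; exact: dsubmx_delta_r.
Qed.
End Projections.

Lemma map_bihermitian (F G : fieldType) (f : {rmorphism F -> G}) d eps (g A : 'M[F]_d) :
  map_mx f (bihermitian eps g A) = bihermitian (f eps) (map_mx f g) (map_mx f A).
Proof.
rewrite /bihermitian map_mxZ rmorphN fmorphV rmorph_nat !map_mxM.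
rewrite map_col_mx map_row_mx !map_mx1 !map_mxZ map_invmx !rmorphN.
by [].
Qed.

(** * The covariant derivative of J in a chart of X, and involutivity *)

Section Field.
Variables (R : realType) (d : nat) (M : topologicalType).
Variables (A : atlas R M d) (g I J K : tensor A d).
Hypothesis mA : smooth_manifold A.
Hypothesis hk : hyperkahler g I J K.
Variables (i0 : idx A) (b1 b2 : idx (CP1_atlas R)).
Let i : idx (X_atlas A) := (i0, b1, b2).
Let U := codom_chart i0.
Let gx := in_chart g i0.
Let Tx k := in_chart (pick3 I J K k) i0.

(** A point of the chart is ((m, alpha), beta). The fields [E] depend on m only, the coefficients
    [c1] on alpha and [c2] on beta; [Fb] is the M-block of J. *)
Let E eps k (x : 'cV[R]_d) := bihermitian eps (gx x) (Tx k x).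
Let c1 k (y : 'cV[R]_(d + 2 + 2)) := stereo b1 k (dsubmx (usubmx y)).
Let c2 k (y : 'cV[R]_(d + 2 + 2)) := stereo b2 k (dsubmx y).
Let Fb y := \sum_k c1 k y *: E 1 k (usubmx (usubmx y))
          + \sum_k c2 k y *: E (-1) k (usubmx (usubmx y)).
Let W := [set y : 'cV[R]_(d + 2 + 2) | U (usubmx (usubmx y))].

Let oU : open U. Proof. exact: man_open_codom. Qed.

Lemma open_W : open W.
Proof.
apply: (@open_comp _ _ (fun y : 'cV[R]_(d + 2 + 2) => usubmx (usubmx y))) => // y _.
apply: (@continuous_comp _ _ _ usubmx usubmx); exact: continuous_usubmx.
Qed.

Lemma sub_codom_W : codom_chart i `<=` W.
Proof.
move=> y; rewrite (codom_prod (A := prod_atlas A _)) => -[+ _].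
by rewrite codom_prod => -[].
Qed.

Let kT k : kahler g (pick3 I J K k).
Proof. by case: k => -[|[|[|//]]] h; [exact: hk_I hk|exact: hk_J hk|exact: hk_K hk]. Qed.

Let TxE k x : Tx k x = pick3 (in_chart I i0 x) (in_chart J i0 x) (in_chart K i0 x) k.
Proof. by case: k => -[|[|[|//]]]. Qed.

Lemma J_X_field y : W y -> in_chart (J_X g I J K) i y = gprod (gprod (Fb y) (J_S R)) (J_S R).
Proof.
move=> Wy; have py := psi_dom mA Wy.
have dy : dom i (psi i y).
  by split; [split|]; [exact: py|exact: (CP1_psiK _ _).1|exact: (CP1_psiK _ _).1].
have FE : J_M g I J K i0 (psi i0 (usubmx (usubmx y)))
    (psi b1 (dsubmx (usubmx y))) (psi b2 (dsubmx y)) = Fb y.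
  rewrite /J_M !I_at_stereo !bihermitian_sum; congr (_ + _).
    by apply: eq_bigr => k _; rewrite bihermitianZ /E TxE.
  by apply: eq_bigr => k _; rewrite bihermitianZ /E TxE.
by rewrite -FE; exact: (J_XE hk dy).
Qed.

Let sg : smooth_on U gx. Proof. exact: riem_smooth (hk_riemannian hk) i0. Qed.
Let sT k : smooth_on U (Tx k). Proof. exact: cs_smooth (kahler_complex (kT k)) i0. Qed.
Let gu x : U x -> gx x \in unitmx. Proof. by move=> /(psi_dom mA); exact: (hk_unit hk). Qed.

Let sE eps k : eps ^+ 2 = 1 -> smooth_on U (E eps k).
Proof. by move=> e2; exact: (smooth_bihermitian oU sg (sT k) gu e2). Qed.

Let sEW eps k : eps ^+ 2 = 1 -> smooth_on W (fun y => E eps k (usubmx (usubmx y))).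
Proof.
move=> e2; apply: (smooth_comp_usubmx (U := [set z | U (usubmx z)])
  (F := fun z => E eps k (usubmx z)) open_W) => //.
apply: (smooth_comp_usubmx (U := U)) => //; last exact: sE.
by apply: open_comp => // z _; exact: continuous_usubmx.
Qed.

Let sc1 k m : Ck m W (c1 k).
Proof.
apply: (Ck_usubmx (U := setT) (f := fun z => stereo b1 k (dsubmx z)) open_W) => //.
by apply: (Ck_dsubmx (U := setT)) => //; [exact: openT|exact: Ck_stereo].
Qed.

Let sc2 k m : Ck m W (c2 k).
Proof. by apply: (Ck_dsubmx (U := setT)) => //; [exact: open_W|exact: Ck_stereo]. Qed.

Let e1 : (1 : R) ^+ 2 = 1. Proof. exact: expr1n. Qed.
Let e2 : (-1 : R) ^+ 2 = 1. Proof. by rewrite sqrrN expr1n. Qed.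

Lemma smooth_Fb : smooth_on W Fb.
Proof.
have oW := open_W; apply: smooth_add => //; apply: smooth_sum => // k.
all: by apply: smooth_scale => //; exact: sEW.
Qed.

Lemma smooth_J_X : smooth_on (codom_chart i) (in_chart (J_X g I J K) i).
Proof.
apply: (sub_smooth_on sub_codom_W); have oW := open_W.
apply: (eq_smooth_on oW (F := fun y => gprod (gprod (Fb y) (J_S R)) (J_S R))).
  by move=> y Wy; rewrite J_X_field.
by apply: smooth_gprod => //; [apply: smooth_gprod => //; [exact: smooth_Fb|]|]; exact: smooth_cst.
Qed.

Let pm (x : 'cV[R]_(d + 2 + 2)) := usubmx (usubmx x).
Let nabla x := christoffel (gx (pm x)) (fun c => pd_mx c gx (pm x)).

Let E_parallel eps k x a : eps ^+ 2 = 1 -> W x ->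
  pd_mx a (E eps k) (pm x) + gen_connection (nabla x) a *m E eps k (pm x)
  - E eps k (pm x) *m gen_connection (nabla x) a = 0.
Proof.
move=> ee Wx.
have lc := levi_civita_metric mA (hk_riemannian hk) Wx a.
have kc := kahler_covariant mA (hk_riemannian hk) Wx (kT k) a.
exact: (bihermitian_parallel oU sg (sT k) gu ee Wx lc kc).
Qed.

Let pd_Fb a x : W x -> pd_mx a Fb x =
  \sum_k (pd a (c1 k) x *: E 1 k (pm x)
          + c1 k x *: pd_mx a (fun y => E 1 k (pm y)) x)
  + \sum_k (pd a (c2 k) x *: E (-1) k (pm x)
          + c2 k x *: pd_mx a (fun y => E (-1) k (pm y)) x).
Proof.
move=> Wx; have oW := open_W.
have s1 := fun k => sEW k e1; have s2 := fun k => sEW k e2.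
have d1 : derivable_entries a x (fun y => \sum_k c1 k y *: E 1 k (pm y)).
  apply: smooth_derivable Wx _; apply: smooth_sum => // k.
  exact: (smooth_scale oW (sc1 k) (s1 k)).
have d2 : derivable_entries a x (fun y => \sum_k c2 k y *: E (-1) k (pm y)).
  apply: smooth_derivable Wx _; apply: smooth_sum => // k.
  exact: (smooth_scale oW (sc2 k) (s2 k)).
apply: etrans (pd_mxD d1 d2) _.
rewrite (pd_mx_lincomb a oW Wx sc1 s1); congr (_ + _).
exact: (pd_mx_lincomb a oW Wx sc2 s2).
Qed.

Let drop_left p q (s c : R) (u v v' : 'M[R]_(p, q)) :
  s = 0 -> v = v' -> s *: u + c *: v = c *: v'.
Proof. by move=> -> ->; rewrite scale0r add0r. Qed.

Let drop_right p q (s s' c : R) (u v : 'M[R]_(p, q)) :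
  s = s' -> v = 0 -> s *: u + c *: v = s' *: u.
Proof. by move=> -> ->; rewrite scaler0 addr0. Qed.

Let drop_both p q (s c : R) (u v : 'M[R]_(p, q)) :
  s = 0 -> v = 0 -> s *: u + c *: v = 0.
Proof. by move=> -> ->; rewrite scale0r scaler0 addr0. Qed.

(** Coordinates of M move only the fields [E], those of a sphere only its own coefficients, so in
    each direction one kind of term of the Leibniz rule survives. *)
Let pd_Fb_M a x : W x -> pd_mx (lshift 2 (lshift 2 a)) Fb x =
  \sum_k c1 k x *: pd_mx a (E 1 k) (pm x) + \sum_k c2 k x *: pd_mx a (E (-1) k) (pm x).
Proof.
move=> Wx; apply: (etrans (pd_Fb _ Wx)); congr (_ + _); apply: eq_bigr => k _.
  apply: drop_left.
    apply: etrans (pd_usubmx_l (fun z => stereo b1 k (dsubmx z)) _ _) _.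
    exact: (pd_dsubmx_l (stereo b1 k)).
  apply: etrans (pd_mx_usubmx_l (fun z => E 1 k (usubmx z)) _ _) _.
  exact: (pd_mx_usubmx_l (E 1 k)).
apply: drop_left; first exact: (pd_dsubmx_l (stereo b2 k)).
apply: etrans (pd_mx_usubmx_l (fun z => E (-1) k (usubmx z)) _ _) _.
exact: (pd_mx_usubmx_l (E (-1) k)).
Qed.

Let pd_Fb_1 a x : W x -> pd_mx (lshift 2 (rshift d a)) Fb x =
  \sum_k pd a (stereo b1 k) (dsubmx (usubmx x)) *: E 1 k (pm x).
Proof.
move=> Wx; apply: (etrans (pd_Fb _ Wx)); rewrite -[RHS]addr0; congr (_ + _).
  apply: eq_bigr => k _; apply: drop_right.
    apply: etrans (pd_usubmx_l (fun z => stereo b1 k (dsubmx z)) _ _) _.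
    exact: (pd_dsubmx_r (stereo b1 k)).
  apply: etrans (pd_mx_usubmx_l (fun z => E 1 k (usubmx z)) _ _) _.
  exact: (pd_mx_usubmx_r (E 1 k)).
apply: big1 => k _; apply: drop_both; first exact: (pd_dsubmx_l (stereo b2 k)).
apply: etrans (pd_mx_usubmx_l (fun z => E (-1) k (usubmx z)) _ _) _.
exact: (pd_mx_usubmx_r (E (-1) k)).
Qed.

Let pd_Fb_2 a x : W x -> pd_mx (rshift (d + 2) a) Fb x =
  \sum_k pd a (stereo b2 k) (dsubmx x) *: E (-1) k (pm x).
Proof.
move=> Wx; apply: (etrans (pd_Fb _ Wx)); rewrite -[RHS]add0r; congr (_ + _).
  apply: big1 => k _; apply: drop_both.
    exact: (pd_usubmx_r (fun z => stereo b1 k (dsubmx z))).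
  exact: (pd_mx_usubmx_r (fun z => E 1 k (usubmx z))).
apply: eq_bigr => k _; apply: drop_right; first exact: (pd_dsubmx_r (stereo b2 k)).
exact: (pd_mx_usubmx_r (fun z => E (-1) k (usubmx z))).
Qed.

Let Gam x := @ext_connection R (d + 2) 2 (@ext_connection R d 2 (nabla x)).
Let Jx := in_chart (J_X g I J K) i.
Let DJ x a := pd_mx a Jx x + gen_connection (Gam x) a *m Jx x
  - Jx x *m gen_connection (Gam x) a.

(** The connection is flat along the spheres and [J_S] is constant, so nabla J lives in the
    M-block. *)
Let DJ_embed N x a S :
  W x -> gen_connection (Gam x) a = gprod (gprod S 0) 0 ->
  pd_mx a Fb x + S *m Fb x - Fb x *m S = N ->
  DJ x a = gprod (gprod N 0) 0.
Proof.
move=> Wx GE <-.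
have JE : Jx x = gprod (gprod (Fb x) (J_S R)) (J_S R) := J_X_field Wx.
have dJE : pd_mx a Jx x = gprod (gprod (pd_mx a Fb x) 0) 0.
  apply: etrans (pd_mx_eq_on a open_W Wx J_X_field) _.
  apply: etrans (pd_mx_gprod a x (fun y => gprod (Fb y) (J_S R)) (fun=> J_S R)) _.
  rewrite (pd_mx_cst a x (J_S R)); congr (gprod _ _).
  apply: etrans (pd_mx_gprod a x Fb (fun=> J_S R)) _.
  by rewrite (pd_mx_cst a x (J_S R)).
rewrite /DJ GE JE dJE; move: (pd_mx a Fb x) (Fb x) => dF F.
by rewrite !gprodM !mulmx0 !mul0mx !gprodBl !gprodDl.
Qed.

Let covariant_sum p (G : 'M[R]_p) (c : 'I_3 -> R) (B dB : 'I_3 -> 'M[R]_p) :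
  (forall k, dB k + G *m B k - B k *m G = 0) ->
  \sum_k c k *: dB k + G *m (\sum_k c k *: B k) - (\sum_k c k *: B k) *m G = 0.
Proof.
move=> h; rewrite mulmx_sumr mulmx_suml -big_split -sumrB big1 // => k _.
by rewrite /= -scalemxAr -scalemxAl -scalerDr -scalerBr h scaler0.
Qed.

Let covariant_add p (G B B' dB dB' : 'M[R]_p) :
  dB + G *m B - B *m G = 0 -> dB' + G *m B' - B' *m G = 0 ->
  (dB + dB') + G *m (B + B') - (B + B') *m G = 0.
Proof.
move=> h h'; rewrite mulmxDr mulmxDl -[RHS](addr0 0) -[X in _ = X + _]h -[X in _ = _ + X]h'.
by mx_ring.
Qed.

Let DJ_M x a : W x -> DJ x (lshift 2 (lshift 2 a)) = 0.
Proof.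
move=> Wx; rewrite -!gprod0; apply: (DJ_embed (S := gen_connection (nabla x) a)) => //.
  by rewrite /Gam !gen_connection_l.
rewrite pd_Fb_M //; apply: covariant_add; apply: covariant_sum => k; exact: E_parallel.
Qed.

Let DJ_1 x a : W x -> DJ x (lshift 2 (rshift d a)) =
  gprod (gprod (\sum_k pd a (stereo b1 k) (dsubmx (usubmx x)) *: E 1 k (pm x)) 0) 0.
Proof.
move=> Wx; apply: (DJ_embed (S := 0)) => //.
  by rewrite /Gam gen_connection_l gen_connection_r !gprod0.
by rewrite mul0mx mulmx0 subr0 addr0 pd_Fb_1.
Qed.

Let DJ_2 x a : W x -> DJ x (rshift (d + 2) a) =
  gprod (gprod (\sum_k pd a (stereo b2 k) (dsubmx x) *: E (-1) k (pm x)) 0) 0.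
Proof.
move=> Wx; apply: (DJ_embed (S := 0)) => //.
  by rewrite /Gam gen_connection_r !gprod0.
by rewrite mul0mx mulmx0 subr0 addr0 pd_Fb_2.
Qed.

Local Notation rc := (real_complex R).
Local Notation toC := (map_mx rc).

Let emb (v : 'cV[R[i]]_(d + d)) : 'cV[R[i]]_(d + 2 + 2 + (d + 2 + 2)) := gpair (gpair v 0) 0.

Let emb_sum n (t : 'I_n -> R[i]) (v : 'I_n -> 'cV[R[i]]_(d + d)) :
  \sum_a t a *: emb (v a) = emb (\sum_a t a *: v a).
Proof.
have eD u u' : emb (u + u') = emb u + emb u'.
  by rewrite /emb -!gpairD !addr0.
have eZ c u : emb (c *: u) = c *: emb u.
  by rewrite /emb -!gpairZ !scaler0.
have e0 : emb 0 = 0 by rewrite /emb !gpair0.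
by rewrite (big_morph emb eD e0); apply: eq_bigr => a _; rewrite eZ.
Qed.

Let toC_gprod S (w : 'cV[R[i]]_(d + 2 + 2 + (d + 2 + 2))) :
  toC (gprod (gprod S 0) 0) *m w = emb (toC S *m gfst (gfst w)).
Proof. by rewrite !map_gprod !map_mx0 !gprod_mulv !mul0mx. Qed.

Let TC k x := toC (Tx k (pm x)).

Let TCE k x : TC k x =
  pick3 (toC (in_chart I i0 (pm x))) (toC (in_chart J i0 (pm x))) (toC (in_chart K i0 (pm x))) k.
Proof. by rewrite /TC TxE; case: k => -[|[|[|//]]]. Qed.

Let QC x : W x -> quaternionic (toC (in_chart I i0 (pm x)))
  (toC (in_chart J i0 (pm x))) (toC (in_chart K i0 (pm x))).
Proof. by move=> Wx; apply: map_quaternionic; exact: (hk_quaternionic hk (psi_dom mA Wx)). Qed.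

Let toC_lincomb eps (r : 'I_3 -> R) x :
  toC (\sum_k r k *: E eps k (pm x)) =
  \sum_k rc (r k) *: bihermitian (rc eps) (toC (gx (pm x))) (TC k x).
Proof.
rewrite map_mx_sum /=; apply: eq_bigr => k _.
by rewrite map_mxZ map_bihermitian.
Qed.

(** The hypotheses say that the graph component of w0 is of type (0,1) for the structure with
    coordinate y, and that t is of type (0,1) on the sphere. *)
Let dir_vanish x (w0 : 'cV[R[i]]_(d + d)) b y eps (t : 'cV[R[i]]_2) : W x ->
  (\sum_k rc (stereo b k y) *: TC k x) *m (graph_row eps (toC (gx (pm x))) *m w0) =
    - 'i%C *: (graph_row eps (toC (gx (pm x))) *m w0) ->
  t 1 0 = 'i%C * t 0 0 ->
  \sum_a t a 0 *: ((\sum_k rc (pd a (stereo b k) y) *: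
    bihermitian eps (toC (gx (pm x))) (TC k x)) *m w0) = 0.
Proof.
move=> Wx; set p := graph_row _ _ *m w0 => hp ht.
have Q := QC Wx.
apply: (bihermitian_family (t := fun a => t a 0)); rewrite -/p.
have -> : \sum_a t a 0 *: (\sum_k rc (pd a (stereo b k) y) *: (TC k x *m p)) =
    \sum_a t a 0 *: \sum_k rc (pd a (stereo b k) y) *:
      (pick3 (toC (in_chart I i0 (pm x))) (toC (in_chart J i0 (pm x)))
             (toC (in_chart K i0 (pm x))) k *m p).
  by apply: eq_bigr => a _; congr (_ *: _); apply: eq_bigr => k _; rewrite TCE.
apply: (stereo_kernel (f := rc) (imag_sq R) Q) ht.
rewrite -[RHS]hp mulmx_suml; apply: eq_bigr => k _.
by rewrite TCE -scalemxAl.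
Qed.

Let J_X_parallel x (w z : 'cV[R[i]]_(d + 2 + 2 + (d + 2 + 2))) : W x ->
  toC (Jx x) *m w = 'i%C *: w -> toC (Jx x) *m z = 'i%C *: z ->
  \sum_a z (lshift (d + 2 + 2) a) 0 *: (toC (DJ x a) *m w) = 0.
Proof.
move=> Wx; have -> : Jx x = gprod (gprod (Fb x) (J_S R)) (J_S R) := J_X_field Wx.
rewrite !map_gprod => /gprod_eigen[/gprod_eigen[Fw _] _].
move=> /gprod_eigen[/gprod_eigen[_ /J_S_eigen z1] /J_S_eigen z2].
have gCu : toC (gx (pm x)) \in unitmx by rewrite map_unitmx; exact: gu.
have two0C : 2 != 0 :> R[i] by rewrite pnatr_eq0.
set w0 := gfst (gfst w) in Fw.
have [Fw1 Fw2] : (\sum_k rc (c1 k x) *: TC k x) *m (graph_row 1 (toC (gx (pm x))) *m w0) =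
      - 'i%C *: (graph_row 1 (toC (gx (pm x))) *m w0) /\
    (\sum_k rc (c2 k x) *: TC k x) *m (graph_row (-1) (toC (gx (pm x))) *m w0) =
      - 'i%C *: (graph_row (-1) (toC (gx (pm x))) *m w0).
  apply: bihermitian_eigen => //; rewrite -[RHS]Fw /Fb map_mxD !toC_lincomb rmorph1 rmorphN1.
  rewrite !bihermitian_sum; congr ((_ + _) *m _); apply: eq_bigr => k _; exact: bihermitianZ.
have emb0 : emb 0 = 0 by rewrite /emb !gpair0.
(* [a'] places the two coordinates of a sphere among those of X, so that one statement serves both
   spheres. *)
have vanish b y eps (t : 'cV[R[i]]_2) r (a' : 'I_2 -> 'I_(d + 2 + 2)) :
    (forall a, DJ x (a' a) = gprod (gprod (\sum_k r a k *: E eps k (pm x)) 0) 0) ->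
    (forall a k, r a k = pd a (stereo b k) y) ->
    (forall a, z (lshift (d + 2 + 2) (a' a)) 0 = t a 0) ->
    (\sum_k rc (stereo b k y) *: TC k x) *m (graph_row (rc eps) (toC (gx (pm x))) *m w0) =
      - 'i%C *: (graph_row (rc eps) (toC (gx (pm x))) *m w0) ->
    t 1 0 = 'i%C * t 0 0 ->
    \sum_a z (lshift (d + 2 + 2) (a' a)) 0 *: (toC (DJ x (a' a)) *m w) = 0.
  move=> DJE rE tE hp ht; rewrite -[RHS]emb0 -(dir_vanish Wx hp ht).
  apply: etrans (emb_sum _ _); apply: eq_bigr => a _.
  have lin : toC (\sum_k r a k *: E eps k (pm x)) = \sum_k rc (pd a (stereo b k) y) *:
      bihermitian (rc eps) (toC (gx (pm x))) (TC k x).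
    by apply: (etrans (toC_lincomb _ _ _)); apply: eq_bigr => k _; rewrite rE.
  have step := etrans (congr1 (fun X => toC X *m w) (DJE a)) (toC_gprod _ w).
  exact: (congr2 *:%R (tE a) (etrans step (congr1 (fun X => emb (X *m w0)) lin))).
have S0 : \sum_(a < d) z (lshift (d + 2 + 2) (lshift 2 (lshift 2 a))) 0 *:
    (toC (DJ x (lshift 2 (lshift 2 a))) *m w) = 0.
  by apply: big1 => a _; rewrite DJ_M // map_mx0 mul0mx scaler0.
have S1 := vanish b1 _ 1 (\col_a gsnd (gfst z) (lshift 2 a) 0) _
  (fun a => lshift 2 (rshift d a))
  (fun a => DJ_1 a Wx) (fun a k => erefl).
have S2 := vanish b2 _ (-1) (\col_a gsnd z (lshift 2 a) 0) _
  (fun a => rshift (d + 2) a)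
  (fun a => DJ_2 a Wx) (fun a k => erefl).
rewrite rmorph1 in S1; rewrite rmorphN1 in S2.
(* The sum over directions splits into those of M, of the first sphere and of the second. *)
rewrite big_split_ord big_split_ord /= [X in X + _ + _]S0 [X in _ + X + _]S1; last first.
- by rewrite [LHS]mxE [X in _ * X]mxE; exact: z1.
- exact: Fw1.
- by move=> a; rewrite [RHS]mxE /gsnd /gfst col_mxKu col_mxEu !mxE.
rewrite [X in _ + X]S2 ?addr0 //; last first.
- by rewrite [LHS]mxE [X in _ * X]mxE; exact: z2.
- by move=> a; rewrite [RHS]mxE /gsnd col_mxEu !mxE.
Qed.

Lemma J_X_courant (V : set 'cV[R]_(d + 2 + 2)) 
    (u v : 'cV[R]_(d + 2 + 2) -> 'cV[R[i]]_(d + 2 + 2 + (d + 2 + 2))) :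
  open V -> V `<=` codom_chart i -> smoothC_on V u -> smoothC_on V v ->
  sectionL (J_X g I J K) i V u -> sectionL (J_X g I J K) i V v ->
  sectionL (J_X g I J K) i V (courantC u v).
Proof.
move=> oV VU su sv Ju Jv x Vx.
have Wx := sub_codom_W (VU x Vx).
have sJ : smooth_on V Jx := sub_smooth_on VU smooth_J_X.
have dx : dom i (psi i x) := psi_dom (X_manifold mA) (VU x Vx).
apply: (integrable_criterion (Gam := Gam x) oV Vx sJ _ _ _ _ su sv Ju Jv).
- exact: (J_X_sq hk dx).
- exact: (J_X_skew hk dx).
- apply: ext_connection_sym; apply: ext_connection_sym => a b k.
  exact: (levi_civita_torsion_free mA (hk_riemannian hk) Wx).
- by move=> w z; exact: (J_X_parallel Wx).
Qed.

End Field.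

Theorem theorem12 (R : realType) (n : nat) (M : topologicalType)
    (A : atlas R M (4 * n)) (g I J K : tensor A (4 * n)) :
  smooth_manifold A ->
  hyperkahler g I J K ->
  gen_complex_manifold (J_X g I J K).
Proof.
move=> mA hk; split.
- exact: X_manifold.
- split.
  + exact: J_X_tensor.
  + by move=> [[i0 b1] b2]; exact: smooth_J_X.
  + move=> i p ip; apply: orthogonalE; [exact: (J_X_sq hk ip)|exact: (J_X_skew hk ip)].
  + by move=> i p ip; exact: (J_X_sq hk ip).
- move=> [[i0 b1] b2] V oV VU u v su sv Ju Jv.
  exact: (J_X_courant mA hk oV VU su sv Ju Jv).
Qed.
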